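(* Let $n\ge 2$ be an integer, let $\lambda,\mu\in\mathbb{R}$ satisfy $\lambda+2\mu>0$ and $\mu>0$, let $N\in\{1,\dots,n\}$, let $(f_0,f_1)\in\{H^1(\mathbb{R}^n)\cap L^{1,1}(\mathbb{R}^n)\}^n\times\{L^2(\mathbb{R}^n)\cap L^{1,1}(\mathbb{R}^n)\}^n$, and let $u={}^T(u_1,\dots,u_n)$ be the solution of $$\partial_t^2u-\mu\Delta u-(\lambda+\mu)\nabla(\operatorname{div}u)=0\ (t>0,\ x\in\mathbb{R}^n),\qquad u(0,x)=f_0(x),\quad \partial_tu(0,x)=f_1(x)\ (x\in\mathbb{R}^n).$$ Then the following statements hold. For $n=2$ and $t\ge0$, $$\|u_N(t)\|_{L^2}\le C\big(\|f_0\|_2+|M_1|\sqrt{\log(t+2)}+\|f_1\|_{1,1}\big).$$ Furthermore, suppose that $\lambda+\mu\neq 0$ and $t\gg1$. (i) When $n=2$, if $\sum_{j=0}^1\sum_{k=1}^2|P_{jk}|\neq 0$, then $$\|u_N(t)\|_{L^2}\ge C\Big(|M_0|+|M_1|\sqrt{\log(t+2)}+\sum_{j=0}^1\sum_{k=1}^2|P_{jk}|\Big).$$ (ii) When $n\ge 3$, if either $|\mathbb{P}_{0,N}|\neq 0$ or $|\mathbb{P}_{1,N}|\neq 0$ holds, then $$\|u_N(t)\|_{L^2}\ge C\big(|M_0|+|M_1|+|\mathbb{P}_{0,N}|+|\mathbb{P}_{1,N}|\big).$$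
   Context: All functions are real valued; $f_j={}^T(f_{j1},\dots,f_{jn})$ for $j=0,1$. $L^{1,1}(\mathbb{R}^n)=\{f\in L^1(\mathbb{R}^n):(1+|x|)f\in L^1(\mathbb{R}^n)\}$ with norm $\|f\|_{L^{1,1}}=\|(1+|x|)f\|_{L^1}$. For a vector function $f={}^T(f_1,\dots,f_n)$, $\|f\|_2:=\sum_{k=1}^n\|f_k\|_{L^2}$ and $\|f\|_{1,1}:=\sum_{k=1}^n\|f_k\|_{L^{1,1}}$. $C$ denotes a generic positive constant, which may differ between occurrences, and ''$t\gg1$'' means for all sufficiently large $t$. Moments, for $j=0,1$ and $k,\ell=1,\dots,n$: $m_{jk}:=\int_{\mathbb{R}^n}f_{jk}(x)\,dx$, $|M_j|:=\sum_{k=1}^n|m_{jk}|$; $p_{jk,\ell}:=-\int_{\mathbb{R}^n}x_\ell f_{jk}(x)\,dx$, $P_{jk}:={}^T(p_{jk,1},\dots,p_{jk,n})$, $|P_{jk}|:=\sum_{\ell=1}^n|p_{jk,\ell}|$; and $$|\mathbb{P}_{j,N}|:=|P_{jN}|+\sum_{k=1}^n|p_{jk,N}|+\sum_{k=1}^n|p_{jk,k}|+\sum_{\substack{1\le k<\ell\le n\\ k\ne N,\ \ell\neq N}}|p_{jk,\ell}+p_{j\ell,k}|.$$ The solution is the one given in Fourier space by $$\hat u(t,\xi)=\cos(t\alpha_1|\xi|)P\hat f_0+\frac{\sin(t\alpha_1|\xi|)}{\alpha_1|\xi|}P\hat f_1+\cos(t\alpha_2|\xi|)(I-P)\hat f_0+\frac{\sin(t\alpha_2|\xi|)}{\alpha_2|\xi|}(I-P)\hat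 f_1,$$ where $\alpha_1=\sqrt{\lambda+2\mu}$, $\alpha_2=\sqrt{\mu}$, $P=\frac{\xi}{|\xi|}\otimes\frac{\xi}{|\xi|}$, and $I$ is the $n\times n$ identity matrix. *)

(* Defs.v *)
From HB Require Import structures.
From mathcomp Require Import all_boot all_order all_algebra complex.
From mathcomp Require Import all_classical all_reals all_analysis.
Set Implicit Arguments.
Unset Strict Implicit.
Unset Printing Implicit Defensive.
Import Order.TTheory GRing.Theory Num.Theory.
Import numFieldNormedType.Exports.
Local Open Scope classical_set_scope.
Local Open Scope ring_scope.

(* R^n, with the product Borel sigma-algebra of the library on tuples. *)
Notation Rn R n := (n.-tuple (measurableTypeR R)).

Definition Rn_cons (R : realType) n (z : measurableTypeR R * Rn R n)
  : Rn R n.+1 := [tuple of z.1 :: z.2].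

Lemma measurable_Rn_cons (R : realType) n :
  measurable_fun [set: measurableTypeR R * Rn R n] (@Rn_cons R n).
Proof. exact: measurable_cons. Qed.

Definition cons_measure (R : realType) n
    (m : {sigma_finite_measure set (Rn R n) -> \bar R}) :
    set (Rn R n.+1) -> \bar R :=
  pushforward (@lebesgue_measure R \x m)%E (@Rn_cons R n).

Section cons_measure.
Context (R : realType) (n : nat).
Variable m : {sigma_finite_measure set (Rn R n) -> \bar R}.

Let cons_measure0 : cons_measure m set0 = 0%E.
Proof. by rewrite /cons_measure /pushforward preimage_set0 measure0. Qed.

Let cons_measure_ge0 A : (0 <= cons_measure m A)%E.
Proof. exact: integral_ge0. Qed.

Let cons_measure_sigma_additive : semi_sigma_additive (cons_measure m).
Proof.
have mcons A : measurable A -> measurable (@Rn_cons R n @^-1` A).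
  by move=> mA; rewrite -[X in measurable X]setTI; exact: measurable_Rn_cons.
move=> F mF tF mUF; rewrite /cons_measure /pushforward preimage_bigcup.
apply: measure_semi_sigma_additive => [i||]; first exact: mcons.
- apply/trivIsetP => /= i j _ _ ij; rewrite -preimage_setI.
  by move/trivIsetP : tF => /(_ _ _ _ _ ij) ->//; rewrite preimage_set0.
- by rewrite -preimage_bigcup; exact: mcons.
Qed.

HB.instance Definition _ := isMeasure.Build _ _ _ (cons_measure m)
  cons_measure0 cons_measure_ge0 cons_measure_sigma_additive.

Let cons_measure_sigma_finite : sigma_finite setT (cons_measure m).
Proof.
have /sigma_finiteP[F [FT ndF Ffin]] := sigma_finiteT (@lebesgue_measure R).
have /sigma_finiteP[G [GT ndG Gfin]] := sigma_finiteT m.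
pose uncons (x : Rn R n.+1) : measurableTypeR R * Rn R n :=
  (thead x, [tuple of behead x]).
have muncons : measurable_fun setT uncons.
  apply/measurable_fun_pair; first exact: measurable_tnth.
  exact: measurable_behead.
have consK z : uncons (Rn_cons z) = z.
  by case: z => a x; congr pair; apply: val_inj.
exists (fun i => uncons @^-1` (F i `*` G i)).
  apply/esym/seteqP; split=> // x _.
  have [i _ Fi] : (\bigcup_i F i) (thead x) by rewrite -FT.
  have [j _ Gj] : (\bigcup_j G j) [tuple of behead x] by rewrite -GT.
  exists (maxn i j) => //; split => /=.
    by move: Fi; exact/subsetPset/ndF/leq_maxl.
  by move: Gj; exact/subsetPset/ndG/leq_maxr.
move=> i; have [mF Foo] := Ffin i; have [mG Goo] := Gfin i; split.
  by rewrite -[X in measurable X]setTI; apply: muncons => //; exact: measurableX.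
rewrite /cons_measure /pushforward -comp_preimage.
rewrite (_ : uncons \o _ = id); last by apply/funext => z /=; rewrite consK.
by rewrite preimage_id product_measure1E// lte_mul_pinfty// ge0_fin_numE.
Qed.

HB.instance Definition _ := Measure_isSigmaFinite.Build _ _ _
  (cons_measure m) cons_measure_sigma_finite.

End cons_measure.

Fixpoint lebesgueRn (R : realType) n :
    {sigma_finite_measure set (Rn R n) -> \bar R} :=
  match n with
  | 0 => dirac ([tuple] : Rn R 0)
  | n'.+1 => cons_measure (lebesgueRn R n')
  end.

Section function_spaces.
Context (R : realType) (n : nat).
Notation mu := (lebesgueRn R n).
Implicit Types f g v : Rn R n -> R.

Definition dotRn (x y : Rn R n) : R := \sum_(i < n) tnth x i * tnth y i.

Definition normRn (x : Rn R n) : R := Num.sqrt (dotRn x x).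

Definition isL2 f : Prop := f \in Lfun mu 2%:E.

Definition isL11 f : Prop :=
  f \in Lfun mu 1 /\ (fun x => (1 + normRn x) * f x) \in Lfun mu 1.

(* Real-valued norms, to be used on members of the corresponding spaces. *)
Definition normL2 f : R := fine ('N[mu]_2%:E[EFin \o f])%E.

Definition normL11 f : R :=
  fine ('N[mu]_1[EFin \o (fun x => (1 + normRn x) * f x)%R])%E.

(* Test functions live on row vectors, which carry the topology and the
   directional derivatives; rowRn transports points from tuples. *)
Definition rowRn (x : Rn R n) : 'rV[R]_n := \row_i (tnth x i : R).

Definition partial (i : 'I_n) (phi : 'rV[R]_n -> R) : 'rV[R]_n -> R :=
  fun x => 'D_(delta_mx 0 i) phi x.

Fixpoint isCk (k : nat) (phi : 'rV[R]_n -> R) : Prop :=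
  match k with
  | 0 => continuous phi
  | k'.+1 => continuous phi /\
      forall i, (forall x, derivable phi x (delta_mx 0 i)) /\
                isCk k' (partial i phi)
  end.

Definition test_function (phi : 'rV[R]_n -> R) : Prop :=
  (forall k, isCk k phi) /\ exists M : R, forall x, M < `|x| -> phi x = 0.

Definition weak_partial (i : 'I_n) f g : Prop :=
  forall phi, test_function phi ->
    \int[mu]_x (f x * partial i phi (rowRn x)) =
    - \int[mu]_x (g x * phi (rowRn x)).

Definition isH1 f : Prop :=
  isL2 f /\ forall i, exists2 g, isL2 g & weak_partial i f g.

(* \hat f(xi) = \int e^{- i x.xi} f(x) dx, for integrable f *)
Definition fourier f (xi : Rn R n) : R[i] :=
  Complex (\int[mu]_x (cos (dotRn x xi) * f x))
          (- \int[mu]_x (sin (dotRn x xi) * f x)).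

Definition normL2C (g : Rn R n -> R[i]) : \bar R :=
  ('N[mu]_2%:E[EFin \o (fun xi => ComplexField.Normc.normc (g xi))])%E.

(* g is the L^2 (Plancherel) Fourier transform of v: the limit in L^2 of the
   Fourier integrals of the truncations of v to the balls of radius k. *)
Definition is_fourierL2 v (g : Rn R n -> R[i]) : Prop :=
  [/\ isL2 v,
      isL2 (fun xi => complex.Re (g xi)),
      isL2 (fun xi => complex.Im (g xi)) &
      normL2C (fun xi => fourier (v \_ [set x | normRn x <= k%:R]) xi - g xi)
        @[k --> \oo] --> 0%E].

End function_spaces.

Section elastic_wave.
Context (R : realType) (n : nat).
Notation mu := (lebesgueRn R n).
Implicit Type f : 'I_n -> Rn R n -> R.

Definition vnorm2 f : R := \sum_(k < n) normL2 (f k).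

Definition vnorm11 f : R := \sum_(k < n) normL11 (f k).

Definition fourierv f (xi : Rn R n) : 'cV[R[i]]_n := \col_k fourier (f k) xi.

(* P = (xi / |xi|) \otimes (xi / |xi|); its value at the null set xi = 0 is
   irrelevant. *)
Definition projmx (xi : Rn R n) : 'M[R[i]]_n :=
  \matrix_(k, l)
    (((tnth xi k / normRn xi) * (tnth xi l / normRn xi))%:C)%C.

Definition uhat (lambda mu0 : R) f0 f1 (t : R) (xi : Rn R n) : 'cV[R[i]]_n :=
  let a1 := Num.sqrt (lambda + 2 * mu0) in
  let a2 := Num.sqrt mu0 in
  let r := normRn xi in
  let P := projmx xi in
  ((cos (t * a1 * r))%:C)%C *: (P *m fourierv f0 xi) +
  ((sin (t * a1 * r) / (a1 * r))%:C)%C *: (P *m fourierv f1 xi) +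
  ((cos (t * a2 * r))%:C)%C *: ((1%:M - P) *m fourierv f0 xi) +
  ((sin (t * a2 * r) / (a2 * r))%:C)%C *: ((1%:M - P) *m fourierv f1 xi).

(* u solves the Cauchy problem
     u_tt - mu0 Delta u - (lambda + mu0) grad (div u) = 0,
     u(0) = f0, u_t(0) = f1
   in the sense that \hat u(t) is given by the explicit Fourier formula. *)
Definition elastic_solution (lambda mu0 : R) f0 f1
    (u : R -> 'I_n -> Rn R n -> R) : Prop :=
  forall t, 0 <= t -> forall k,
    is_fourierL2 (u t k) (fun xi => uhat lambda mu0 f0 f1 t xi k 0).

Definition moment f (k : 'I_n) : R := \int[mu]_x f k x.

Definition absM f : R := \sum_(k < n) `|moment f k|.

Definition moment1 f (k l : 'I_n) : R := - \int[mu]_x (tnth x l * f k x).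

Definition absP f (k : 'I_n) : R := \sum_(l < n) `|moment1 f k l|.

Definition absPN f (N : 'I_n) : R :=
  absP f N + \sum_(k < n) `|moment1 f k N| + \sum_(k < n) `|moment1 f k k| +
  \sum_(k < n) \sum_(l < n | [&& (k < l)%N, k != N & l != N])
    `|moment1 f k l + moment1 f l k|.

End elastic_wave.

(* Main.v *)
(* By Plancherel, every bound is a bound on the integral of |\hat u_N(t)|^2,
   whose real and imaginary parts are
     cos(t a1 r) A + sin(t a1 r) B / (a1 r)
       + cos(t a2 r) A' + sin(t a2 r) B' / (a2 r),   r = |xi|,
   with coefficients made of the cosine, resp. sine, transforms of f_0 and f_1.
   These transforms are Lipschitz, with the L^{1,1} norms as constants.

   Upper bound: with s = 1 / (t + 2), the squares of the sine quotients are at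
   most a multiple of 1 / (s^2 + r^2), so only the value M_1 of \hat f_1 at 0
   matters near the origin, and the integral of 1 / (s^2 + r^2) over the strip
   |xi_1| <= 1 of the plane is O(log (t + 2)).  The constant may depend on the
   data, which absorbs the L^2 norm of f_1 into its L^{1,1} norm.

   Lower bounds: on a small cube the coefficients are almost constant, and the
   square of a trigonometric polynomial in t r with the two speeds a1 <> a2 has
   a positive mean.  If all coefficients vanished on a half space, then
   differentiating the sine transforms at 0 along rays would make a linear and
   a quadratic form in the first moments vanish identically, which is
   P_{j,N} = 0.  In the plane with M_1 <> 0, the dyadic rescalings of one cube
   towards the origin contribute equally, and about log t of them are available.

   Plancherel itself is obtained by damping |\hat v|^2 with a product of
   one-dimensional exponentials, which turns its integral into the average of
   v(x) v(y) against a product of Poisson kernels. *)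

Require Import Defs.
From HB Require Import structures.
From mathcomp Require Import all_boot all_order all_algebra complex ring lra.
From mathcomp Require Import all_classical all_reals all_analysis.
From mathcomp Require Import measurable_realfun.
Import Order.TTheory GRing.Theory Num.Theory.
Import numFieldNormedType.Exports.
Set Implicit Arguments.
Unset Strict Implicit.
Unset Printing Implicit Defensive.
Local Open Scope classical_set_scope.
Local Open Scope ring_scope.

(** All constants are chosen after the data, so a lower bound by one fixed positive number yields a
    bound by any expression free of t. Only the factor sqrt(log(t + 2)) needs quantitative work.
    First moments show up in the imaginary part of the transformed solution (sine transforms), total
    moments in the real part (cosine transforms at 0); each lower bound keeps one of the two parts
    and discards the other.

    The solution is given only through an L^2 limit of truncated Fourier integrals. The exact
    Plancherel identity is therefore proved for integrable, square integrable functions, and two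
    inequalities with a lost factor 2 carry it to the limit.

    In Plancherel's identity, the approach of the kernels to the identity is measured by a quadratic
    oscillation [osc]. This quantity passes to product kernels through rectangles, extends from open
    sets to measurable sets of finite measure by regularity and Dynkin's theorem, and is continuous
    in L^2. The whole argument thus reduces to the Poisson kernel on the line and an open set. *)

Section integral_Rn.
Context {R : realType}.
Local Notation leb := (@lebesgue_measure R).
Local Notation mu n := (lebesgueRn R n).

Lemma measurable_dotRn n : measurable_fun [set: Rn R n * Rn R n]
  (fun z => dotRn z.1 z.2).
Proof.
rewrite /dotRn; apply: measurable_sum => i.
apply: measurable_funM.
  by apply: (@measurableT_comp _ _ _ _ _ _ (fun x : Rn R n => tnth x i) _ fst) => //;
  exact: measurable_tnth.
by apply: (@measurableT_comp _ _ _ _ _ _ (fun x : Rn R n => tnth x i) _ snd) => //;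
  exact: measurable_tnth.
Qed.

Lemma measurable_normRn n : measurable_fun [set: Rn R n] (@normRn R n).
Proof.
have sqrt_cont : continuous (@Num.sqrt R) by exact: sqrt_continuous.
apply: (measurableT_comp (continuous_measurable_fun sqrt_cont)).
rewrite [X in measurable_fun _ X](_ : _ = (fun z => dotRn z.1 z.2) \o (fun x => (x, x))) //.
by apply: measurableT_comp; [exact: measurable_dotRn | exact: measurable_fun_pair].
Qed.

Local Open Scope ereal_scope.

Lemma ge0_integral_cons n (f : Rn R n.+1 -> \bar R) :
  measurable_fun setT f -> (forall x, 0 <= f x) ->
  \int[mu n.+1]_x f x = \int[leb]_a \int[mu n]_x f (Rn_cons (a, x)).
Proof.
move=> mf f0 /=; rewrite /cons_measure ge0_integral_pushforward//; last first.
  exact: measurable_Rn_cons.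
rewrite preimage_setT (fubini_tonelli1 (f \o (@Rn_cons R n)))//.
  by apply: measurableT_comp => //; exact: measurable_Rn_cons.
by move=> x; exact: f0.
Qed.

(** The order with the first coordinate innermost serves the cube estimates, where oscillations are
    averaged along the first axis with the other coordinates fixed. *)
Lemma ge0_integral_cons_sym n (f : Rn R n.+1 -> \bar R) :
  measurable_fun setT f -> (forall x, 0 <= f x) ->
  \int[mu n.+1]_x f x = \int[mu n]_x \int[leb]_a f (Rn_cons (a, x)).
Proof.
move=> mf f0 /=; rewrite /cons_measure ge0_integral_pushforward//; last first.
  exact: measurable_Rn_cons.
rewrite preimage_setT (fubini_tonelli2 (f \o (@Rn_cons R n)))//.
  by apply: measurableT_comp => //; exact: measurable_Rn_cons.
by move=> x; exact: f0.
Qed.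

Lemma integral_cons n (f : Rn R n.+1 -> \bar R) :
  (mu n.+1).-integrable setT f ->
  \int[mu n.+1]_x f x = \int[leb]_a \int[mu n]_x f (Rn_cons (a, x)).
Proof.
move=> /integrableP[mf foo].
have mg : measurable_fun setT (f \o @Rn_cons R n).
  by apply: measurableT_comp => //; exact: measurable_Rn_cons.
have ig : (leb \x mu n).-integrable setT (f \o @Rn_cons R n).
  apply/integrable12ltyP => //; move: foo; rewrite ge0_integral_cons//.
  exact: measurableT_comp.
rewrite /= /cons_measure integral_pushforward//; last exact: measurable_Rn_cons.
by rewrite preimage_setT -integral12_prod_meas1.
Qed.

End integral_Rn.

(** * Oscillation against Markov kernels *)

Lemma measurable_EFin d (T : measurableType d) (R : realType) (D : set T) (f : T -> R) :
  measurable_fun D f -> measurable_fun D (fun x => (f x)%:E).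
Proof. by move=> mf; apply/measurable_EFinP. Qed.

Ltac mfun := repeat first
  [ assumption | exact: measurable_cst
  | apply: measurable_EFin
  | apply: measurable_funX | apply: measurable_funB | apply: measurable_funD
  | apply: measurable_funM | apply: measurable_indic ].

Section oscillation.
Context d (T : measurableType d) (R : realType).
Variable m : {sigma_finite_measure set T -> \bar R}.
Variable k : T * T -> R.
Local Open Scope ereal_scope.

(** Twice the Dirichlet form of the Markov kernel [k]. When both marginals are 1 and v is square
    integrable, it is 2 |v|^2 minus twice the integral of v(x) v(y) k(x, y), with |v| the L^2 norm;
    so its vanishing in a limit says that these double integrals tend to |v|^2. *)
Definition osc (v : T -> R) : \bar R :=
  \int[m \x m]_z ((v z.1 - v z.2) ^+ 2 * k z)%:E.

Hypothesis mk : measurable_fun setT k.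
Hypothesis k0 : forall z, (0 <= k z)%R.
Hypothesis kl : forall x, \int[m]_y (k (x, y))%:E = 1.
Hypothesis kr : forall y, \int[m]_x (k (x, y))%:E = 1.

Lemma osc_ge0 (v : T -> R) : 0 <= osc v.
Proof. by apply: integral_ge0 => z _; rewrite lee_fin mulr_ge0// sqr_ge0. Qed.

Lemma measurable_comp_fst (v : T -> R) : measurable_fun setT v -> measurable_fun setT (fun z : T * T => v z.1 : R).
Proof. by move=> mv; apply: (measurableT_comp mv). Qed.

Lemma measurable_comp_snd (v : T -> R) : measurable_fun setT v -> measurable_fun setT (fun z : T * T => v z.2 : R).
Proof. by move=> mv; apply: (measurableT_comp mv). Qed.

Lemma measurable_osc_integrand (v : T -> R) : measurable_fun setT v ->
  measurable_fun setT (fun z : T * T => ((v z.1 - v z.2) ^+ 2 * k z)%:E).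
Proof.
move=> mv; have := measurable_comp_fst mv; have := measurable_comp_snd mv => m2 m1.
by mfun.
Qed.

Lemma osc_add (v w : T -> R) : measurable_fun setT v -> measurable_fun setT w ->
  osc (fun x => v x + w x)%R <= 2%:E * osc v + 2%:E * osc w.
Proof.
move=> mv mw; rewrite /osc.
rewrite -!ge0_integralZl//; try exact: measurable_osc_integrand; try (by move=> z _; rewrite lee_fin mulr_ge0// sqr_ge0).
rewrite -ge0_integralD//; try (by move=> z _; rewrite mule_ge0// lee_fin mulr_ge0// sqr_ge0);
  try (by apply: emeasurable_funM => //; exact: measurable_osc_integrand).
apply: ge0_le_integral => //.
- by move=> z _; rewrite lee_fin mulr_ge0// sqr_ge0.
- by apply: (measurable_osc_integrand (v := fun x => v x + w x)%R); exact: measurable_funD.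
- by apply: emeasurable_funD; apply: emeasurable_funM => //; exact: measurable_osc_integrand.
- move=> z _; rewrite -!EFinM -EFinD lee_fin !mulrA -mulrDl ler_wpM2r//.
  rewrite -subr_ge0; set a := v z.1; set b := v z.2; set c := w z.1; set e := w z.2.
  rewrite [leRHS](_ : _ = ((a - b) - (c - e)) ^+ 2)%R ?sqr_ge0//; ring.
Qed.

Lemma osc_scale c (v : T -> R) : measurable_fun setT v ->
  osc (fun x => c * v x)%R = (c ^+ 2)%:E * osc v.
Proof.
move=> mv; rewrite /osc -ge0_integralZl//; last 3 first.
- exact: measurable_osc_integrand.
- by move=> z _; rewrite lee_fin mulr_ge0// sqr_ge0.
- by rewrite lee_fin sqr_ge0.
by apply: eq_integral => z _; rewrite -EFinM; congr EFin; ring.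
Qed.

Lemma integral_sqr_fst (v : T -> R) : measurable_fun setT v ->
  \int[m \x m]_z (v z.1 ^+ 2 * k z)%:E = \int[m]_x (v x ^+ 2)%:E.
Proof.
move=> mv; rewrite fubini_tonelli1//=; last 2 first.
- by have := measurable_comp_fst mv => mv1; mfun.
- by move=> z /=; rewrite lee_fin mulr_ge0// sqr_ge0.
apply: eq_integral => x _; rewrite /fubini_F/=.
under eq_integral do rewrite EFinM.
rewrite ge0_integralZl ?kl ?mule1// ?lee_fin ?sqr_ge0//.
- by mfun; apply: (measurableT_comp mk); exact: measurable_pair1.
- by move=> y _; rewrite lee_fin.
Qed.

Lemma integral_sqr_snd (v : T -> R) : measurable_fun setT v ->
  \int[m \x m]_z (v z.2 ^+ 2 * k z)%:E = \int[m]_x (v x ^+ 2)%:E.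
Proof.
move=> mv; rewrite fubini_tonelli2//=; last 2 first.
- by have := measurable_comp_snd mv => mv1; mfun.
- by move=> z /=; rewrite lee_fin mulr_ge0// sqr_ge0.
apply: eq_integral => x _; rewrite /fubini_G/=.
under eq_integral do rewrite EFinM.
rewrite ge0_integralZl ?kr ?mule1// ?lee_fin ?sqr_ge0//.
- by mfun; apply: (measurableT_comp mk); exact: measurable_pair2.
- by move=> y _; rewrite lee_fin.
Qed.

(** From (a - b)^2 <= 2 a^2 + 2 b^2, each square being integrated against a kernel with unit
    marginals. The constant does not depend on the kernel, hence is uniform along a sequence of
    kernels. *)
Lemma osc_le (v : T -> R) : measurable_fun setT v ->
  osc v <= 4%:E * \int[m]_x (v x ^+ 2)%:E.
Proof.
move=> mv; have mv1 := measurable_comp_fst mv; have mv2 := measurable_comp_snd mv.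
have -> : 4%:E * \int[m]_x (v x ^+ 2)%:E =
  \int[m \x m]_z (2 * (v z.1 ^+ 2 * k z) + 2 * (v z.2 ^+ 2 * k z))%:E.
  under [RHS]eq_integral do rewrite EFinD.
  rewrite ge0_integralD//; last 4 first.
  - by move=> z _; rewrite lee_fin mulr_ge0// mulr_ge0// sqr_ge0.
  - by mfun.
  - by move=> z _; rewrite lee_fin mulr_ge0// mulr_ge0// sqr_ge0.
  - by mfun.
  under eq_integral do rewrite EFinM.
  under [X in _ = _ + X]eq_integral do rewrite EFinM.
  rewrite !ge0_integralZl//; try mfun;
    try (by move=> z _; rewrite lee_fin mulr_ge0// sqr_ge0).
  rewrite integral_sqr_fst// integral_sqr_snd// -ge0_muleDl// -EFinD.
  by congr (_%:E * _); ring.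
apply: ge0_le_integral => //.
- by move=> z _; rewrite lee_fin mulr_ge0// sqr_ge0.
- exact: measurable_osc_integrand.
- by mfun.
- move=> z _; rewrite lee_fin !mulrA -mulrDl ler_wpM2r// -subr_ge0.
  rewrite [leRHS](_ : _ = (v z.1 + v z.2) ^+ 2)%R ?sqr_ge0//; ring.
Qed.

End oscillation.

Record markov_kernels d (T : measurableType d) (R : realType)
    (m : {sigma_finite_measure set T -> \bar R}) (k : nat -> T * T -> R) : Prop :=
  MarkovKernels {
    mk_measurable : forall j, measurable_fun setT (k j) ;
    mk_ge0 : forall j z, 0 <= k j z ;
    mk_left : forall j x, (\int[m]_y (k j (x, y))%:E = 1)%E ;
    mk_right : forall j y, (\int[m]_x (k j (x, y))%:E = 1)%E }.

Section vanishing_oscillation.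
Context d (T : measurableType d) (R : realType).
Variable m : {sigma_finite_measure set T -> \bar R}.
Variable k : nat -> T * T -> R.
Hypothesis hk : markov_kernels m k.
Local Open Scope ereal_scope.

Definition vanishing_osc (v : T -> R) : Prop :=
  forall e : R, (0 < e)%R -> \forall j \near \oo, osc m (k j) v <= e%:E.

Lemma vanishing_osc_add (v w : T -> R) :
  measurable_fun setT v -> measurable_fun setT w ->
  vanishing_osc v -> vanishing_osc w -> vanishing_osc (fun x => v x + w x)%R.
Proof.
move=> mv mw Vv Vw e e0; have e4 : (0 < e / 4)%R by rewrite divr_gt0.
have Ov := Vv _ e4; have Ow := Vw _ e4; near=> j.
apply: (le_trans (osc_add m (mk_measurable hk j) (mk_ge0 hk j) mv mw)).
apply: (@le_trans _ _ (2%:E * (e / 4)%:E + 2%:E * (e / 4)%:E)).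
  by apply: leeD; apply: lee_wpmul2l => //; near: j.
by rewrite -!EFinM -EFinD lee_fin -mulrDl; lra.
Unshelve. all: by end_near. Qed.

Lemma vanishing_osc_scale c (v : T -> R) :
  measurable_fun setT v -> vanishing_osc v -> vanishing_osc (fun x => c * v x)%R.
Proof.
move=> mv Vv e e0; have c1 : (0 < c ^+ 2 + 1)%R by rewrite ltr_wpDl// sqr_ge0.
have /Vv Ov : (0 < e / (c ^+ 2 + 1))%R by rewrite divr_gt0.
near=> j.
rewrite osc_scale//; [|exact: (mk_measurable hk)|exact: (mk_ge0 hk)].
apply: (@le_trans _ _ ((c ^+ 2)%:E * (e / (c ^+ 2 + 1))%:E)).
  by apply: lee_wpmul2l; [rewrite lee_fin sqr_ge0|near: j].
rewrite -EFinM lee_fin mulrCA ger_pMr// ler_pdivrMr// mul1r; lra.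
Unshelve. all: by end_near. Qed.

Lemma vanishing_osc_sum I (s : seq I) (F : I -> T -> R) :
  (forall i, measurable_fun setT (F i)) -> (forall i, vanishing_osc (F i)) ->
  vanishing_osc (fun x => \sum_(i <- s) F i x)%R.
Proof.
move=> mF VF; elim: s => [|i s IH].
  under eq_fun do rewrite big_nil.
  move=> e e0; near=> j; rewrite /osc integral0_eq ?lee_fin ?ltW// => z _.
  by rewrite subrr expr0n/= mul0r.
under eq_fun do rewrite big_cons.
by apply: vanishing_osc_add => //; exact: measurable_sum.
Unshelve. all: by end_near. Qed.

(** Closure in L^2: [osc_le] controls the oscillation of v - w by its L^2 norm, uniformly in j. *)
Lemma vanishing_osc_approx (v : T -> R) : measurable_fun setT v ->
  (forall e : R, (0 < e)%R -> exists w : T -> R, [/\ measurable_fun setT w,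
     vanishing_osc w & \int[m]_x ((v x - w x) ^+ 2)%:E <= e%:E]) ->
  vanishing_osc v.
Proof.
move=> mv happ e e0.
(* The budget is 2 (e / 4) + 2 * 4 (e / 16) = e, the factor 4 coming from [osc_le]. *)
have [w [mw Vw vw]] : exists w : T -> R, [/\ measurable_fun setT w,
     vanishing_osc w & \int[m]_x ((v x - w x) ^+ 2)%:E <= (e / 16)%:E].
  by apply: happ; rewrite divr_gt0.
have /Vw Ow : (0 < e / 4)%R by rewrite divr_gt0.
near=> j.
have mk := mk_measurable hk j; have k0 := mk_ge0 hk j.
have mvw : measurable_fun setT (fun x => v x - w x)%R by exact: measurable_funB.
rewrite [X in osc _ _ X](_ : _ = fun x => (w x + (v x - w x))%R); last first.
  by apply/funext => x; rewrite addrC subrK.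
apply: (le_trans (osc_add m mk k0 mw mvw)).
apply: (@le_trans _ _ (2%:E * (e / 4)%:E + 2%:E * (4%:E * (e / 16)%:E))).
  apply: leeD; apply: lee_wpmul2l => //; first by near: j.
  apply: (le_trans (osc_le mk k0 (mk_left hk j) (mk_right hk j) mvw)).
  exact: lee_wpmul2l.
by rewrite -!EFinM -EFinD lee_fin; lra.
Unshelve. all: by end_near. Qed.

(** Since the union has finite measure, the indicators converge to its indicator in L^2. This is the
    countable step of the later set-theoretic arguments. *)
Lemma vanishing_osc_nondecreasing (S : (set T)^nat) :
  (forall i, measurable (S i)) -> nondecreasing_seq S ->
  m (\bigcup_i S i) < +oo ->
  (forall i, vanishing_osc (\1_(S i))) -> vanishing_osc (\1_(\bigcup_i S i)).
Proof.
move=> mS ndS finS VS; have mU : measurable (\bigcup_i S i) by exact: bigcupT_measurable.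
apply: vanishing_osc_approx; first exact: measurable_indic.
move=> e e0.
have Sle i : m (S i) <= m (\bigcup_i S i).
  by apply: le_measure; rewrite ?inE//; exact: bigcup_sup.
have [i Hi] : exists i, m (\bigcup_i S i) <= m (S i) + e%:E.
  have /fine_cvgP[_ /cvgrPdist_le/(_ _ e0)[i _ /(_ i (leqnn i))/=]] :
      (m \o S) i @[i --> \oo] --> (fine (m (\bigcup_i S i)))%:E.
    rewrite fineK ?ge0_fin_numE//; exact: nondecreasing_cvg_mu.
  move=> Hi; exists i; rewrite -(@fineK _ (m (\bigcup_i S i))) ?ge0_fin_numE//.
  rewrite -(@fineK _ (m (S i))) ?ge0_fin_numE//; last exact: le_lt_trans (Sle i) _.
  by rewrite -EFinD lee_fin -lerBlDl (le_trans (ler_norm _)).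
exists (\1_(S i)); split=> //.
rewrite (eq_integral (fun x => (\1_(\bigcup_i S i `\` S i) x)%:E)); last first.
  move=> x _; rewrite !indicE in_setD; congr EFin.
  have [xS|xS] := boolP (x \in S i); last by rewrite subr0/= andbT; case: (x \in _); rewrite ?expr1n// expr0n.
  have -> : x \in \bigcup_i S i by rewrite inE; exists i => //; exact/set_mem.
  by rewrite subrr expr0n.
rewrite integral_indic//; last exact: measurableD.
rewrite setIT measureD// setIidr; last exact: bigcup_sup.
by rewrite leeBlDl// ge0_fin_numE//; exact: le_lt_trans (Sle i) _.
Qed.

Import HBNNSimple.

Lemma vanishing_osc_nnsfun (g : {nnsfun T >-> R}) :
  (forall A, measurable A -> m A < +oo -> vanishing_osc (\1_A)) ->
  \int[m]_x (g x ^+ 2)%:E < +oo -> vanishing_osc g.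
Proof.
move=> hA goo; have -> : (g : T -> R) = fun x => (\sum_(y <- finmap.enum_fset (fset_set (range g)))
    (y * \1_(g @^-1` [set y]) x))%R.
  by apply/funext => x; rewrite fimfunE fsbig_finite.
apply: vanishing_osc_sum => y.
  by apply: measurable_funM => //; exact: measurable_indic.
(* The level set of 0 may have infinite measure, but its coefficient is 0. The other level sets have
   finite measure by Chebyshev's inequality. *)
have [->|y0] := eqVneq y 0%R.
  move=> e e0; near=> j; rewrite osc_scale ?expr0n ?mul0e ?lee_fin ?ltW//.
  - exact: (mk_measurable hk).
  - exact: (mk_ge0 hk).
apply: vanishing_osc_scale => //; apply: hA => //.
have y2 : (0 < y ^+ 2)%R by rewrite exprn_even_gt0.
have : (y ^+ 2)%:E * m (g @^-1` [set y]) < +oo.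
  apply: le_lt_trans goo.
  rewrite -[g @^-1` _]setIT -integral_indic// -ge0_integralZl//; last 2 first.
  - by mfun => //.
  - by rewrite lee_fin ltW.
  apply: ge0_le_integral => //.
  - by move=> x _; rewrite -EFinM lee_fin mulr_ge0// ltW.
  - by apply: emeasurable_funM => //; mfun.
  - by mfun; exact: measurable_funP.
  - move=> x _; rewrite -EFinM lee_fin indicE.
    have [/set_mem/= ->|_] := boolP (x \in _); first by rewrite mulr1.
    by rewrite mulr0 sqr_ge0.
have [] := eqVneq (m (g @^-1` [set y])) +oo; last by rewrite -ltey.
by move=> ->; rewrite gt0_muley.
Unshelve. all: by end_near. Qed.

(** Simple functions increasing to v converge to it in L^2, by dominated convergence with majorant
    v^2. *)
Lemma ge0_vanishing_osc_L2 (v : T -> R) :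
  (forall A, measurable A -> m A < +oo -> vanishing_osc (\1_A)) ->
  measurable_fun setT v -> (forall x, 0 <= v x)%R ->
  \int[m]_x (v x ^+ 2)%:E < +oo -> vanishing_osc v.
Proof.
move=> hA mv v0 voo.
have mev : measurable_fun setT (EFin \o v) by exact/measurable_EFinP.
pose g := nnsfun_approx measurableT mev.
have gcvg x : g n x @[n --> \oo] --> v x.
  have := @cvg_nnsfun_approx _ _ _ _ measurableT _ mev (fun y _ => v0 y) x I.
  by move=> /fine_cvgP[].
have gv n x : (g n x <= v x)%R.
  rewrite -(cvg_lim _ (gcvg x))//; apply: (nondecreasing_cvgn_le _ (cvgP _ (gcvg x))).
  by move=> a b ab; exact/lefP/nd_nnsfun_approx.
apply: vanishing_osc_approx => // e e0.
have mvg n : measurable_fun setT (fun x => ((v x - g n x) ^+ 2)%:E).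
  by mfun; exact: measurable_funP.
have [] := @dominated_convergence _ _ _ m _ measurableT
  (fun n x => ((v x - g n x) ^+ 2)%:E) (cst 0) (fun x => (v x ^+ 2)%:E).
- exact: mvg.
- exact: measurable_cst.
- apply: aeW => x _; apply: cvg_EFin; first exact: nearW.
  rewrite -[X in _ --> X](expr0n R 2) -[X in (X ^+ 2)%R](subrr (v x)).
  by apply: cvgM; apply: cvgB => //; exact: cvg_cst.
- apply/integrableP; split; first by mfun.
  by under eq_integral do rewrite gee0_abs ?lee_fin ?sqr_ge0//.
- apply: aeW => x n _; rewrite gee0_abs ?lee_fin ?sqr_ge0//.
  rewrite lerXn2r ?nnegrE ?subr_ge0//.
  by rewrite gerBl.
move=> _ _; rewrite integral0 => /fine_cvgP[fin cvg0].
have /cvgrPdist_le/(_ _ e0) Hd := cvg0.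
have [n [nfin nd]] : exists n, \int[m]_x ((v x - g n x) ^+ 2)%:E \is a fin_num /\
   (`|0 - fine (\int[m]_x ((v x - g n x) ^+ 2)%:E)| <= e)%R.
  have [n _ /(_ n (leqnn n))/= ?] := filterI fin Hd.
  by exists n.
exists (g n); split; first exact: measurable_funP.
- apply: vanishing_osc_nnsfun => //; apply: le_lt_trans voo.
  apply: ge0_le_integral => //.
  + by move=> x _; rewrite lee_fin sqr_ge0.
  + by mfun; exact: measurable_funP.
  + by mfun.
  + by move=> x _; rewrite lee_fin lerXn2r ?nnegrE.
- by rewrite -(fineK nfin) lee_fin (le_trans _ nd)// sub0r normrN ler_norm.
Qed.

Lemma vanishing_osc_L2 (v : T -> R) :
  (forall A, measurable A -> m A < +oo -> vanishing_osc (\1_A)) ->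
  measurable_fun setT v -> \int[m]_x (v x ^+ 2)%:E < +oo -> vanishing_osc v.
Proof.
move=> hA mv voo.
have mp : measurable_fun setT (v^\+)%R by exact: measurable_funrpos.
have mn : measurable_fun setT (v^\-)%R by exact: measurable_funrneg.
have sq_le (w : T -> R) : measurable_fun setT w -> (forall x, `|w x| <= `|v x|)%R ->
    \int[m]_x (w x ^+ 2)%:E < +oo.
  move=> mw wv; apply: le_lt_trans voo; apply: ge0_le_integral => //.
  + by move=> x _; rewrite lee_fin sqr_ge0.
  + by mfun.
  + by mfun.
  + move=> x _; rewrite lee_fin -[leLHS]real_normK ?num_real//.
    by rewrite -[leRHS]real_normK ?num_real// lerXn2r ?nnegrE.
have -> : v = fun x => ((v^\+ x)%R + -1 * (v^\- x)%R)%R.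
  by rewrite -[LHS]funrposBneg; apply/funext => x; rewrite mulN1r.
apply: vanishing_osc_add => //.
- exact: measurable_funM.
- apply: ge0_vanishing_osc_L2 => //; apply: sq_le => // x.
  rewrite /funrpos ger0_norm ?le_max ?lexx ?orbT// ge_max normr_ge0 ler_norm//.
- apply: vanishing_osc_scale => //; apply: ge0_vanishing_osc_L2 => //; apply: sq_le => // x.
  rewrite /funrneg ger0_norm ?le_max ?lexx ?orbT// ge_max normr_ge0 -normrN ler_norm//.
Qed.

End vanishing_oscillation.

(** * Products of measures and of Markov kernels *)

Section product_integral.
Context d1 d2 (T1 : measurableType d1) (T2 : measurableType d2) (R : realType).
Variables (m1 : {sigma_finite_measure set T1 -> \bar R})
          (m2 : {sigma_finite_measure set T2 -> \bar R}).
Local Open Scope ereal_scope.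

Lemma integral_tensor (f : T1 -> \bar R) (g : T2 -> \bar R) :
  measurable_fun setT f -> measurable_fun setT g ->
  (forall x, 0 <= f x) -> (forall y, 0 <= g y) ->
  \int[m1 \x m2]_z (f z.1 * g z.2) = (\int[m1]_x f x) * (\int[m2]_y g y).
Proof.
move=> mf mg f0 g0; rewrite fubini_tonelli1//=; last 2 first.
- by apply: emeasurable_funM; apply: measurableT_comp.
- by move=> z; exact: mule_ge0.
rewrite -ge0_integralZr//; last exact: integral_ge0.
by apply: eq_integral => x _; rewrite /fubini_F/= ge0_integralZl.
Qed.

(** A name for the product measure that can carry a sigma-finite structure, so that [osc] and the
    product construction can be applied to it again. *)
Definition prod_sfm : set (T1 * T2) -> \bar R := (m1 \x m2).

HB.instance Definition _ := Measure.on prod_sfm.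

Let prod_sfm_sigma_finite : sigma_finite setT prod_sfm.
Proof.
have /sigma_finiteP[F [TF ndF Foo]] := sigma_finiteT m1.
have /sigma_finiteP[G [TG ndG Goo]] := sigma_finiteT m2.
exists (fun n => F n `*` G n).
  rewrite -setXTT TF TG predeqE => -[x y]; split.
    move=> [/= [n _ Fnx] [k _ Gky]]; exists (maxn n k) => //; split.
    - by move: x Fnx; exact/subsetPset/ndF/leq_maxl.
    - by move: y Gky; exact/subsetPset/ndG/leq_maxr.
  by move=> [n _ []/= ? ?]; split; exists n.
move=> n; have [mF Fnoo] := Foo n; have [mG Gnoo] := Goo n.
split; first exact: measurableX.
by rewrite /prod_sfm product_measure1E// lte_mul_pinfty// ge0_fin_numE.
Qed.

HB.instance Definition _ := Measure_isSigmaFinite.Build _ _ _ prod_sfm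
  prod_sfm_sigma_finite.

Local Notation pm := prod_sfm.

(** Grouping the four variables by factor instead of by point separates F from G. *)
Lemma integral_tensor2 (F : T1 * T1 -> R) (G : T2 * T2 -> R) :
  measurable_fun setT F -> measurable_fun setT G ->
  (forall x, 0 <= F x)%R -> (forall y, 0 <= G y)%R ->
  \int[pm \x pm]_z (F (z.1.1, z.2.1) * G (z.1.2, z.2.2))%:E =
  \int[m1 \x m1]_z (F z)%:E * \int[m2 \x m2]_z (G z)%:E.
Proof.
move=> mF mG F0 G0.
have mF1 x : measurable_fun setT (fun y => (F (x, y))%:E).
  by mfun; apply: (measurableT_comp mF); exact: measurable_pair1.
have mG1 x : measurable_fun setT (fun y => (G (x, y))%:E).
  by mfun; apply: (measurableT_comp mG); exact: measurable_pair1.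
have mFe : measurable_fun setT (EFin \o F) by mfun.
have mGe : measurable_fun setT (EFin \o G) by mfun.
pose H (z : (T1 * T2) * (T1 * T2)) := (F (z.1.1, z.2.1) * G (z.1.2, z.2.2))%:E.
have mH : measurable_fun setT H.
  apply: measurable_EFin; apply: measurable_funM;
  [apply: (measurableT_comp mF)|apply: (measurableT_comp mG)];
  apply: measurable_fun_pair; do 2 (apply: measurableT_comp => //).
have H0 z : 0 <= H z by rewrite lee_fin mulr_ge0.
transitivity (\int[pm]_p \int[pm]_q H (p, q)).
  exact: (fubini_tonelli1 (m1 := pm) (m2 := pm) H mH H0).
rewrite /H /=.
under eq_integral => p _.
  under eq_integral do rewrite EFinM.
  rewrite (integral_tensor (f := fun b => (F (p.1, b))%:E) (g := fun y => (G (p.2, y))%:E))//; last 2 first.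
  - by move=> b; rewrite lee_fin.
  - by move=> b; rewrite lee_fin.
  over.
rewrite (integral_tensor (f := fun a => \int[m1]_b (F (a, b))%:E)
  (g := fun x => \int[m2]_y (G (x, y))%:E)).
- by rewrite !fubini_tonelli1// => z /=; rewrite lee_fin.
- by apply: (measurable_fun_fubini_tonelli_F (EFin \o F)) => // z; rewrite lee_fin.
- by apply: (measurable_fun_fubini_tonelli_F (EFin \o G)) => // z; rewrite lee_fin.
- by move=> x; apply: integral_ge0 => y _; rewrite lee_fin.
- by move=> x; apply: integral_ge0 => y _; rewrite lee_fin.
Qed.

End product_integral.

Section product_kernel.
Context d1 d2 (T1 : measurableType d1) (T2 : measurableType d2) (R : realType).
Variables (m1 : {sigma_finite_measure set T1 -> \bar R})
          (m2 : {sigma_finite_measure set T2 -> \bar R}).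
Variables (k1 : nat -> T1 * T1 -> R) (k2 : nat -> T2 * T2 -> R).
Hypotheses (hk1 : markov_kernels m1 k1) (hk2 : markov_kernels m2 k2).
Local Open Scope ereal_scope.

Definition prod_kernel j (z : (T1 * T2) * (T1 * T2)) : R :=
  (k1 j (z.1.1, z.2.1) * k2 j (z.1.2, z.2.2))%R.

Lemma markov_prod_kernel : markov_kernels (prod_sfm m1 m2) prod_kernel.
Proof.
split.
- move=> j; apply: measurable_funM; [apply: (measurableT_comp (mk_measurable hk1 j))
  |apply: (measurableT_comp (mk_measurable hk2 j))];
  apply: measurable_fun_pair; do 2 (apply: measurableT_comp => //).
- by move=> j z; rewrite mulr_ge0//; [exact: (mk_ge0 hk1)|exact: (mk_ge0 hk2)].
- move=> j x; rewrite /prod_kernel/=; under eq_integral do rewrite EFinM.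
  rewrite (integral_tensor m1 m2 (f := fun b => (k1 j (x.1, b))%:E) (g := fun b => (k2 j (x.2, b))%:E)).
  + by rewrite (mk_left hk1) (mk_left hk2) mule1.
  + by mfun; apply: (measurableT_comp (mk_measurable hk1 j)); exact: measurable_pair1.
  + by mfun; apply: (measurableT_comp (mk_measurable hk2 j)); exact: measurable_pair1.
  + by move=> b; rewrite lee_fin (mk_ge0 hk1).
  + by move=> b; rewrite lee_fin (mk_ge0 hk2).
- move=> j x; rewrite /prod_kernel/=; under eq_integral do rewrite EFinM.
  rewrite (integral_tensor m1 m2 (f := fun b => (k1 j (b, x.1))%:E) (g := fun b => (k2 j (b, x.2))%:E)).
  + by rewrite (mk_right hk1) (mk_right hk2) mule1.
  + by mfun; apply: (measurableT_comp (mk_measurable hk1 j)); exact: measurable_pair2.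
  + by mfun; apply: (measurableT_comp (mk_measurable hk2 j)); exact: measurable_pair2.
  + by move=> b; rewrite lee_fin (mk_ge0 hk1).
  + by move=> b; rewrite lee_fin (mk_ge0 hk2).
Qed.

(** The difference of two products of indicators is (1_A(a) - 1_A(b)) 1_B(x) + 1_A(b) (1_B(x) -
    1_B(y)). In each square one factor is an oscillation, and the other integrates to the measure of
    a side because the marginals are 1. *)
Lemma osc_rectangle j A B : measurable A -> measurable B ->
  osc (prod_sfm m1 m2) (prod_kernel j) (\1_(A `*` B)) <=
  2%:E * (osc m1 (k1 j) (\1_A) * m2 B) + 2%:E * (m1 A * osc m2 (k2 j) (\1_B)).
Proof.
move=> mA mB.
have mk1 := mk_measurable hk1 j; have mk2 := mk_measurable hk2 j.
have k10 := mk_ge0 hk1 j; have k20 := mk_ge0 hk2 j.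
pose F1 z := ((\1_A z.1 - \1_A z.2) ^+ 2 * k1 j z)%R.
pose G1 z := (\1_B z.1 ^+ 2 * k2 j z)%R.
pose F2 z := (\1_A z.2 ^+ 2 * k1 j z)%R.
pose G2 z := ((\1_B z.1 - \1_B z.2) ^+ 2 * k2 j z)%R.
have mF1 : measurable_fun setT F1 by apply/measurable_EFinP; apply: measurable_osc_integrand => //; exact: measurable_indic.
have mG2 : measurable_fun setT G2 by apply/measurable_EFinP; apply: measurable_osc_integrand => //; exact: measurable_indic.
have mG1 : measurable_fun setT G1.
  by have mB1 := measurable_comp_fst (measurable_indic (R := R) mB); mfun.
have mF2 : measurable_fun setT F2.
  by have mA2 := measurable_comp_snd (measurable_indic (R := R) mA); mfun.
have F10 z : (0 <= F1 z)%R by rewrite mulr_ge0// sqr_ge0.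
have F20 z : (0 <= F2 z)%R by rewrite mulr_ge0// sqr_ge0.
have G10 z : (0 <= G1 z)%R by rewrite mulr_ge0// sqr_ge0.
have G20 z : (0 <= G2 z)%R by rewrite mulr_ge0// sqr_ge0.
have sqr_indic T' (C : set T') x : (\1_C x ^+ 2 = \1_C x :> R)%R.
  by rewrite indicE; case: (_ \in _); rewrite ?expr1n ?expr0n.
have -> : m2 B = \int[m2 \x m2]_z (G1 z)%:E.
  transitivity (\int[m2]_x (\1_B x ^+ 2)%:E).
    by under eq_integral do rewrite sqr_indic; rewrite integral_indic// setIT.
  apply/esym; apply: (integral_sqr_fst mk2 k20 (mk_left hk2 j)).
  exact: measurable_indic.
have -> : m1 A = \int[m1 \x m1]_z (F2 z)%:E.
  transitivity (\int[m1]_x (\1_A x ^+ 2)%:E).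
    by under eq_integral do rewrite sqr_indic; rewrite integral_indic// setIT.
  apply/esym; apply: (integral_sqr_snd mk1 k10 (mk_right hk1 j)).
  exact: measurable_indic.
have mH (F : T1 * T1 -> R) (G : T2 * T2 -> R) : measurable_fun setT F -> measurable_fun setT G ->
  measurable_fun setT (fun z : (T1 * T2) * (T1 * T2) => (F (z.1.1, z.2.1) * G (z.1.2, z.2.2))%:E).
  move=> mF mG; mfun; [apply: (measurableT_comp mF)|apply: (measurableT_comp mG)];
  apply: measurable_fun_pair; do 2 (apply: measurableT_comp => //).
have mH1 := mH _ _ mF1 mG1; have mH2 := mH _ _ mF2 mG2.
rewrite -[osc m1 _ _]/(\int[m1 \x m1]_z (F1 z)%:E).
rewrite -[osc m2 _ _]/(\int[m2 \x m2]_z (G2 z)%:E).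
rewrite -(integral_tensor2 m1 m2 mF1 mG1 F10 G10).
rewrite -(integral_tensor2 m1 m2 mF2 mG2 F20 G20) /osc.
rewrite -!ge0_integralZl//; try (by move=> z _; rewrite lee_fin mulr_ge0//); try exact: mH1; try exact: mH2.
rewrite -ge0_integralD//; try (by move=> z _; rewrite mule_ge0// lee_fin mulr_ge0//);
  try (by apply: emeasurable_funM => //; exact: mH1);
  try (by apply: emeasurable_funM => //; exact: mH2).
apply: ge0_le_integral => //.
- by move=> z _; rewrite lee_fin mulr_ge0 ?sqr_ge0// (mk_ge0 markov_prod_kernel).
- apply: measurable_osc_integrand; first exact: (mk_measurable markov_prod_kernel).
  by apply: measurable_indic; exact: measurableX.
- by apply: emeasurable_funD; [apply: emeasurable_funM => //; exact: mH1|apply: emeasurable_funM => //; exact: mH2].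
- move=> [[a x] [b y]] _; rewrite -!EFinM -EFinD lee_fin /F1 /F2 /G1 /G2 /prod_kernel/=.
  have AB z : (\1_(A `*` B) z = \1_A z.1 * \1_B z.2 :> R)%R.
    by rewrite !indicE in_setX -natrM mulnb.
  rewrite !AB -subr_ge0 /=.
  set p := \1_A a; set q := \1_A b; set r := \1_B x; set s := \1_B y.
  set K := k1 j _; set L := k2 j _.
  rewrite [leRHS](_ : _ = (((p - q) * r - q * (r - s)) ^+ 2) * (K * L))%R; last by ring.
  by rewrite mulr_ge0 ?sqr_ge0// mulr_ge0//; [exact: k10|exact: k20].
Qed.

End product_kernel.

(** Adding 1 to the denominator allots the error e to a factor c that may be 0. *)
Lemma ler_div_succ_mul (R : realType) (e c : R) : 0 <= e -> 0 <= c -> e / (c + 1) * c <= e.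
Proof.
move=> e0 c0; have c1 : 0 < c + 1 by lra.
by rewrite mulrAC ler_pdivrMr// ler_wpM2l//; lra.
Qed.

Lemma indic_bigcup_trivIset (R : realType) (T : Type) (F : nat -> set T) n x :
  trivIset setT F ->
  \1_(\bigcup_(i < n) F i) x = \sum_(i <- iota 0 n) \1_(F i) x :> R.
Proof.
move=> tF; rewrite indicE; have [/set_mem[i /= ltin Fix]|nF] := boolP (x \in _).
  rewrite (bigD1_seq i)//= ?mem_iota ?iota_uniq// indicE mem_set//.
  rewrite big1 ?addr0// => j ji; rewrite indicE memNset// => Fjx.
  by move/eqP: ji; apply; apply: tF => //; exists x.
rewrite big1_seq// => i /=; rewrite mem_iota/= => ltin; rewrite indicE memNset// => Fix.
by move/negP: nF; apply; rewrite inE; exists i.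
Qed.

Definition approx_identity d (T : measurableType d) (R : realType)
    (m : {sigma_finite_measure set T -> \bar R}) (k : nat -> T * T -> R) : Prop :=
  markov_kernels m k /\
  forall A, measurable A -> (m A < +oo)%E -> vanishing_osc m k (\1_A).

Section approx_identity_prod.
Context d1 d2 (T1 : measurableType d1) (T2 : measurableType d2) (R : realType).
Variables (m1 : {sigma_finite_measure set T1 -> \bar R})
          (m2 : {sigma_finite_measure set T2 -> \bar R}).
Variables (k1 : nat -> T1 * T1 -> R) (k2 : nat -> T2 * T2 -> R).
Hypotheses (ai1 : approx_identity m1 k1) (ai2 : approx_identity m2 k2).
Local Open Scope ereal_scope.
Local Notation m := (prod_sfm m1 m2).
Local Notation k := (prod_kernel k1 k2).

Let hk := markov_prod_kernel ai1.1 ai2.1.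

Let vanishing_rectangle A B : measurable A -> measurable B ->
  m1 A < +oo -> m2 B < +oo -> vanishing_osc m k (\1_(A `*` B)).
Proof.
move=> mA mB Aoo Boo e e0.
have EA : m1 A = (fine (m1 A))%:E by rewrite fineK// ge0_fin_numE.
have EB : m2 B = (fine (m2 B))%:E by rewrite fineK// ge0_fin_numE.
set a := fine (m1 A) in EA; set b := fine (m2 B) in EB.
have a0 : (0 <= a)%R by exact: fine_ge0.
have b0 : (0 <= b)%R by exact: fine_ge0.
have a1 : (0 < a + 1)%R by lra.
have b1 : (0 < b + 1)%R by lra.
have ea : (0 < e / 4 / (a + 1))%R by rewrite !divr_gt0.
have eb : (0 < e / 4 / (b + 1))%R by rewrite !divr_gt0.
have VA := ai1.2 A mA Aoo _ eb; have VB := ai2.2 B mB Boo _ ea.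
near=> j.
apply: (le_trans (osc_rectangle ai1.1 ai2.1 j mA mB)).
apply: (@le_trans _ _ (2%:E * ((e / 4 / (b + 1))%:E * b%:E) +
                       2%:E * (a%:E * (e / 4 / (a + 1))%:E))).
  rewrite EA EB; apply: leeD; apply: lee_wpmul2l => //.
    by apply: lee_wpmul2r; rewrite ?lee_fin//; near: j.
  by apply: lee_wpmul2l; rewrite ?lee_fin//; near: j.
rewrite -!EFinM -EFinD lee_fin [(a * _)%R]mulrC.
have e4 : (0 <= e / 4)%R by rewrite divr_ge0// ltW.
have := ler_div_succ_mul e4 a0; have := ler_div_succ_mul e4 b0.
by clear; lra.
Unshelve. all: by end_near. Qed.

(** Dynkin's theorem is applied to the property that all traces on rectangles with sides of finite
    measure have vanishing oscillation. Passing to traces keeps complements within finite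
    measure. *)
Let vanishing_section S : measurable S -> forall A B,
  measurable A -> measurable B -> m1 A < +oo -> m2 B < +oo ->
  vanishing_osc m k (\1_(S `&` A `*` B)).
Proof.
move=> mS; move: S mS.
suff H : forall S : set (T1 * T2)%type, <<s [set A `*` B | A in measurable & B in measurable] >> S ->
    forall A B, measurable A -> measurable B -> m1 A < +oo -> m2 B < +oo ->
    vanishing_osc m k (\1_(S `&` A `*` B)).
  by move=> S; rewrite measurable_prod_measurableType => /H.
apply: dynkin_induction.
- exact: measurable_prod_measurableType.
- move=> _ _ [A mA [B mB <-]] [C mC [D mD <-]]; rewrite -setXI.
  by exists (A `&` C); [exact: measurableI|exists (B `&` D) => //; exact: measurableI].
- by move=> A B mA mB Aoo Boo; rewrite setTI; exact: vanishing_rectangle.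
- move=> _ [C mC [D mD <-]] A B mA mB Aoo Boo; rewrite -setXI.
  apply: vanishing_rectangle; [exact: measurableI|exact: measurableI| |].
    by apply: le_lt_trans Aoo; apply: le_measure; rewrite ?inE//; exact: measurableI.
  by apply: le_lt_trans Boo; apply: le_measure; rewrite ?inE//; exact: measurableI.
- move=> S mS IH A B mA mB Aoo Boo.
  have mAB : measurable (A `*` B) by exact: measurableX.
  rewrite (_ : \1_(~` S `&` A `*` B) = fun x => \1_(A `*` B) x + -1 * \1_(S `&` A `*` B) x)%R; last first.
    apply/funext => x; rewrite !indicE !in_setI in_setC.
    by case: (x \in S); case: (x \in A `*` B); rewrite /=; lra.
  apply: (vanishing_osc_add hk) => //.
  + apply: measurable_funM => //; apply: measurable_indic; exact: measurableI.
  + exact: vanishing_rectangle.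
  + apply: (vanishing_osc_scale hk) => //; last exact: IH.
    by apply: measurable_indic; exact: measurableI.
- move=> F mF tF IH A B mA mB Aoo Boo.
  have mAB : measurable (A `*` B) by exact: measurableX.
  have ABoo : m (A `*` B) < +oo.
    by rewrite /= /prod_sfm product_measure1E// lte_mul_pinfty// ge0_fin_numE.
  (* Disjointness makes the indicator of a finite union a sum, and the countable union is the
     increasing limit of finite ones inside a set of finite measure. *)
  pose G n := \bigcup_(i < n) (F i `&` A `*` B).
  have mG n : measurable (G n) by apply: bigcup_measurable => i _; exact: measurableI.
  have UG : \bigcup_n F n `&` A `*` B = \bigcup_n G n.
    rewrite setI_bigcupl; apply/seteqP; split => [x [i _ Fx]|x [i _ [j _ Fx]]].
      by exists i.+1 => //; exists i => //=.
    by exists j.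
  rewrite UG; apply: (vanishing_osc_nondecreasing hk) => //.
  + move=> a b ab; apply/subsetPset => x [i /= ia Fx]; exists i => //=.
    exact: leq_trans ia ab.
  + rewrite -UG; apply: le_lt_trans ABoo; apply: le_measure; rewrite ?inE//.
    by apply: measurableI => //; exact: bigcupT_measurable.
  + move=> n; rewrite (_ : \1_(G n) = fun x => \sum_(i <- iota 0 n) \1_(F i `&` A `*` B) x)%R.
      apply: (vanishing_osc_sum hk) => // i; last exact: IH.
      by apply: measurable_indic; exact: measurableI.
    apply/funext => x; apply: indic_bigcup_trivIset => i j _ _ [y [[Fi _] [Fj _]]].
    by apply: tF => //; exists y.
Qed.

(** A set of finite measure is the increasing union of its traces on rectangles of finite measure
    that exhaust the product. *)
Lemma approx_identity_prod : approx_identity m k.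
Proof.
split=> // S mS Soo.
have /sigma_finiteP[F [TF ndF Foo]] := sigma_finiteT m1.
have /sigma_finiteP[G [TG ndG Goo]] := sigma_finiteT m2.
have SE : S = \bigcup_n (S `&` F n `*` G n).
  apply/seteqP; split=> [[x y] Sxy|x [n _ []]//].
  have [i _ Fi] : (\bigcup_i F i) x by rewrite -TF.
  have [j _ Gj] : (\bigcup_i G i) y by rewrite -TG.
  exists (maxn i j) => //; split => //; split => /=.
    by move: Fi; exact/subsetPset/ndF/leq_maxl.
  by move: Gj; exact/subsetPset/ndG/leq_maxr.
rewrite SE; apply: (vanishing_osc_nondecreasing hk) => //.
- move=> i; apply: measurableI => //; apply: measurableX; [exact: (Foo i).1|exact: (Goo i).1].
- move=> a b ab; apply/subsetPset => x [Sx [Fx Gx]]; split=> //; split.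
    by move: Fx; exact/subsetPset/ndF.
  by move: Gx; exact/subsetPset/ndG.
- by rewrite -SE.
- move=> i; have [? ?] := Foo i; have [? ?] := Goo i; exact: vanishing_section.
Qed.

End approx_identity_prod.

(** * Poisson kernels *)

Section ftc_everywhere.
Context {R : realType}.
Implicit Types (f F : R -> R) (a b l : R).
Local Notation leb := (@lebesgue_measure R).

Lemma is_derive_continuous F f : (forall x : R, is_derive x 1 F (f x)) -> continuous F.
Proof. by move=> dF x; apply/differentiable_continuous/derivable1_diffP; apply: ex_derive. Qed.

Lemma derivable_continuous f : (forall x : R, derivable f x 1) -> continuous f.
Proof. by move=> df x; apply/differentiable_continuous/derivable1_diffP. Qed.

Lemma integral_even_FTC F f l : (forall x, 0 <= f x) -> continuous f ->
  (forall x : R, is_derive x 1 F (f x)) -> F x @[x --> +oo] --> l ->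
  (\int[leb]_x (f `|x|)%:E = (2 * (l - F 0))%:E)%E.
Proof.
move=> f0 cf dF Fl; have cF := is_derive_continuous dF.
rewrite ge0_symfun_integralT//; last 2 first.
- by move=> x; apply: continuous_comp; [exact: norm_continuous|exact: cf].
- by move=> x /=; rewrite normrN.
rewrite -set_itvcy.
under eq_integral => x do [rewrite inE/= in_itv/= andbT => x0; rewrite ger0_norm//].
rewrite (ge0_continuous_FTC2y (F := F) (l := l))// -?EFinB -?EFinM//.
- exact: continuous_subspaceT.
- by apply: cvg_at_right_filter; exact: cF.
- by move=> x _; rewrite derive1E; apply: derive_val.
Qed.

End ftc_everywhere.

Section poisson_kernel.
Context {R : realType}.
Local Notation leb := (@lebesgue_measure R).

(** The Poisson kernel of the half plane at height e, without its normalising factor 1 / pi. *)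
Definition poisson (e x : R) : R := e / (e ^+ 2 + x ^+ 2).

Lemma poisson_den_gt0 (e x : R) : 0 < e -> 0 < e ^+ 2 + x ^+ 2.
Proof. by move=> e0; rewrite ltr_pwDl ?exprn_gt0// sqr_ge0. Qed.

Lemma poisson_ge0 (e x : R) : 0 < e -> 0 <= poisson e x.
Proof. by move=> e0; rewrite divr_ge0// ltW// poisson_den_gt0. Qed.

Lemma continuous_poisson e : 0 < e -> continuous (poisson e).
Proof.
move=> e0 x; apply: cvgM; first exact: cvg_cst.
apply: cvgV; first by rewrite gt_eqF// poisson_den_gt0.
by apply: cvgD; [exact: cvg_cst|exact: exprn_continuous].
Qed.

Lemma integral_poisson e : 0 < e ->
  (\int[leb]_x (poisson e x)%:E = pi%:E)%E.
Proof.
move=> e0; under eq_integral => x _ do rewrite /poisson -(real_normK (num_real x)) -/(poisson e _).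
have dF (x : R) : is_derive x 1 (fun x => atan (e^-1 * x)) (poisson e x).
  apply: is_derive_eq.
  rewrite /GRing.scale/= /poisson mulr1.
  have e1 : e != 0 by rewrite gt_eqF.
  have d0 := lt0r_neq0 (poisson_den_gt0 x e0).
  by field; rewrite ?d0 ?e1.
rewrite (integral_even_FTC (fun x => poisson_ge0 x e0) (continuous_poisson e0) dF (l := pi / 2)).
  by rewrite mulr0 atan0 subr0 mulrC divfK.
apply: cvg_comp; last exact: cvgy_atan.
by apply: gt0_cvgMry => //; rewrite invr_gt0.
Qed.

Lemma cvg_expRN (e : R) : 0 < e -> expR (- (e * x)) @[x --> +oo] --> (0 : R).
Proof.
move=> e0; have : (fun x : R => expR (- x)) x @[x --> +oo] --> (0 : R) by exact: cvgr_expR.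
move=> H; apply: (cvg_comp (fun x : R => e * x) _ _ H).
exact: gt0_cvgMry.
Qed.

(* The antiderivative of [expR (- (e * x)) * (1 + cos (z * x))]; adding 1 makes
   the integrand nonnegative. *)
Let F (e z x : R) : R := - (expR (- (e * x)) / e) +
  expR (- (e * x)) * (- (e * cos (z * x)) + z * sin (z * x)) / (e ^+ 2 + z ^+ 2).

Lemma integral_laplace_1cos e z : 0 < e ->
  (\int[leb]_x (expR (- (e * `|x|)) * (1 + cos (z * `|x|)))%:E =
   (2 * (e^-1 + poisson e z))%:E)%E.
Proof.
move=> e0; have e1 : e != 0 by rewrite gt_eqF.
have d0 := lt0r_neq0 (poisson_den_gt0 z e0).
have dF (x : R) : is_derive x 1 (F e z) (expR (- (e * x)) * (1 + cos (z * x))).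
  rewrite /F; apply: is_derive_eq; rewrite /GRing.scale/=.
  by field; rewrite d0.
rewrite (integral_even_FTC _ _ dF (l := 0)).
- rewrite /F /poisson !mulr0 oppr0 expR0 cos0 sin0 !mul1r; congr (_%:E).
  by field; rewrite e1 d0.
- move=> x; rewrite mulr_ge0 ?expR_ge0//.
- by apply: derivable_continuous => x; apply: ex_derive.
(* The antiderivative is a trigonometric factor bounded by C times a decaying exponential, hence
   tends to 0 at infinity. *)
- pose C := e^-1 + (e + `|z|) / (e ^+ 2 + z ^+ 2).
  have FC x : `|F e z x| <= C * expR (- (e * x)).
    rewrite (_ : F e z x = (- e^-1 + (- (e * cos (z * x)) + z * sin (z * x)) / (e ^+ 2 + z ^+ 2))
      * expR (- (e * x))); last by rewrite /F; field; rewrite d0 e1.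
    rewrite normrM [X in _ * X]ger0_norm ?expR_ge0// ler_wpM2r ?expR_ge0//.
    apply: (le_trans (ler_normD _ _)); rewrite /C normrN ger0_norm ?invr_ge0 ?(ltW e0)// lerD2l.
    have d1 : 0 <= (e ^+ 2 + z ^+ 2)^-1 by rewrite invr_ge0 ltW// poisson_den_gt0.
    rewrite normrM [X in _ * X]ger0_norm// ler_wpM2r//.
    apply: (le_trans (ler_normD _ _)); rewrite normrN !normrM (gtr0_norm e0).
    apply: lerD; rewrite ler_piMr ?(ltW e0)// ler_norml.
      by rewrite cos_geN1 cos_le1.
    by rewrite sin_geN1 sin_le1.
  have CE : C * expR (- (e * x)) @[x --> +oo] --> (0 : R).
    by rewrite -[X in _ --> X](mulr0 C); apply: cvgM; [exact: cvg_cst|exact: cvg_expRN].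
  apply: (@squeeze_cvgr _ _ _ _ (fun x => - (C * expR (- (e * x)))) (fun x => C * expR (- (e * x)))) => //.
    by near=> x; rewrite -ler_norml FC.
  by rewrite -[X in _ --> X]oppr0; exact: cvgN.
Unshelve. all: by end_near. Qed.

Definition laplace (e x : R) : R := expR (- (e * `|x|)).

Lemma laplace_ge0 e x : 0 <= laplace e x.
Proof. exact: expR_ge0. Qed.

Lemma continuous_laplace e : continuous (laplace e).
Proof.
move=> x; apply: continuous_comp; last exact: continuous_expR.
by apply: cvgN; apply: cvgM; [exact: cvg_cst|exact: norm_continuous].
Qed.

Lemma measurable_laplace e : measurable_fun setT (laplace e).
Proof. by apply: continuous_measurable_fun; exact: continuous_laplace. Qed.

Lemma integral_laplace e : 0 < e -> (\int[leb]_x (laplace e x)%:E = (2 / e)%:E)%E.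
Proof.
move=> e0; have e1 : e != 0 by rewrite gt_eqF.
(* The case z = 0 of the preceding integral, where 1 + cos equals 2. *)
have H : (\int[leb]_x (2%:E * (laplace e x)%:E) = (4 / e)%:E)%E.
  under eq_integral => x _.
    rewrite -EFinM (_ : 2 * laplace e x = expR (- (e * `|x|)) * (1 + cos (0 * `|x|))); last first.
      by rewrite mul0r cos0 mulrC /laplace; congr (_ * _); lra.
    over.
  by rewrite integral_laplace_1cos//; congr (_%:E); rewrite /poisson; field.
rewrite ge0_integralZl// in H; last 2 first.
- by apply: measurable_EFin; exact: measurable_laplace.
- by move=> x _; rewrite lee_fin laplace_ge0.
have E : (\int[leb]_x (laplace e x)%:E = (2^-1)%:E * (2%:E * \int[leb]_x (laplace e x)%:E))%E.
  by rewrite muleA -EFinM mulVf ?mul1e// pnatr_eq0.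
by rewrite E H -EFinM; congr (_%:E); field.
Qed.

Lemma integrable_laplaceM e (h : R -> R) : 0 < e -> measurable_fun setT h ->
  (forall x, `|h x| <= 1) -> leb.-integrable setT (fun x => (laplace e x * h x)%:E).
Proof.
move=> e0 mh h1; apply: (@le_integrable _ _ _ leb setT measurableT _ (fun x => (laplace e x)%:E)).
- by apply: measurable_EFin; apply: measurable_funM => //; exact: measurable_laplace.
- move=> x _ /=; rewrite lee_fin normrM ger0_norm ?laplace_ge0// ler_piMr ?laplace_ge0//.
- apply/integrableP; split; first by apply: measurable_EFin; exact: measurable_laplace.
  under eq_integral => x _ do rewrite gee0_abs ?lee_fin ?laplace_ge0//.
  by rewrite integral_laplace ?ltry.
Qed.

Lemma measurable_cosM (z : R) : measurable_fun setT (fun x : R => cos (z * x)).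
Proof.
apply: (measurableT_comp (f := @cos R)); last exact: mulrl_measurable.
by apply: continuous_measurable_fun; exact: continuous_cos.
Qed.

Lemma measurable_sinM (z : R) : measurable_fun setT (fun x : R => sin (z * x)).
Proof.
apply: (measurableT_comp (f := @sin R)); last exact: mulrl_measurable.
by apply: continuous_measurable_fun; exact: continuous_sin.
Qed.

Lemma norm_cos_le1 (x : R) : `|cos x| <= 1.
Proof. by rewrite ler_norml cos_geN1 cos_le1. Qed.

Lemma norm_sin_le1 (x : R) : `|sin x| <= 1.
Proof. by rewrite ler_norml sin_geN1 sin_le1. Qed.

(** Subtraction of the case z = 0 removes the 1 that was added to make the integrand nonnegative. *)
Lemma integral_laplace_cos e z : 0 < e ->
  (\int[leb]_x (laplace e x * cos (z * x))%:E = (2 * poisson e z)%:E)%E.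
Proof.
move=> e0; have e1 : e != 0 by rewrite gt_eqF.
have i1 := integrable_laplaceM e0 (measurable_cosM z) (fun x => norm_cos_le1 _).
have i0 : leb.-integrable setT (fun x => (laplace e x * 1)%:E).
  by apply: (integrable_laplaceM e0 (measurable_cst _)) => x; rewrite normr1.
have E : (\int[leb]_x ((laplace e x * 1)%:E + (laplace e x * cos (z * x))%:E) =
    (2 * (e^-1 + poisson e z))%:E)%E.
  rewrite -integral_laplace_1cos//; apply: eq_integral => x _.
  rewrite -EFinD -mulrDr; congr ((_ * (_ + _))%:E).
  by have [x0|x0] := lerP 0 x; [rewrite ger0_norm|rewrite ltr0_norm// mulrN cosN].
have E1 : (\int[leb]_x (laplace e x * 1)%:E = (2 / e)%:E)%E.
  by rewrite -integral_laplace//; apply: eq_integral => x _; rewrite mulr1.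
rewrite integralD// E1 in E.
have /fineK Ec := integrable_fin_num measurableT i1.
rewrite -Ec -EFinD in E; rewrite -Ec; congr (_%:E); case: E => E.
apply: (addrI (2 / e)); rewrite E; ring.
Qed.

Lemma integral_opp (f : R -> \bar R) : leb.-integrable setT f ->
  (\int[leb]_x f (- x)%R = \int[leb]_x f x)%E.
Proof.
move=> fi; have mN : measurable_fun setT (-%R : measurableTypeR R -> measurableTypeR R).
  exact: oppr_measurable.
have mf : measurable_fun setT f by case/integrableP : fi.
have EN (g : R -> \bar R) : (\int[pushforward leb (-%R : _ -> measurableTypeR R)]_x g x = \int[leb]_x g x)%E.
  by apply: eq_measure_integral => A mA _; exact: lebesgue_measureN.
rewrite -[RHS]EN integral_pushforward//.
rewrite preimage_setT; apply/integrableP; split; first exact: measurableT_comp.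
case/integrableP : fi => _; rewrite -[X in (X < _)%E -> _]EN ge0_integral_pushforward//.
exact: measurableT_comp.
Qed.

Lemma integral_laplace_sin e z : 0 < e ->
  (\int[leb]_x (laplace e x * sin (z * x))%:E = 0)%E.
Proof.
move=> e0.
have i1 := integrable_laplaceM e0 (measurable_sinM z) (fun x => norm_sin_le1 _).
have := integral_opp i1.
under eq_integral => x _ do rewrite mulrN sinN mulrN /laplace normrN -/(laplace e x) EFinN.
rewrite integralN/=; last exact: integrable_add_def.
have /fineK <- := integrable_fin_num measurableT i1.
by rewrite -EFinN => -[H]; congr (_%:E); lra.
Qed.

Lemma integral_shift (G : R -> R) a : continuous G -> (forall x, 0 <= G x) ->
  (\int[leb]_x (G (x - a))%:E = \int[leb]_x (G x)%:E)%E.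
Proof.
move=> cG G0.
have dF (x : R) : is_derive x 1 (fun x : R => x - a) (1 : R).
  by apply: is_derive_eq; rewrite subr0.
have dF1 : derive1 (fun x : R => x - a) = cst 1 :> (R -> R).
  by apply/funext => x; rewrite derive1E; apply: derive_val.
rewrite (increasing_ge0_integration_by_substitutionT (F := fun x => x - a) (G := G))//.
- by rewrite dF1; apply: eq_integral => x _ /=; rewrite mulr1.
- by move=> x y; rewrite ltrD2r.
- by rewrite dF1 => x; exact: cst_continuous.
- by rewrite dF1; exact: is_cvg_cst.
- by rewrite dF1; exact: is_cvg_cst.
- exact: cvg_addrr_Ny.
- exact: cvg_addrr.
Qed.

End poisson_kernel.

Section poisson_identity.
Context {R : realType}.
Local Notation leb := (@lebesgue_measure R).
Local Notation mu n := (lebesgueRn R n).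

Definition poisson1 (j : nat) (z : measurableTypeR R * measurableTypeR R) : R :=
  poisson j.+1%:R^-1 (z.1 - z.2) / pi.

Lemma inv_succ_gt0 j : 0 < j.+1%:R^-1 :> R.
Proof. by rewrite invr_gt0 ltr0n. Qed.

Lemma poisson1_ge0 j z : 0 <= poisson1 j z.
Proof. by rewrite divr_ge0 ?poisson_ge0 ?inv_succ_gt0 ?pi_ge0. Qed.

Lemma poisson1C j x y : poisson1 j (x, y) = poisson1 j (y, x).
Proof. by rewrite /poisson1 /poisson/= -(sqrrN (x - y)) opprB. Qed.

Lemma measurable_poisson1 j : measurable_fun setT (poisson1 j).
Proof.
apply: measurable_funM => //.
apply: (measurableT_comp (f := poisson j.+1%:R^-1)).
  by apply: continuous_measurable_fun; apply: continuous_poisson; exact: inv_succ_gt0.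
by apply: measurable_funB.
Qed.

Lemma integral_poisson1 j x : (\int[leb]_y (poisson1 j (y, x))%:E = 1)%E.
Proof.
rewrite /poisson1/=.
have e0 := inv_succ_gt0 j; set e := j.+1%:R^-1 in e0 *.
rewrite (integral_shift (G := fun y => poisson e y / pi)).
- under eq_integral do rewrite EFinM muleC.
  rewrite ge0_integralZl ?integral_poisson//.
  + by rewrite -EFinM mulVf// gt_eqF// pi_gt0.
  + by apply: measurable_EFin; apply: continuous_measurable_fun; exact: continuous_poisson.
  + by move=> y _; rewrite lee_fin poisson_ge0.
  + by rewrite lee_fin invr_ge0 pi_ge0.
- by move=> y; apply: cvgM; [exact: continuous_poisson|exact: cvg_cst].
- by move=> y; rewrite divr_ge0 ?poisson_ge0 ?pi_ge0.
Qed.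

Lemma markov_poisson1 : markov_kernels leb poisson1.
Proof.
split.
- exact: measurable_poisson1.
- exact: poisson1_ge0.
- by move=> j x; under eq_integral do rewrite poisson1C; exact: integral_poisson1.
- exact: integral_poisson1.
Qed.

Local Open Scope ereal_scope.

(* Away from the diagonal, [poisson e] is at most [e] times a multiple of [poisson 1]. *)
Lemma poisson1_tail j (d x y : R) : (0 < d)%R -> (d <= `|x - y|)%R ->
  (poisson1 j (x, y) <= j.+1%:R^-1 * (1 + d ^+ 2) / d ^+ 2 * poisson1 0 (x, y))%R.
Proof.
move=> d0 dxy; rewrite /poisson1/= invr1 !mulrA ler_wpM2r ?invr_ge0 ?pi_ge0//.
rewrite /poisson expr1n; set z := (x - y)%R in dxy *.
have e0 := inv_succ_gt0 j; set e := (_^-1)%R in e0 *.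
rewrite -!mulrA ler_wpM2l ?(ltW e0)// mul1r.
have d2 : (0 < d ^+ 2)%R by rewrite exprn_gt0.
have z2 : (d ^+ 2 <= z ^+ 2)%R by rewrite -(real_normK (num_real z)) lerXn2r ?nnegrE ?(ltW d0).
have e2 : (0 < e ^+ 2)%R by rewrite exprn_gt0.
set D := (d ^+ 2)%R in d2 z2 *; set Z := (z ^+ 2)%R in z2 *; set E := (e ^+ 2)%R in e2 *.
have [p1 p2 p3] : [/\ D != 0, 1 + Z != 0 & E + Z != 0]%R by split; rewrite gt_eqF//; lra.
rewrite -subr_ge0 (_ : _ - _ = (E + D * E + (Z - D)) / (D * (1 + Z) * (E + Z)))%R; last first.
  by field; rewrite p1 p2 p3.
have DE : (0 <= D * E)%R by rewrite mulr_ge0// ltW.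
by rewrite divr_ge0//; [lra|rewrite !mulr_ge0//; lra].
Qed.

(** A point x of U lies at a positive distance d from the complement, so by [poisson1_tail] the
    kernel mass sent from x out of U is O(1 / (j + 1)). The oscillation is twice the integral of
    this escaping mass over U, which tends to 0 by dominated convergence as U has finite measure. *)
Lemma vanishing_osc_open (U : set R) : open U -> leb U < +oo ->
  vanishing_osc leb poisson1 (\1_U).
Proof.
move=> oU Uoo; have mU := open_measurable oU.
(* The mass that the kernel at x places outside U. *)
pose psi j (x : measurableTypeR R) := \int[leb]_y (\1_(~` U) y * poisson1 j (x, y))%:E.
have mI j : measurable_fun setT (fun z : measurableTypeR R * measurableTypeR R =>
    (\1_U z.1 * (\1_(~` U) z.2 * poisson1 j z))%:E).
  have m1 := measurable_comp_fst (measurable_indic (R := R) mU).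
  have m2 := measurable_comp_snd (measurable_indic (R := R) (measurableC mU)).
  by have := measurable_poisson1 j => m3; mfun.
have H0 j z : 0 <= (\1_U z.1 * (\1_(~` U) z.2 * poisson1 j z))%:E.
  by rewrite lee_fin mulr_ge0// mulr_ge0// poisson1_ge0.
have m1 := measurable_comp_fst (measurable_indic (R := R) mU).
have m1C := measurable_comp_fst (measurable_indic (R := R) (measurableC mU)).
have m2 := measurable_comp_snd (measurable_indic (R := R) mU).
have m2C := measurable_comp_snd (measurable_indic (R := R) (measurableC mU)).
have mp j x : measurable_fun setT (fun y => poisson1 j (x, y)).
  by apply: (measurableT_comp (measurable_poisson1 j)); exact: measurable_pair1.
have mp' j x : measurable_fun setT (fun y => (\1_(~` U) y * poisson1 j (x, y))%:E).
  apply: measurable_EFin; apply: measurable_funM; last exact: mp.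
  by apply: measurable_indic; exact: measurableC.
have p0 j x y : 0 <= (\1_(~` U) y * poisson1 j (x, y))%:E.
  by rewrite lee_fin mulr_ge0// poisson1_ge0.
(* The integrand is nonzero only when exactly one of the two points lies in U; by the symmetry of
   the kernel both cases contribute equally. *)
have oscE j : osc leb (poisson1 j) (\1_U) = 2%:E * \int[leb]_x ((\1_U x)%:E * psi j x).
  have E1 : \int[leb \x leb]_z (\1_U z.1 * (\1_(~` U) z.2 * poisson1 j z))%:E =
      \int[leb]_x ((\1_U x)%:E * psi j x).
    rewrite fubini_tonelli1//; apply: eq_integral => x _; rewrite /fubini_F/=.
    by under eq_integral do rewrite EFinM; rewrite ge0_integralZl//; exact: mp'.
  have E2 : \int[leb \x leb]_z (\1_U z.2 * (\1_(~` U) z.1 * poisson1 j z))%:E =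
      \int[leb]_x ((\1_U x)%:E * psi j x).
    rewrite fubini_tonelli2//; last 2 first.
    - by have := measurable_poisson1 j => m3; mfun.
    - by move=> z; rewrite lee_fin mulr_ge0// mulr_ge0// poisson1_ge0.
    apply: eq_integral => x _; rewrite /fubini_G/=.
    by under eq_integral do rewrite EFinM poisson1C; rewrite ge0_integralZl//; exact: mp'.
  rewrite mule_natl mule2n -{1}E1 -E2 -ge0_integralD//; last 2 first.
  - by move=> z _; rewrite lee_fin mulr_ge0// mulr_ge0// poisson1_ge0.
  - by have := measurable_poisson1 j => m3; mfun.
  apply: eq_integral => z _; rewrite -EFinD; congr (_%:E).
  rewrite !indicE !in_setC; by case: (z.1 \in U); case: (z.2 \in U); rewrite /=; ring.
have psi_ge0 j x : 0 <= psi j x by exact: integral_ge0.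
have psi1 j x : psi j x <= 1.
  rewrite -(mk_left markov_poisson1 j x); apply: ge0_le_integral => //.
  - exact: mp'.
  - exact: measurable_EFin (mp j x).
  - move=> y _; by rewrite lee_fin ler_piMl ?poisson1_ge0.
have psi0 x : U x -> psi j x @[j --> \oo] --> 0.
  move=> Ux; have [d /= d0 dU] := (nbhs_ballP x U).1 (open_nbhs_nbhs (conj oU Ux)).
  apply: (@squeeze_cvge _ _ _ _ (cst 0) _
    (fun j => ((1 + d ^+ 2) / d ^+ 2 * j.+1%:R^-1)%:E)).
  - apply: nearW => j; rewrite psi_ge0/=.
    pose c := (j.+1%:R^-1 * (1 + d ^+ 2) / d ^+ 2)%R.
    have c0 : (0 <= c)%R by rewrite divr_ge0 ?sqr_ge0// mulr_ge0 ?(ltW (inv_succ_gt0 j))// addr_ge0// sqr_ge0.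
    rewrite (_ : (_ * _)%:E = c%:E * 1); last by rewrite mule1 /c; congr (_%:E); ring.
    rewrite -(mk_left markov_poisson1 0%N x) -ge0_integralZl//; last 2 first.
    + exact: measurable_EFin (mp 0%N x).
    + by move=> y _; rewrite lee_fin poisson1_ge0.
    apply: ge0_le_integral => //.
    + exact: mp'.
    + by apply: emeasurable_funM => //; exact: measurable_EFin (mp 0%N x).
    + move=> y _; rewrite -EFinM lee_fin indicE in_setC.
      have [_|yU] := boolP (y \in U).
        by rewrite mul0r mulr_ge0 ?poisson1_ge0.
      rewrite mul1r poisson1_tail// leNgt; apply: contra yU => xy.
      by rewrite inE; exact: dU.
  - exact: cvg_cst.
  - apply: cvg_EFin; first exact: nearW.
    rewrite -[X in _ --> X](mulr0 ((1 + d ^+ 2) / d ^+ 2)%R).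
    by apply: cvgM; [exact: cvg_cst|exact: cvg_harmonic].
have mpsi j : measurable_fun setT (psi j).
  pose g (z : measurableTypeR R * measurableTypeR R) : \bar R := (\1_(~` U) z.2 * poisson1 j z)%:E.
  have mg : measurable_fun setT g by have := measurable_poisson1 j => m3; mfun.
  have g0 z : 0 <= g z by rewrite lee_fin mulr_ge0// poisson1_ge0.
  exact: (measurable_fun_fubini_tonelli_F (m2 := leb) g mg g0).
have mUe : measurable_fun setT (fun x => (\1_U x)%:E : \bar R).
  by mfun.
have [] := @dominated_convergence _ _ _ leb _ measurableT
  (fun j x => (\1_U x)%:E * psi j x) (cst 0) (EFin \o \1_U).
- by move=> j; exact: emeasurable_funM.
- exact: measurable_cst.
- apply: aeW => x _; rewrite indicE.
  have [/set_mem Ux|_] := boolP (x \in U).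
    by rewrite (_ : (fun _ => _) = psi^~ x); [exact: psi0 Ux|apply/funext => j; rewrite mul1e].
  by rewrite (_ : (fun _ => _) = cst 0); [exact: cvg_cst|apply/funext => j; rewrite mul0e].
- apply/integrableP; split => //.
  under eq_integral => x _ do rewrite gee0_abs ?lee_fin//.
  by rewrite integral_indic// setIT.
- apply: aeW => x n _; rewrite gee0_abs ?mule_ge0 ?lee_fin//.
  by rewrite -[leRHS]mule1 lee_wpmul2l// lee_fin.
move=> _ _; rewrite integral0 => /fine_cvgP[fin cvg0] e e0.
have e2 : (0 < e / 2)%R by rewrite divr_gt0.
have /cvgrPdist_le/(_ _ e2) Hd := cvg0.
near=> j.
rewrite oscE (_ : e = 2 * (e / 2))%R; last lra.
rewrite EFinM lee_wpmul2l// -[leLHS]fineK; last by near: j.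
rewrite lee_fin -[leLHS]subr0 (le_trans (ler_norm _))// distrC.
by near: j.
Unshelve. all: by end_near. Qed.

(** Outer regularity replaces a set of finite measure by an open one at a small cost in L^2. *)
Lemma approx_identity_poisson1 : approx_identity leb poisson1.
Proof.
split=> [|A mA Aoo]; first exact: markov_poisson1.
apply: (vanishing_osc_approx markov_poisson1); first exact: measurable_indic.
move=> e e0; have [U [oU AU Ue]] := lebesgue_regularity_outer mA Aoo e0.
have mU := open_measurable oU.
exists (\1_U); split.
- exact: measurable_indic.
- apply: vanishing_osc_open => //.
  rewrite -(setDKU AU); apply: (le_lt_trans (measureU2 _ _ _)) => //.
    exact: measurableD.
  by rewrite lte_add_pinfty//; apply: lt_trans Ue _; rewrite ltry.
rewrite (eq_integral (fun x : measurableTypeR R => (\1_(U `\` A) x)%:E)); last first.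
  move=> x _; rewrite !indicE in_setD; congr EFin.
  have [xA|xA] := boolP (x \in A).
    have -> : x \in U by rewrite inE; apply: AU; exact/set_mem.
    by rewrite subrr expr0n.
  by rewrite sub0r sqrrN andbT; case: (x \in U); rewrite ?expr1n// expr0n.
rewrite integral_indic//; last exact: measurableD.
by rewrite setIT ltW.
Qed.

Definition poissonRn n j (z : Rn R n * Rn R n) : R :=
  (\prod_(i < n) poisson1 j (tnth z.1 i, tnth z.2 i))%R.

Lemma ge0_integral_cons2 n (G : Rn R n.+1 * Rn R n.+1 -> \bar R) :
  measurable_fun setT G -> (forall z, 0 <= G z) ->
  \int[mu n.+1 \x mu n.+1]_z G z =
  \int[prod_sfm leb (mu n) \x prod_sfm leb (mu n)]_z G (Rn_cons z.1, Rn_cons z.2).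
Proof.
move=> mG G0; rewrite fubini_tonelli1//.
have mF : measurable_fun setT (fubini_F (mu n.+1) G) by exact: measurable_fun_fubini_tonelli_F.
have mcons := @measurable_Rn_cons R n.
rewrite /= /cons_measure ge0_integral_pushforward//; last first.
  by move=> x _; exact: integral_ge0.
rewrite preimage_setT.
pose H (z : (measurableTypeR R * Rn R n) * (measurableTypeR R * Rn R n)) := G (Rn_cons z.1, Rn_cons z.2).
have mH : measurable_fun setT H.
  by apply: (measurableT_comp mG); apply: measurable_fun_pair; apply: (measurableT_comp mcons).
have H0 z : 0 <= H z by exact: G0.
rewrite [RHS](fubini_tonelli1 (m1 := prod_sfm leb (mu n)) (m2 := prod_sfm leb (mu n)) H mH H0).
apply: eq_integral => x _; rewrite /fubini_F/= /cons_measure ge0_integral_pushforward//.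
by apply: (measurableT_comp mG); exact: measurable_pair1.
Qed.

Lemma Rn_consK n (x : Rn R n.+1) : x = Rn_cons (thead x, [tuple of behead x]).
Proof. by rewrite {1}(tuple_eta x). Qed.

Lemma poissonRn_cons n j x y :
  poissonRn j (@Rn_cons R n x, Rn_cons y) = prod_kernel poisson1 (@poissonRn n) j (x, y).
Proof.
rewrite /poissonRn /prod_kernel big_ord_recl/=; congr (_ * _)%R.
by apply: eq_bigr => i _; rewrite !tnthS.
Qed.

Lemma measurable_poissonRn n j : measurable_fun setT (@poissonRn n j).
Proof.
apply: measurable_prod => i _.
apply: (measurableT_comp (measurable_poisson1 j)).
apply: measurable_fun_pair; apply: (measurableT_comp (measurable_tnth i)) => //.
Qed.

Lemma poissonRn_ge0 n j z : (0 <= @poissonRn n j z)%R.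
Proof. by apply: prodr_ge0 => i _; exact: poisson1_ge0. Qed.

(** Induction on the dimension. On R^0, a single point, every oscillation is 0; the step transports
    the product of the line and R^n along [Rn_cons], under which the kernel factorises. *)
Lemma approx_identity_poissonRn n : approx_identity (mu n) (@poissonRn n).
Proof.
elim: n => [|n IH].
  have p1 j z : @poissonRn 0 j z = 1%R by rewrite /poissonRn big_ord0.
  split; first split.
  - exact: measurable_poissonRn.
  - exact: poissonRn_ge0.
  - by move=> j x; under eq_integral do rewrite p1; rewrite integral_cst//= diracT mule1.
  - by move=> j x; under eq_integral do rewrite p1; rewrite integral_cst//= diracT mule1.
  - move=> A mA _ e e0; near=> j; rewrite /osc integral0_eq ?lee_fin ?ltW// => z _.
    by rewrite (tuple0 z.1) (tuple0 z.2) subrr expr0n mul0r.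
have [hk vk] := approx_identity_prod approx_identity_poisson1 IH.
have mcons := @measurable_Rn_cons R n.
split; first split.
- exact: measurable_poissonRn.
- exact: poissonRn_ge0.
- move=> j x; rewrite /= /cons_measure ge0_integral_pushforward//; last 2 first.
  + apply: measurable_EFin; apply: (measurableT_comp (measurable_poissonRn j)).
    exact: measurable_pair1.
  + by move=> y _; rewrite lee_fin poissonRn_ge0.
  rewrite preimage_setT -(mk_left hk j (thead x, [tuple of behead x])).
  by apply: eq_integral => y _; rewrite /= {1}(Rn_consK x) poissonRn_cons.
- move=> j x; rewrite /= /cons_measure ge0_integral_pushforward//; last 2 first.
  + apply: measurable_EFin; apply: (measurableT_comp (measurable_poissonRn j)).
    exact: measurable_pair2.
  + by move=> y _; rewrite lee_fin poissonRn_ge0.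
  rewrite preimage_setT -(mk_right hk j (thead x, [tuple of behead x])).
  by apply: eq_integral => y _; rewrite /= {1}(Rn_consK x) poissonRn_cons.
- move=> A mA Aoo e e0.
  have mA' : measurable (@Rn_cons R n @^-1` A).
    by rewrite -[X in measurable X]setTI; exact: mcons.
  have := vk _ mA' Aoo e e0; apply: filterS => j; apply: le_trans.
  rewrite /osc ge0_integral_cons2.
  + rewrite le_eqVlt; apply/orP; left; apply/eqP; apply: eq_integral => -[x y] _.
    by rewrite poissonRn_cons.
  + apply: measurable_osc_integrand; [exact: measurable_poissonRn|exact: measurable_indic].
  + by move=> z; rewrite lee_fin mulr_ge0 ?sqr_ge0 ?poissonRn_ge0.
Unshelve. all: by end_near. Qed.

End poisson_identity.

(** * Plancherel's identity *)

Section integrable_tensor.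
Context d1 d2 (T1 : measurableType d1) (T2 : measurableType d2) (R : realType).
Variables (m1 : {sigma_finite_measure set T1 -> \bar R})
          (m2 : {sigma_finite_measure set T2 -> \bar R}).
Local Open Scope ereal_scope.

Lemma integrable_tensor (f : T1 -> R) (g : T2 -> R) :
  m1.-integrable setT (EFin \o f) -> m2.-integrable setT (EFin \o g) ->
  (m1 \x m2).-integrable setT (fun z => (f z.1 * g z.2)%:E).
Proof.
move=> /integrableP[/measurable_EFinP mf fi] /integrableP[/measurable_EFinP mg gi].
have mf1 : measurable_fun setT (fun z : T1 * T2 => f z.1) by apply: (measurableT_comp mf).
have mg2 : measurable_fun setT (fun z : T1 * T2 => g z.2) by apply: (measurableT_comp mg).
apply/integrableP; split; first by mfun.
under eq_integral do rewrite /= normrM EFinM.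
rewrite (integral_tensor m1 m2 (f := fun x => `|f x|%:E) (g := fun y => `|g y|%:E))//.
- by rewrite lte_mul_pinfty// ?ge0_fin_numE ?integral_ge0//; exact: integral_ge0.
- by apply: measurable_EFin; exact: measurableT_comp.
- by apply: measurable_EFin; exact: measurableT_comp.
Qed.

Lemma integral_tensor_integrable (f : T1 -> R) (g : T2 -> R) :
  m1.-integrable setT (EFin \o f) -> m2.-integrable setT (EFin \o g) ->
  \int[m1 \x m2]_z (f z.1 * g z.2)%:E = \int[m1]_x (f x)%:E * \int[m2]_y (g y)%:E.
Proof.
move=> fi gi; rewrite -integral12_prod_meas1; last exact: integrable_tensor.
have /fineK Eg := integrable_fin_num measurableT gi.
rewrite -[X in _ * X]Eg -integralZr//; apply: eq_integral => x _; rewrite /fubini_F/= Eg.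
by rewrite -integralZl.
Qed.

(** No integrability is assumed, so Tonelli's theorem is applied to the positive and negative parts
    separately. *)
Lemma measurable_integral_fst (h : T1 * T2 -> R) : measurable_fun setT h ->
  measurable_fun setT (fun y => \int[m1]_x (h (x, y)))%R.
Proof.
move=> mh; rewrite /Rintegral; apply: measurableT_comp => //.
have mhe : measurable_fun setT (EFin \o h) by apply: measurable_EFin.
rewrite (_ : (fun _ => _) = fun y => fubini_G m1 (EFin \o h)^\+ y - fubini_G m1 (EFin \o h)^\- y).
  by apply: emeasurable_funB; apply: measurable_fun_fubini_tonelli_G => //;
    [exact: measurable_funepos|exact: measurable_funeneg].
by apply/funext => y; rewrite [LHS]integralE; congr (_ - _); apply: eq_integral => x _; rewrite ?funeposE ?funenegE.
Qed.

End integrable_tensor.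

Section exponential_weight.
Context {R : realType}.
Local Notation leb := (@lebesgue_measure R).
Local Notation mu n := (lebesgueRn R n).
Local Open Scope ereal_scope.

Definition phase n (c : 'I_n -> R) (xi : Rn R n) : R := (\sum_(i < n) c i * tnth xi i)%R.

(** The exponential of -e times the l^1 norm of xi. This norm, unlike the Euclidean one, makes the
    weight a product over the coordinates, and its Fourier transform a product of Poisson
    kernels. *)
Definition weight n (e : R) (xi : Rn R n) : R := (\prod_(i < n) laplace e (tnth xi i))%R.

Lemma weight_ge0 n e xi : (0 <= @weight n e xi)%R.
Proof. by apply: prodr_ge0 => i _; exact: laplace_ge0. Qed.

Lemma measurable_weight n e : measurable_fun setT (@weight n e).
Proof.
apply: measurable_prod => i _; apply: (measurableT_comp (measurable_laplace e)).
exact: measurable_tnth.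
Qed.

Lemma measurable_phase n (c : 'I_n -> R) : measurable_fun setT (phase c).
Proof. by apply: measurable_sum => i; apply: measurable_funM => //; exact: measurable_tnth. Qed.

Lemma weight_cons n e a xi : weight e (@Rn_cons R n (a, xi)) = (laplace e a * weight e xi)%R.
Proof.
rewrite /weight big_ord_recl/=; congr (_ * _)%R.
by apply: eq_bigr => i _; rewrite tnthS.
Qed.

Lemma phase_cons n (c : 'I_n.+1 -> R) a xi :
  phase c (@Rn_cons R n (a, xi)) = (c ord0 * a + phase (c \o lift ord0) xi)%R.
Proof.
rewrite /phase big_ord_recl/=; congr (_ + _)%R.
by apply: eq_bigr => i _; rewrite tnthS.
Qed.

Lemma integral_weight_lty n e : (0 < e)%R -> \int[mu n]_xi (weight e xi)%:E < +oo.
Proof.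
move=> e0; elim: n => [|n IH].
  under eq_integral do rewrite /weight big_ord0.
  by rewrite integral_cst//= diracT mule1 ltry.
rewrite ge0_integral_cons; last 2 first.
- by apply: measurable_EFin; exact: measurable_weight.
- by move=> x; rewrite lee_fin weight_ge0.
under eq_integral => a _.
  under eq_integral do rewrite weight_cons EFinM.
  rewrite ge0_integralZl//; [|by apply: measurable_EFin; exact: measurable_weight
    |by move=> x _; rewrite lee_fin weight_ge0|by rewrite lee_fin laplace_ge0].
  over.
rewrite ge0_integralZr//.
- rewrite integral_laplace// lte_mul_pinfty// lee_fin; exact: divr_ge0 (ltW e0).
- by apply: measurable_EFin; exact: measurable_laplace.
- by move=> x _; rewrite lee_fin laplace_ge0.
- by apply: integral_ge0 => x _; rewrite lee_fin weight_ge0.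
Qed.

Lemma integrable_weightM n e (h : Rn R n -> R) : (0 < e)%R -> measurable_fun setT h ->
  (forall x, `|h x| <= 1)%R -> (mu n).-integrable setT (fun x => (weight e x * h x)%:E).
Proof.
move=> e0 mh h1; have mw := measurable_weight e (n := n).
apply: (@le_integrable _ _ _ (mu n) setT measurableT _ (fun x => (weight e x)%:E)).
- by mfun.
- by move=> x _ /=; rewrite lee_fin normrM ger0_norm ?weight_ge0// ler_piMr ?weight_ge0.
- apply/integrableP; split; first by mfun.
  under eq_integral => x _ do rewrite gee0_abs ?lee_fin ?weight_ge0//.
  exact: integral_weight_lty.
Qed.

Lemma measurable_cos_phase n (c : 'I_n -> R) : measurable_fun setT (fun x => cos (phase c x)).
Proof.
apply: (measurableT_comp (f := @cos R)); last exact: measurable_phase.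
by apply: continuous_measurable_fun; exact: continuous_cos.
Qed.

Lemma measurable_sin_phase n (c : 'I_n -> R) : measurable_fun setT (fun x => sin (phase c x)).
Proof.
apply: (measurableT_comp (f := @sin R)); last exact: measurable_phase.
by apply: continuous_measurable_fun; exact: continuous_sin.
Qed.

(** Both integrals go through one induction: the addition formulas express each in dimension n + 1
    by both in dimension n. The sine integrals vanish by oddness, which leaves a product of
    one-dimensional cosine integrals. *)
Lemma integral_weight_cos_sin n e (c : 'I_n -> R) : (0 < e)%R ->
  \int[mu n]_xi (weight e xi * cos (phase c xi))%:E = (\prod_(i < n) (2 * poisson e (c i)))%:E /\
  \int[mu n]_xi (weight e xi * sin (phase c xi))%:E = 0.
Proof.
move=> e0; elim: n c => [|n IH] c.
  rewrite big_ord0; split.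
    under eq_integral do rewrite /weight /phase !big_ord0 cos0 mul1r.
    by rewrite integral_cst//= diracT mule1.
  under eq_integral do rewrite /weight /phase !big_ord0 sin0 mul1r.
  by rewrite integral0.
have [IHc IHs] := IH (c \o lift ord0).
set c' := c \o lift ord0 in IHc IHs.
have iC := integrable_weightM e0 (measurable_cos_phase c') (fun x => norm_cos_le1 _).
have iS := integrable_weightM e0 (measurable_sin_phase c') (fun x => norm_sin_le1 _).
have lc := integrable_laplaceM e0 (measurable_cosM (c ord0)) (fun x => norm_cos_le1 _).
have ls := integrable_laplaceM e0 (measurable_sinM (c ord0)) (fun x => norm_sin_le1 _).
split.
- rewrite integral_cons; last first.
    exact: (integrable_weightM e0 (measurable_cos_phase c) (fun x => norm_cos_le1 _)).
  transitivity (\int[leb]_a ((laplace e a * cos (c ord0 * a))%:E *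
     (\prod_(i < n) (2 * poisson e (c' i)))%:E)).
    apply: eq_integral => a _.
    under eq_integral => x _.
      rewrite weight_cons phase_cons cosD -/c'.
      rewrite (_ : (_ * _)%R = (laplace e a * cos (c ord0 * a) * (weight e x * cos (phase c' x)) -
        laplace e a * sin (c ord0 * a) * (weight e x * sin (phase c' x)))%R); last by ring.
      rewrite EFinB EFinM [X in _ - X]EFinM; over.
    rewrite integralB//; [|exact: integrableZl|exact: integrableZl].
    by rewrite !integralZl// IHc IHs mule0 sube0.
  rewrite integralZr// integral_laplace_cos// -EFinM; congr (_%:E).
  by rewrite [RHS]big_ord_recl.
- rewrite integral_cons; last first.
    exact: (integrable_weightM e0 (measurable_sin_phase c) (fun x => norm_sin_le1 _)).
  transitivity (\int[leb]_a ((laplace e a * sin (c ord0 * a))%:E *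
     (\prod_(i < n) (2 * poisson e (c' i)))%:E)).
    apply: eq_integral => a _.
    under eq_integral => x _.
      rewrite weight_cons phase_cons sinD -/c'.
      rewrite (_ : (_ * _)%R = (laplace e a * sin (c ord0 * a) * (weight e x * cos (phase c' x)) +
        laplace e a * cos (c ord0 * a) * (weight e x * sin (phase c' x)))%R); last by ring.
      rewrite EFinD EFinM [X in _ + X]EFinM; over.
    rewrite integralD//; [|exact: integrableZl|exact: integrableZl].
    by rewrite !integralZl// IHc IHs mule0 adde0.
  by rewrite integralZr// integral_laplace_sin// mul0e.
Qed.

End exponential_weight.

Section plancherel.
Context {R : realType} (n : nat).
Local Notation mu := (lebesgueRn R n).
Local Open Scope ereal_scope.

Lemma measurable_cos_dot : measurable_fun setT (fun z : Rn R n * Rn R n => cos (dotRn z.1 z.2)).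
Proof.
apply: (measurableT_comp (f := @cos R)); last exact: measurable_dotRn.
by apply: continuous_measurable_fun; exact: continuous_cos.
Qed.

Lemma measurable_sin_dot : measurable_fun setT (fun z : Rn R n * Rn R n => sin (dotRn z.1 z.2)).
Proof.
apply: (measurableT_comp (f := @sin R)); last exact: measurable_dotRn.
by apply: continuous_measurable_fun; exact: continuous_sin.
Qed.

Definition cos_transform (v : Rn R n -> R) (xi : Rn R n) : R :=
  (\int[mu]_x (cos (dotRn x xi) * v x))%R.
Definition sin_transform (v : Rn R n -> R) (xi : Rn R n) : R :=
  (\int[mu]_x (sin (dotRn x xi) * v x))%R.

Lemma integrable_bddM (v h : Rn R n -> R) : measurable_fun setT h ->
  (forall x, `|h x| <= 1)%R -> mu.-integrable setT (EFin \o v) ->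
  mu.-integrable setT (fun x => (h x * v x)%:E).
Proof.
move=> mh h1 vi; have mv : measurable_fun setT v by case/integrableP: vi => /measurable_EFinP.
apply: (le_integrable measurableT _ _ vi); first by mfun.
by move=> x _ /=; rewrite lee_fin normrM ler_piMl.
Qed.

Lemma integrable_cos_dot (v : Rn R n -> R) xi : mu.-integrable setT (EFin \o v) ->
  mu.-integrable setT (EFin \o (fun x => cos (dotRn x xi) * v x)%R).
Proof.
apply: integrable_bddM; last by move=> x; exact: norm_cos_le1.
exact: (measurableT_comp measurable_cos_dot (measurable_pair2 _)).
Qed.

Lemma integrable_sin_dot (v : Rn R n -> R) xi : mu.-integrable setT (EFin \o v) ->
  mu.-integrable setT (EFin \o (fun x => sin (dotRn x xi) * v x)%R).
Proof.
apply: integrable_bddM; last by move=> x; exact: norm_sin_le1.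
exact: (measurableT_comp measurable_sin_dot (measurable_pair2 _)).
Qed.

Lemma measurable_cos_transform v : measurable_fun setT v -> measurable_fun setT (cos_transform v).
Proof.
move=> mv; apply: (measurable_integral_fst mu (h := fun z => cos (dotRn z.1 z.2) * v z.1)%R).
by apply: measurable_funM; [exact: measurable_cos_dot|apply: (measurableT_comp mv)].
Qed.

Lemma measurable_sin_transform v : measurable_fun setT v -> measurable_fun setT (sin_transform v).
Proof.
move=> mv; apply: (measurable_integral_fst mu (h := fun z => sin (dotRn z.1 z.2) * v z.1)%R).
by apply: measurable_funM; [exact: measurable_sin_dot|apply: (measurableT_comp mv)].
Qed.

Variable v : Rn R n -> R.
Hypothesis vi : mu.-integrable setT (EFin \o v).

Let mv : measurable_fun setT v. Proof. by case/integrableP: vi => /measurable_EFinP. Qed.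

(** The squared modulus of the Fourier transform of the real function v. *)
Definition spectrum xi : R := (cos_transform v xi ^+ 2 + sin_transform v xi ^+ 2)%R.

Lemma spectrum_ge0 xi : (0 <= spectrum xi)%R.
Proof. by rewrite addr_ge0 ?sqr_ge0. Qed.

Lemma measurable_spectrum : measurable_fun setT spectrum.
Proof.
by apply: measurable_funD; apply: measurable_funX;
  [exact: measurable_cos_transform|exact: measurable_sin_transform].
Qed.

Let dphase (z : Rn R n * Rn R n) i : R := (tnth z.1 i - tnth z.2 i)%R.

Let phase_dphase z xi : phase (dphase z) xi = (dotRn z.1 xi - dotRn z.2 xi)%R.
Proof. by rewrite /phase /dotRn -sumrB; apply: eq_bigr => i _; rewrite mulrBl. Qed.

(** Squares of integrals are double integrals, and the formula for the cosine of a difference merges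
    the cosine and sine contributions. *)
Lemma spectrumE xi : (spectrum xi)%:E =
  \int[mu \x mu]_z (cos (phase (dphase z) xi) * (v z.1 * v z.2))%:E.
Proof.
have iC := integrable_cos_dot xi vi; have iS := integrable_sin_dot xi vi.
have iCC := integrable_tensor iC iC; have iSS := integrable_tensor iS iS.
under eq_integral => z _.
  rewrite phase_dphase cosB (_ : (_ * _)%R =
   ((cos (dotRn z.1 xi) * v z.1) * (cos (dotRn z.2 xi) * v z.2) +
    (sin (dotRn z.1 xi) * v z.1) * (sin (dotRn z.2 xi) * v z.2))%R); last by ring.
  rewrite EFinD; over.
rewrite integralD//.
rewrite (integral_tensor_integrable iC iC) (integral_tensor_integrable iS iS).
have /fineK <- := integrable_fin_num measurableT iC.
have /fineK <- := integrable_fin_num measurableT iS.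
by rewrite -!EFinM -EFinD.
Qed.

(** The weight makes the triple integrand absolutely integrable, with majorant |v(x) v(y)| [weight],
    so Fubini allows integration in xi first. Each coordinate then yields 2 [poisson] = 2 pi
    [poisson1], whence the factor (2 pi)^n. *)
Lemma integral_weight_spectrum j : let e : R := (j.+1%:R^-1)%R in
  \int[mu]_xi (weight e xi * spectrum xi)%:E =
  \int[mu \x mu]_z ((2 * pi) ^+ n * (v z.1 * v z.2 * poissonRn j z))%:E.
Proof.
move=> e; have e0 : (0 < e)%R := inv_succ_gt0 j.
have mw := measurable_weight (n := n) e.
pose W (p : (Rn R n * Rn R n) * Rn R n) : \bar R :=
  (v p.1.1 * v p.1.2 * (weight e p.2 * cos (phase (dphase p.1) p.2)))%:E.
have ivv := integrable_tensor vi vi.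
have mvv : measurable_fun setT (fun z : Rn R n * Rn R n => v z.1 * v z.2)%R.
  by case/integrableP : ivv => /measurable_EFinP.
have mcos : measurable_fun setT (fun p : (Rn R n * Rn R n) * Rn R n => cos (phase (dphase p.1) p.2)).
  apply: (measurableT_comp (f := @cos R)); first by apply: continuous_measurable_fun; exact: continuous_cos.
  apply: measurable_sum => i; apply: measurable_funM; [apply: measurable_funB|].
  - by apply: (measurableT_comp (measurable_tnth i)); apply: measurableT_comp.
  - by apply: (measurableT_comp (measurable_tnth i)); apply: measurableT_comp.
  - by apply: (measurableT_comp (measurable_tnth i)).
have iw : mu.-integrable setT (EFin \o weight e).
  apply/integrableP; split; first exact: measurable_EFin.
  under eq_integral => x _ do rewrite gee0_abs ?lee_fin ?weight_ge0//.
  exact: integral_weight_lty.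
have iW : ((prod_sfm mu mu) \x mu).-integrable setT W.
  have := integrable_tensor (m1 := prod_sfm mu mu) (m2 := mu) ivv iw.
  apply: le_integrable => //.
    apply: measurable_EFin; apply: measurable_funM; first by apply: (measurableT_comp mvv).
    by apply: measurable_funM => //; apply: (measurableT_comp mw).
  move=> p _; rewrite /W !abse_EFin lee_fin normrM [leRHS]normrM ler_wpM2l//.
  by rewrite normrM ler_piMr// norm_cos_le1.
have F := Fubini iW; rewrite /W/= in F.
transitivity (\int[mu]_y \int[prod_sfm mu mu]_x
   (v x.1 * v x.2 * (weight e y * cos (phase (dphase x) y)))%:E).
  apply: eq_integral => xi _; rewrite EFinM spectrumE.
  rewrite -integralZl//.
    by apply: eq_integral => z _; rewrite -EFinM; congr (_%:E); ring.
  apply: (le_integrable measurableT _ _ ivv).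
    apply: measurable_EFin; apply: measurable_funM => //.
    exact: (measurableT_comp mcos (measurable_pair2 _)).
  by move=> z _ /=; rewrite lee_fin normrM ler_piMl ?norm_cos_le1.
rewrite -F; apply: eq_integral => z _.
under eq_integral do rewrite EFinM.
rewrite integralZl//; last exact: integrable_weightM e0 (measurable_cos_phase _) (fun x => norm_cos_le1 _).
rewrite (integral_weight_cos_sin (dphase z) e0).1 -EFinM; congr (_%:E).
rewrite mulrCA; congr (_ * _)%R.
rewrite /poissonRn -[X in (_ ^+ X)%R]card_ord -prodr_const -big_split/=; apply: eq_bigr => i _.
have pi0 : pi != 0%R :> R by rewrite gt_eqF// pi_gt0.
have cancel (p q : R) : p != 0%R -> (2 * q = 2 * p * (q / p))%R by move=> p0; field.
exact: cancel.
Qed.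

Hypothesis v2oo : \int[mu]_x (v x ^+ 2)%:E < +oo.

Let hk := (approx_identity_poissonRn (R := R) n).1.

Let i1 j : (mu \x mu).-integrable setT (fun z => (v z.1 ^+ 2 * poissonRn j z)%:E).
Proof.
have mv1 := measurable_comp_fst mv; have mp := measurable_poissonRn (R := R) (n := n) j.
apply/integrableP; split; first by mfun.
rewrite (eq_integral (fun z => (v z.1 ^+ 2 * poissonRn j z)%:E)); last first.
  by move=> z _; rewrite gee0_abs// lee_fin mulr_ge0 ?sqr_ge0 ?poissonRn_ge0.
by rewrite (integral_sqr_fst (mk_measurable hk j) (mk_ge0 hk j) (mk_left hk j) mv).
Qed.

Let i2 j : (mu \x mu).-integrable setT (fun z => (v z.2 ^+ 2 * poissonRn j z)%:E).
Proof.
have mv1 := measurable_comp_snd mv; have mp := measurable_poissonRn (R := R) (n := n) j.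
apply/integrableP; split; first by mfun.
rewrite (eq_integral (fun z => (v z.2 ^+ 2 * poissonRn j z)%:E)); last first.
  by move=> z _; rewrite gee0_abs// lee_fin mulr_ge0 ?sqr_ge0 ?poissonRn_ge0.
by rewrite (integral_sqr_snd (mk_measurable hk j) (mk_ge0 hk j) (mk_right hk j) mv).
Qed.

Let i12 j : (mu \x mu).-integrable setT (fun z => (v z.1 * v z.2 * poissonRn j z)%:E).
Proof.
have mv1 := measurable_comp_fst mv; have mv2 := measurable_comp_snd mv; have mp := measurable_poissonRn (R := R) (n := n) j.
apply: (le_integrable measurableT _ _ (integrableD measurableT (i1 j) (i2 j))); first by mfun.
move=> z _; rewrite -[leRHS]/(`|(v z.1 ^+ 2 * poissonRn j z + v z.2 ^+ 2 * poissonRn j z)%:E|).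
rewrite -mulrDl !abse_EFin lee_fin normrM [leRHS]normrM ler_wpM2r//.
rewrite [leRHS]ger0_norm ?addr_ge0 ?sqr_ge0//.
rewrite ler_norml; apply/andP; split; rewrite -subr_ge0.
  rewrite (_ : _ - _ = ((v z.1 + v z.2) ^+ 2 + (v z.1 ^+ 2 + v z.2 ^+ 2)) / 2)%R; last by field.
  by rewrite divr_ge0// !addr_ge0// sqr_ge0.
rewrite (_ : _ - _ = ((v z.1 - v z.2) ^+ 2 + (v z.1 ^+ 2 + v z.2 ^+ 2)) / 2)%R; last by field.
by rewrite divr_ge0// !addr_ge0// sqr_ge0.
Qed.

(** By 2 v(x) v(y) = v(x)^2 + v(y)^2 - (v(x) - v(y))^2, the damped spectral integral falls short of
    the Plancherel value by exactly half the oscillation times (2 pi)^n. *)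
Let weight_spectrum_osc j :
  2%:E * \int[mu]_xi (weight j.+1%:R^-1 xi * spectrum xi)%:E +
    ((2 * pi) ^+ n)%:E * osc mu (@poissonRn R n j) v =
  2%:E * (((2 * pi) ^+ n)%:E * \int[mu]_x (v x ^+ 2)%:E).
Proof.
rewrite integral_weight_spectrum/=.
have iD := integrableD measurableT (i1 j) (i2 j).
have iZ := integrableZl measurableT 2 (i12 j).
have /fineK EX := integrable_fin_num measurableT (i12 j).
set X := \int[_]_z _ in EX.
have oscE : osc mu (@poissonRn R n j) v = 2%:E * \int[mu]_x (v x ^+ 2)%:E - 2%:E * X.
  transitivity (\int[mu \x mu]_z (((v z.1 ^+ 2 * poissonRn j z)%:E + (v z.2 ^+ 2 * poissonRn j z)%:E) -
      2%:E * (v z.1 * v z.2 * poissonRn j z)%:E)).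
    apply: eq_integral => z _; by rewrite -EFinM -EFinD; congr (_%:E); ring.
  rewrite integralB// integralD// integralZl//.
  rewrite (integral_sqr_fst (mk_measurable hk j) (mk_ge0 hk j) (mk_left hk j) mv).
  rewrite (integral_sqr_snd (mk_measurable hk j) (mk_ge0 hk j) (mk_right hk j) mv).
  by congr (_ - _); rewrite mule_natl mule2n.
have /fineK EV : \int[mu]_x (v x ^+ 2)%:E \is a fin_num.
  by rewrite ge0_fin_numE// integral_ge0// => x _; rewrite lee_fin sqr_ge0.
under eq_integral do rewrite EFinM.
rewrite integralZl// -/X oscE -EX -EV -!EFinM -!EFinD -?EFinM -?EFinD.
by congr (_%:E); ring.
Qed.

(** The weights increase to 1. Nonnegativity of the oscillation bounds every damped integral, and
    monotone convergence gives one inequality. For the other, the damped integral is at most the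
    full one, and some index j makes the oscillation small. *)
Theorem plancherel : \int[mu]_xi (spectrum xi)%:E = ((2 * pi) ^+ n)%:E * \int[mu]_x (v x ^+ 2)%:E.
Proof.
have c0 : (0 <= (2 * pi) ^+ n :> R)%R by rewrite exprn_ge0// mulr_ge0// pi_ge0.
have ms := measurable_spectrum.
have mw j := measurable_weight (n := n) (j.+1%:R^-1 : R).
have /fineK EV : \int[mu]_x (v x ^+ 2)%:E \is a fin_num.
  by rewrite ge0_fin_numE// integral_ge0// => x _; rewrite lee_fin sqr_ge0.
have ws0 j xi : 0 <= (weight (j.+1%:R^-1 : R) xi * spectrum xi)%:E.
  by rewrite lee_fin mulr_ge0 ?spectrum_ge0 ?weight_ge0.
have mws j : measurable_fun setT (fun xi => (weight (j.+1%:R^-1 : R) xi * spectrum xi)%:E).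
  by apply: measurable_EFin; apply: measurable_funM; [exact: mw|exact: ms].
have le_j j : \int[mu]_xi (weight j.+1%:R^-1 xi * spectrum xi)%:E <=
    ((2 * pi) ^+ n)%:E * \int[mu]_x (v x ^+ 2)%:E.
  rewrite -(@lee_pmul2l _ 2%:E)// -(weight_spectrum_osc j) leeDl//.
  by rewrite mule_ge0 ?lee_fin//; apply: osc_ge0; exact: poissonRn_ge0.
apply/eqP; rewrite eq_le; apply/andP; split.
- have wE j xi : weight (j.+1%:R^-1 : R) xi = expR (- (j.+1%:R^-1 * \sum_(i < n) `|tnth xi i|)).
    by rewrite mulr_sumr -sumrN expR_sum.
  have cvgw xi : (weight (j.+1%:R^-1 : R) xi * spectrum xi)%:E @[j --> \oo] --> (spectrum xi)%:E.
    apply: cvg_EFin; first exact: nearW.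
    rewrite (_ : _ \o _ = fun j => expR (- (j.+1%:R^-1 * \sum_(i < n) `|tnth xi i|)) * spectrum xi)%R; last first.
      by apply/funext => j; rewrite /= wE.
    rewrite -[X in _ --> X]mul1r; apply: cvgM; last exact: cvg_cst.
    rewrite -[X in _ --> X]expR0; apply: continuous_cvg; first exact: continuous_expR.
    rewrite -[X in _ --> X]oppr0; apply: cvgN.
    by rewrite -[X in _ --> X](mul0r (\sum_(i < n) `|tnth xi i|)%R); apply: cvgM; [exact: cvg_harmonic|exact: cvg_cst].
  have H := cvg_monotone_convergence (mu := mu) measurableT mws (fun j x _ => ws0 j x).
  rewrite (eq_integral (fun xi => limn (fun j => (weight (j.+1%:R^-1 : R) xi * spectrum xi)%:E))); last first.
    by move=> xi _; apply/esym/cvg_lim => //; exact: cvgw.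
  apply: (cvge_to_le (H _)); last exact: nearW.
  move=> xi _ i j ij; rewrite lee_fin ler_wpM2r ?spectrum_ge0// !wE ler_expR lerN2 ler_wpM2r//.
    by apply: sumr_ge0 => k _.
  by rewrite lef_pV2 ?posrE ?ltr0n// ler_nat.
- apply/lee_addgt0Pr => e e0.
  have [_ vA] := approx_identity_poissonRn (R := R) n.
  (* Multiplied by (2 pi)^n, this tolerance is at most 2 e, and the identity above is doubled. *)
  have d0 : (0 < 2 * e / ((2 * pi) ^+ n + 1))%R by rewrite divr_gt0 ?mulr_gt0//; lra.
  have := vanishing_osc_L2 hk vA mv v2oo d0.
  move=> [j _ /(_ j (leqnn j))/= Hj].
  have W : \int[mu]_xi (weight j.+1%:R^-1 xi * spectrum xi)%:E <= \int[mu]_xi (spectrum xi)%:E.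
    apply: ge0_le_integral => //; first exact: measurable_EFin.
    move=> xi _; rewrite lee_fin ler_piMl ?spectrum_ge0//.
    apply: prodr_ile1 => i _; rewrite laplace_ge0/= expR_le1 oppr_le0.
    by rewrite mulr_ge0// ltW// inv_succ_gt0.
  rewrite -(@lee_pmul2l _ 2%:E)// -(weight_spectrum_osc j).
  have S0 : 0 <= \int[mu]_xi (spectrum xi)%:E.
    by apply: integral_ge0 => xi _; rewrite lee_fin spectrum_ge0.
  rewrite [leRHS](@ge0_muleDr _ _ (\int[mu]_xi (spectrum xi)%:E) e%:E)//; last by rewrite lee_fin ltW.
  apply: leeD; first exact: lee_wpmul2l.
  apply: (le_trans (lee_wpmul2l _ Hj)); rewrite ?lee_fin//.
  rewrite mulrC; apply: ler_div_succ_mul => //.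
  by rewrite mulr_ge0 ?ltW.
Qed.

End plancherel.

(** * L^2 norms, cubes and the Fourier transform on L^2 *)

Section L2_norm.
Context {R : realType} (n : nat).
Local Notation mu := (lebesgueRn R n).
Implicit Types f g v : Rn R n -> R.
Local Open Scope ereal_scope.

Lemma Lnorm2_sqr f : ('N[mu]_2%:E[EFin \o f]) `^ 2 = \int[mu]_x (f x ^+ 2)%:E.
Proof.
rewrite poweR_Lnorm//; apply: eq_integral => x _ /=.
by rewrite powR_mulrn// real_normK ?num_real.
Qed.

Lemma isL2_measurable f : isL2 f -> measurable_fun setT f.
Proof. by rewrite /isL2 inE => /andP[/[!inE]]. Qed.

Lemma isL2_lty f : isL2 f -> \int[mu]_x (f x ^+ 2)%:E < +oo.
Proof.
rewrite /isL2 inE => /andP[_]; rewrite inE/= /finite_norm => h.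
by rewrite -Lnorm2_sqr poweR_lty.
Qed.

Lemma normL2_ge0 f : (0 <= normL2 f)%R.
Proof. by rewrite fine_ge0// Lnorm_ge0. Qed.

Lemma normL2_sqr f : isL2 f -> (normL2 f ^+ 2)%:E = \int[mu]_x (f x ^+ 2)%:E.
Proof.
rewrite -Lnorm2_sqr /isL2 inE => /andP[_]; rewrite inE/= /finite_norm => h.
have <- : (normL2 f)%:E = 'N[mu]_2%:E[EFin \o f].
  by rewrite /normL2 fineK// ge0_fin_numE// Lnorm_ge0.
by rewrite poweR_EFin powR_mulrn// normL2_ge0.
Qed.

Lemma isL11_integrable f : isL11 f -> mu.-integrable setT (EFin \o f).
Proof. by move=> [/Lfun1_integrable]. Qed.

Lemma isL11_integrable1 f : isL11 f ->
  mu.-integrable setT (fun x => ((1 + normRn x) * f x)%:E).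
Proof. by move=> [_ /Lfun1_integrable]. Qed.

Lemma normRn_ge0 (x : Rn R n) : (0 <= normRn x)%R.
Proof. exact: sqrtr_ge0. Qed.

Lemma normL11E f : isL11 f ->
  normL11 f = (\int[mu]_x ((1 + normRn x) * `|f x|))%R.
Proof.
move=> _; rewrite /normL11 Lnorm1 /Rintegral; congr fine; apply: eq_integral => x _ /=.
by rewrite normrM ger0_norm// addr_ge0// normRn_ge0.
Qed.

Lemma normL11_ge0 f : (0 <= normL11 f)%R.
Proof. by rewrite fine_ge0// Lnorm_ge0. Qed.

End L2_norm.

Section cube.
Context {R : realType}.
Local Notation leb := (@lebesgue_measure R).
Local Notation mu n := (lebesgueRn R n).
Local Open Scope ereal_scope.

Definition cube n (c : 'I_n -> R) (r : R) : set (Rn R n) :=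
  [set x | forall i, (`|tnth x i - c i| <= r)%R].

Lemma measurable_cube n (c : 'I_n -> R) r : measurable (cube c r).
Proof.
rewrite (_ : cube c r = \bigcap_(i in [set: 'I_n]) ((@tnth n _)^~ i @^-1` `[(c i - r)%R, (c i + r)%R]%classic)).
  apply: fin_bigcap_measurable => // i _; rewrite -[X in measurable X]setTI.
  exact: measurable_tnth.
apply/seteqP; split => [x xc i _|x xc i]/=.
  by rewrite in_itv/=; have := xc i; rewrite ler_distl.
by have := xc i I; rewrite /= in_itv/= ler_distl.
Qed.

Lemma mem_cube_cons n (c : 'I_n.+1 -> R) r a x :
  cube c r (@Rn_cons R n (a, x)) <-> (`|a - c ord0| <= r)%R /\ cube (c \o lift ord0) r x.
Proof.
split=> [H|[Ha Hx] i].
  split; first exact: (H ord0).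
  by move=> i; have := H (lift ord0 i); rewrite /Rn_cons tnthS.
by case: (unliftP ord0 i) => [j ->|->]//; rewrite /Rn_cons tnthS.
Qed.

Lemma integral_indic_itv (a r : R) : (0 <= r)%R ->
  \int[leb]_x (\1_(`[(a - r)%R, (a + r)%R]%classic : set R) x)%:E = (2 * r)%:E.
Proof.
move=> r0; transitivity (lebesgue_measure `[(a - r)%R, (a + r)%R]%classic).
  by rewrite integral_indic// setIT.
rewrite lebesgue_measure_itv/= lte_fin; case: ifPn => [_|].
  by rewrite -EFinB; congr (_%:E); ring.
by rewrite -leNgt => h; (have -> : r = 0%R by apply/eqP; rewrite eq_le r0 andbT; lra); rewrite mulr0.
Qed.

Lemma cube_measure n (c : 'I_n -> R) r : (0 <= r)%R -> mu n (cube c r) = ((2 * r) ^+ n)%:E.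
Proof.
move=> r0; elim: n c => [|n IH] c.
  by rewrite /= diracE mem_set// => -[].
have IH' c' : \int[mu n]_x (\1_(cube c' r) x)%:E = ((2 * r) ^+ n)%:E.
  by rewrite integral_indic//; [rewrite setIT; exact: IH|exact: measurable_cube].
have <- : \int[mu n.+1]_x (\1_(cube c r) x)%:E = mu n.+1 (cube c r).
  by rewrite integral_indic ?setIT//; exact: measurable_cube.
rewrite ge0_integral_cons; last 2 first.
- by apply: measurable_EFin; apply: measurable_indic; exact: measurable_cube.
- by move=> x; rewrite lee_fin.
under eq_integral => a _.
  under eq_integral => x _.
    rewrite (_ : \1_(cube c r) (Rn_cons (a, x)) =
      \1_(`[(c ord0 - r)%R, (c ord0 + r)%R]%classic : set R) a * \1_(cube (c \o lift ord0) r) x)%R; last first.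
      rewrite !indicE -natrM mulnb; congr ((nat_of_bool _)%:R)%R.
      apply/idP/andP; rewrite !inE/= in_itv/= -ler_distl.
        by move/mem_cube_cons.
      by move=> h; exact/mem_cube_cons.
    rewrite EFinM; over.
  rewrite ge0_integralZl//; [|by apply: measurable_EFin; apply: measurable_indic; exact: measurable_cube].
  rewrite IH'; over.
rewrite ge0_integralZr//; [|by apply: measurable_EFin; apply: measurable_indic|by rewrite lee_fin exprn_ge0// mulr_ge0].
by rewrite integral_indic_itv// -EFinM exprS.
Qed.

Lemma integral_indic_cube n (c : 'I_n -> R) r : (0 <= r)%R ->
  \int[mu n]_x (\1_(cube c r) x)%:E = ((2 * r) ^+ n)%:E.
Proof.
by move=> r0; rewrite integral_indic//; [rewrite setIT; exact: cube_measure|exact: measurable_cube].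
Qed.

End cube.

Section fourierL2.
Context {R : realType} (n : nat).
Local Notation mu := (lebesgueRn R n).
Implicit Types (v : Rn R n -> R) (g : Rn R n -> R[i]).
Local Open Scope ereal_scope.

Lemma norm_tnth_le (x : Rn R n) i : (`|tnth x i : R| <= normRn x)%R.
Proof.
rewrite /normRn -sqrtr_sqr ler_sqrt; last by apply: sumr_ge0 => j _; rewrite -expr2 sqr_ge0.
rewrite /dotRn (bigD1 i)//= -expr2 lerDl.
by apply: sumr_ge0 => j _; rewrite -expr2 sqr_ge0.
Qed.

Definition sqr_modulus g (xi : Rn R n) : R := (complex.Re (g xi) ^+ 2 + complex.Im (g xi) ^+ 2)%R.

Lemma sqr_modulus_ge0 g xi : (0 <= sqr_modulus g xi)%R.
Proof. by rewrite addr_ge0// sqr_ge0. Qed.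

Lemma sqr_modulus_fourier v xi : sqr_modulus (fourier v) xi = spectrum v xi.
Proof. by rewrite /sqr_modulus /fourier/= sqrrN. Qed.

Lemma normL2C_sqr g : (normL2C g) `^ 2 = \int[mu]_xi (sqr_modulus g xi)%:E.
Proof.
rewrite /normL2C Lnorm2_sqr; apply: eq_integral => xi _.
rewrite /sqr_modulus; case: (g xi) => a b /=.
by rewrite sqr_sqrtr// addr_ge0// sqr_ge0.
Qed.

Definition truncate v (k : nat) : Rn R n -> R := v \_ [set x | (normRn x <= k%:R)%R].

Let ball k : set (Rn R n) := [set x | (normRn x <= k%:R)%R].

Let mball k : measurable (ball k).
Proof.
rewrite (_ : ball k = (@normRn R n) @^-1` `]-oo, k%:R]%classic).
  by rewrite -[X in measurable X]setTI; apply: measurable_normRn.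
by apply/seteqP; split => x /=; rewrite in_itv.
Qed.

Let ball_lty k : mu (ball k) < +oo.
Proof.
have mc := @measurable_cube R n (fun=> 0%R) k%:R.
apply: (@le_lt_trans _ _ (mu (cube (fun=> 0%R) k%:R))).
  apply: le_measure; rewrite ?inE// => x xk i; rewrite subr0.
  exact: le_trans (norm_tnth_le x i) xk.
by rewrite cube_measure// ltry.
Qed.

Lemma measurable_truncate v k : measurable_fun setT v -> measurable_fun setT (truncate v k).
Proof.
move=> mv; rewrite (_ : truncate v k = fun x => \1_(ball k) x * v x)%R.
  by apply: measurable_funM => //; exact: measurable_indic.
apply/funext => x; rewrite /truncate patchE indicE.
by case: ifPn => _; rewrite ?mul1r ?mul0r.
Qed.

Lemma truncate_sqr_le v k x : (truncate v k x ^+ 2 <= v x ^+ 2)%R.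
Proof. by rewrite /truncate patchE; case: ifPn => // _; rewrite expr0n sqr_ge0. Qed.

Lemma integral_truncate_le v k : measurable_fun setT v ->
  \int[mu]_x (truncate v k x ^+ 2)%:E <= \int[mu]_x (v x ^+ 2)%:E.
Proof.
move=> mv; have mt := measurable_truncate k mv; apply: ge0_le_integral => //.
- by move=> x _; rewrite lee_fin sqr_ge0.
- by apply: measurable_EFin; exact: measurable_funX.
- by apply: measurable_EFin; exact: measurable_funX.
- by move=> x _; rewrite lee_fin truncate_sqr_le.
Qed.

(** On a ball, which has finite measure, |v| <= 1 + v^2. Hence truncations are both integrable and
    square integrable, as [plancherel] requires. *)
Lemma integrable_truncate v k : isL2 v -> mu.-integrable setT (EFin \o truncate v k).
Proof.
move=> v2; have mv := isL2_measurable v2; have mt := measurable_truncate k mv.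
have i2 : mu.-integrable setT (fun x => (v x ^+ 2)%:E).
  apply/integrableP; split; first by apply: measurable_EFin; exact: measurable_funX.
  rewrite (eq_integral (fun x => (v x ^+ 2)%:E)); first exact: isL2_lty.
  by move=> x _; rewrite gee0_abs// lee_fin sqr_ge0.
have i1 : mu.-integrable setT (fun x => (\1_(ball k) x)%:E).
  apply/integrableP; split; first by apply: measurable_EFin; exact: measurable_indic.
  rewrite (eq_integral (fun x => (\1_(ball k) x)%:E)); first by rewrite integral_indic// setIT; exact: ball_lty.
  by move=> x _; rewrite gee0_abs// lee_fin.
apply: (le_integrable measurableT _ _ (integrableD measurableT i1 i2)).
  exact: measurable_EFin.
move=> x _; rewrite -[leRHS]/(`|(\1_(ball k) x + v x ^+ 2)%:E|) lee_fin.
rewrite [leRHS]ger0_norm ?addr_ge0 ?sqr_ge0// /truncate patchE indicE.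
case: ifPn => _; last by rewrite normr0 add0r sqr_ge0.
rewrite -(real_normK (num_real (v x))); set a := `|v x|%R.
rewrite -subr_ge0 (_ : _ - _ = (a - 2^-1) ^+ 2 + 3 / 4)%R; last by rewrite /=; field.
by rewrite addr_ge0 ?sqr_ge0.
Qed.

Let fourier_dist v g k xi := sqr_modulus (fun xi => (fourier (truncate v k) xi - g xi)%R) xi.

Let fourier_dist_small v g : is_fourierL2 v g -> forall e : R, (0 < e)%R ->
  \forall k \near \oo, \int[mu]_xi (fourier_dist v g k xi)%:E <= e%:E.
Proof.
move=> [_ _ _ /fine_cvgP[fin cvg0]] e e0.
have se0 : (0 < Num.sqrt e)%R by rewrite sqrtr_gt0.
have /cvgrPdist_le/(_ _ se0) cvg0' := cvg0.
near=> k.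
rewrite /fourier_dist -normL2C_sqr.
pose N j := normL2C (fun xi => fourier (truncate v j) xi - g xi)%R.
have Nfin : N k \is a fin_num by near: k.
have Nle : (`|0 - fine (N k)| <= Num.sqrt e)%R by near: k.
have N0 : (0 <= fine (N k))%R by rewrite fine_ge0// /N /normL2C Lnorm_ge0.
rewrite -/(N k) -(fineK Nfin) poweR_EFin lee_fin powR_mulrn// -(sqr_sqrtr (ltW e0)).
rewrite lerXn2r ?nnegrE ?sqrtr_ge0//; move: Nle.
by rewrite sub0r normrN ger0_norm.
Unshelve. all: by end_near. Qed.

Lemma Re_sub (a b : R[i]) : complex.Re (a - b)%R = (complex.Re a - complex.Re b)%R.
Proof. by case: a; case: b. Qed.

Lemma Im_sub (a b : R[i]) : complex.Im (a - b)%R = (complex.Im a - complex.Im b)%R.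
Proof. by case: a; case: b. Qed.

Let msqr g : isL2 (fun xi => complex.Re (g xi)) -> isL2 (fun xi => complex.Im (g xi)) ->
  measurable_fun setT (sqr_modulus g).
Proof.
by move=> /isL2_measurable mR /isL2_measurable mI; apply: measurable_funD; exact: measurable_funX.
Qed.

Let mdist v g k : is_fourierL2 v g -> measurable_fun setT (fourier_dist v g k).
Proof.
move=> [v2 /isL2_measurable gR /isL2_measurable gI _].
have mt := measurable_truncate k (isL2_measurable v2).
rewrite /fourier_dist /sqr_modulus.
under eq_fun do rewrite Re_sub Im_sub /=.
apply: measurable_funD; apply: measurable_funX; apply: measurable_funB => //.
  exact: measurable_cos_transform.
by apply: measurable_funN; exact: measurable_sin_transform.
Qed.

Let C : R := ((2 * pi) ^+ n)%R.

Let C0 : (0 <= C)%R. Proof. by rewrite exprn_ge0// mulr_ge0// pi_ge0. Qed.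

Let integral_le_add2 (A B D : Rn R n -> R) :
  measurable_fun setT A -> measurable_fun setT B -> measurable_fun setT D ->
  (forall x, 0 <= A x)%R -> (forall x, 0 <= B x)%R -> (forall x, 0 <= D x)%R ->
  (forall x, A x <= 2 * B x + 2 * D x)%R ->
  \int[mu]_x (A x)%:E <= 2%:E * \int[mu]_x (B x)%:E + 2%:E * \int[mu]_x (D x)%:E.
Proof.
move=> mA mB mD A0 B0 D0 ABD.
have mBe : measurable_fun setT (fun x => (B x)%:E) by exact: measurable_EFin.
have mDe : measurable_fun setT (fun x => (D x)%:E) by exact: measurable_EFin.
rewrite -!ge0_integralZl//; try by move=> x _; rewrite lee_fin.
rewrite -ge0_integralD//; try (by move=> x _; rewrite mule_ge0// lee_fin);
  try exact: emeasurable_funM.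
apply: ge0_le_integral => //.
- by move=> x _; rewrite lee_fin.
- exact: measurable_EFin.
- by apply: emeasurable_funD; exact: emeasurable_funM.
- by move=> x _; rewrite -!EFinM -EFinD lee_fin.
Qed.

(** One truncation whose transform is close to g is enough: |g|^2 is at most twice the truncated
    spectrum plus twice the squared distance. The lost factor 2 is absorbed by the constants of the
    theorem. *)
Lemma fourierL2_le v g : is_fourierL2 v g ->
  \int[mu]_xi (sqr_modulus g xi)%:E <= (2 * C)%:E * \int[mu]_x (v x ^+ 2)%:E.
Proof.
move=> vg; have [v2 gR gI _] := vg; have mv := isL2_measurable v2.
apply/lee_addgt0Pr => e e0.
have e2 : (0 < e / 2)%R by rewrite divr_gt0.
have [k _ /(_ k (leqnn k))/= Hk] := fourier_dist_small vg e2.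
have tk := integrable_truncate k v2.
have t2 : \int[mu]_x (truncate v k x ^+ 2)%:E < +oo.
  by apply: le_lt_trans (isL2_lty v2); exact: integral_truncate_le.
have P := plancherel tk t2.
have ms := measurable_spectrum tk; have md := mdist k vg.
apply: (@le_trans _ _ (2%:E * \int[mu]_xi (spectrum (truncate v k) xi)%:E +
   2%:E * \int[mu]_xi (fourier_dist v g k xi)%:E)).
  apply: integral_le_add2 => //.
  - exact: msqr.
  - exact: sqr_modulus_ge0.
  - exact: spectrum_ge0.
  - by move=> xi; exact: sqr_modulus_ge0.
  - move=> xi; rewrite -sqr_modulus_fourier /fourier_dist /sqr_modulus.
    rewrite Re_sub Im_sub; set a := complex.Re _; set b := complex.Im _.
    set c := complex.Re _; set d := complex.Im _.
    rewrite -subr_ge0 (_ : _ - _ = (2 * c - a) ^+ 2 + (2 * d - b) ^+ 2)%R; last by ring.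
    by rewrite addr_ge0 ?sqr_ge0.
rewrite P; apply: leeD.
  rewrite -/C muleA -EFinM lee_wpmul2l ?lee_fin ?mulr_ge0//.
  exact: integral_truncate_le.
apply: (le_trans (lee_wpmul2l _ Hk)) => //.
by rewrite -EFinM lee_fin; lra.
Qed.

(** Here the norms of the truncations must also be compared with that of v from below; they increase
    to it by monotone convergence, and the inequality is passed to the limit in k. *)
Lemma fourierL2_ge v g : is_fourierL2 v g ->
  C%:E * \int[mu]_x (v x ^+ 2)%:E <= 2%:E * \int[mu]_xi (sqr_modulus g xi)%:E.
Proof.
move=> vg; have [v2 gR gI _] := vg; have mv := isL2_measurable v2.
have ms := msqr gR gI.
have v2k k : \int[mu]_x (truncate v k x ^+ 2)%:E < +oo.
  by apply: le_lt_trans (isL2_lty v2); exact: integral_truncate_le.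
apply/lee_addgt0Pr => e e0.
have e2 : (0 < e / 2)%R by rewrite divr_gt0.
have dist_small := fourier_dist_small vg e2.
have mt k := measurable_truncate k mv.
have mt2 k : measurable_fun setT (fun x => (truncate v k x ^+ 2)%:E).
  by apply: measurable_EFin; exact: measurable_funX.
have t20 k x : 0 <= (truncate v k x ^+ 2)%:E by rewrite lee_fin sqr_ge0.
have H := cvg_monotone_convergence (mu := mu) measurableT mt2 (fun k x _ => t20 k x).
have limE x : limn (fun k => (truncate v k x ^+ 2)%:E) = (v x ^+ 2)%:E.
  apply/cvg_lim => //; apply: cvg_near_cst; near=> k.
  rewrite /truncate patchE mem_set//=.
  by near: k; exact: nbhs_infty_ger.
rewrite (eq_integral (fun x => limn (fun k => (truncate v k x ^+ 2)%:E))); last by move=> x _; rewrite limE.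
have cvgC : C%:E * \int[mu]_x (truncate v k x ^+ 2)%:E @[k --> \oo] -->
    C%:E * \int[mu]_x limn (fun k => (truncate v k x ^+ 2)%:E).
  apply: cvgeZl => //; apply: H => x _ i j ij; rewrite lee_fin /truncate !patchE.
  case: ifPn => [|_]; last by rewrite expr0n; case: ifPn => _; rewrite ?sqr_ge0// expr0n.
  rewrite inE/= => xi; rewrite mem_set//=.
  by apply: le_trans xi _; rewrite ler_nat.
apply: (cvge_to_le cvgC); near=> k.
rewrite -(plancherel (integrable_truncate k v2) (v2k k)).
have Dk : \int[mu]_xi (fourier_dist v g k xi)%:E <= (e / 2)%:E by near: k.
apply: (@le_trans _ _ (2%:E * \int[mu]_xi (sqr_modulus g xi)%:E +
   2%:E * \int[mu]_xi (fourier_dist v g k xi)%:E)).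
  apply: integral_le_add2.
  - exact: measurable_spectrum (integrable_truncate k v2).
  - exact: ms.
  - exact: mdist.
  - exact: spectrum_ge0.
  - exact: sqr_modulus_ge0.
  - by move=> xi; exact: sqr_modulus_ge0.
  - move=> xi; rewrite -sqr_modulus_fourier /fourier_dist /sqr_modulus.
    rewrite Re_sub Im_sub; set a := complex.Re _; set b := complex.Im _.
    set c := complex.Re _; set d := complex.Im _.
    rewrite -subr_ge0 (_ : _ - _ = (2 * c - a) ^+ 2 + (2 * d - b) ^+ 2)%R; last by ring.
    by rewrite addr_ge0 ?sqr_ge0.
apply: leeD => //; apply: (le_trans (lee_wpmul2l _ Dk)) => //.
by rewrite -EFinM lee_fin; lra.
Unshelve. all: by end_near. Qed.

End fourierL2.

(** * Regularity of the transforms *)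

Section trig_lipschitz.
Context {R : realType}.
Implicit Types (a b t : R) (f : R -> R).

Lemma lipschitz_of_derive f (f' : R -> R) a b k : (forall x : R, is_derive x 1 f (f' x)) ->
  (forall x, Num.min a b <= x <= Num.max a b -> `|f' x| <= k) -> `|f a - f b| <= k * `|a - b|.
Proof.
move=> df fk; wlog ab : a b fk / a <= b => [H|].
  have [ab|/ltW ba] := leP a b; first exact: H.
  by rewrite distrC (distrC a); apply: H => // x; rewrite minC maxC; exact: fk.
move: ab; rewrite le_eqVlt => /predU1P[->|ab]; first by rewrite !subrr normr0 mulr0.
have cf : {within `[a, b], continuous f} by apply: continuous_subspaceT; exact: is_derive_continuous df.
have [c cab H] := MVT ab (fun x _ => df x) cf.
rewrite distrC H normrM (distrC a) ler_wpM2r// fk// (min_idPl (ltW ab)) (max_idPr (ltW ab)).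
by move: cab; rewrite in_itv/= => /andP[/ltW -> /ltW ->].
Qed.

Lemma cos_lipschitz a b : `|cos a - cos b| <= `|a - b|.
Proof.
rewrite -[leRHS]mul1r; apply: (lipschitz_of_derive (f' := fun x => - sin x)) => x _.
by rewrite normrN norm_sin_le1.
Qed.

Lemma sin_lipschitz a b : `|sin a - sin b| <= `|a - b|.
Proof.
rewrite -[leRHS]mul1r; apply: (lipschitz_of_derive (f' := @cos R)) => x _.
exact: norm_cos_le1.
Qed.

Lemma norm_sin_le t : `|sin t| <= `|t|.
Proof. by have := sin_lipschitz t 0; rewrite sin0 !subr0. Qed.

(** Between 0 and t the derivative cos x - 1 is at most |t| in absolute value. This quadratic error
    suffices for difference quotients at 0. *)
Lemma norm_sin_sub_le t : `|sin t - t| <= t ^+ 2.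
Proof.
have df (x : R) : is_derive x 1 (fun x => sin x - x) (cos x - 1 : R) by apply: is_derive_eq.
have := lipschitz_of_derive (a := t) (b := 0) (k := `|t|) df.
rewrite sin0 !subr0 -expr2 real_normK ?num_real//; apply => x xt.
have := cos_lipschitz x 0; rewrite cos0 subr0 => /le_trans; apply.
have [t0|t0] := leP 0 t.
  move: xt; rewrite (min_idPr t0) (max_idPl t0) => /andP[x0 xt].
  by rewrite !ger0_norm.
move: xt; rewrite (min_idPl (ltW t0)) (max_idPr (ltW t0)) => /andP[xt x0].
by rewrite (ltr0_norm t0) ler0_norm// lerN2.
Qed.

End trig_lipschitz.

Section transform_regularity.
Context {R : realType} (n : nat).
Local Notation mu := (lebesgueRn R n).
Implicit Types (f : Rn R n -> R) (xi eta x : Rn R n).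

Definition dist1 xi eta : R := \sum_(i < n) `|tnth xi i - tnth eta i|.

Lemma dist1_ge0 xi eta : 0 <= dist1 xi eta.
Proof. exact: sumr_ge0. Qed.

Lemma dotRn_dist x xi eta : `|dotRn x xi - dotRn x eta| <= normRn x * dist1 xi eta.
Proof.
rewrite /dotRn -sumrB /dist1 mulr_sumr; apply: (le_trans (ler_norm_sum _ _ _)).
by apply: ler_sum => i _; rewrite -mulrBr normrM ler_wpM2r// norm_tnth_le.
Qed.

(** The increment of h is at most |x| times the l^1 distance of the frequencies, and the weight 1 +
    |x| of the L^{1,1} norm pays for the factor |x|. *)
Let transform_lipschitz (h : R -> R) f xi eta : isL11 f -> measurable_fun setT h ->
  (forall t, `|h t| <= 1) -> (forall a b, `|h a - h b| <= `|a - b|) ->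
  `|\int[mu]_x (h (dotRn x xi) * f x) - \int[mu]_x (h (dotRn x eta) * f x)| <=
  normL11 f * dist1 xi eta.
Proof.
move=> f11 mh h1 hlip; have fi := isL11_integrable f11; have fi1 := isL11_integrable1 f11.
have mhd z : measurable_fun setT (fun x => h (dotRn x z)).
  apply: (measurableT_comp mh).
  exact: (measurableT_comp (measurable_dotRn (n := n)) (measurable_pair2 z)).
have ih z : mu.-integrable setT (EFin \o (fun x => h (dotRn x z) * f x)).
  by apply: integrable_bddM.
rewrite -RintegralB//.
have i12 : mu.-integrable setT (EFin \o (fun x => h (dotRn x xi) * f x - h (dotRn x eta) * f x)).
  have := integrableB measurableT (ih xi) (ih eta).
  by apply: eq_integrable => // x _.
apply: (le_trans (le_normr_Rintegral measurableT i12)).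
rewrite normL11E//.
have in1 : mu.-integrable setT (EFin \o (fun x => (1 + normRn x) * `|f x|)).
  have := integrable_abse fi1; apply: eq_integrable => // x _ /=.
  by rewrite normrM ger0_norm// addr_ge0// normRn_ge0.
rewrite -RintegralZr//; apply: le_Rintegral => //.
- exact: (integrable_abse i12).
- by have := integrableZr measurableT (dist1 xi eta) in1; apply: eq_integrable.
- move=> x _; rewrite -mulrBl normrM mulrAC ler_wpM2r//.
  apply: (le_trans (hlip _ _)); apply: (le_trans (dotRn_dist _ _ _)).
  by rewrite ler_wpM2r ?dist1_ge0// lerDr.
Qed.

Lemma cos_transform_lipschitz f xi eta : isL11 f ->
  `|cos_transform f xi - cos_transform f eta| <= normL11 f * dist1 xi eta.
Proof.
move=> f11; apply: transform_lipschitz => //.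
- by apply: continuous_measurable_fun; exact: continuous_cos.
- exact: norm_cos_le1.
- exact: cos_lipschitz.
Qed.

Lemma sin_transform_lipschitz f xi eta : isL11 f ->
  `|sin_transform f xi - sin_transform f eta| <= normL11 f * dist1 xi eta.
Proof.
move=> f11; apply: transform_lipschitz => //.
- by apply: continuous_measurable_fun; exact: continuous_sin.
- exact: norm_sin_le1.
- exact: sin_lipschitz.
Qed.

Definition zeroRn : Rn R n := [tuple 0 | i < n].

Lemma dotRn0 x : dotRn x zeroRn = 0.
Proof. by rewrite /dotRn big1// => i _; rewrite tnth_mktuple mulr0. Qed.

Lemma dist1_0 xi : dist1 xi zeroRn <= n%:R * normRn xi.
Proof.
rewrite /dist1 mulr_natl -[X in _ *+ X]card_ord -sumr_const; apply: ler_sum => i _.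
by rewrite tnth_mktuple subr0 norm_tnth_le.
Qed.

Lemma cos_transform0 f : cos_transform f zeroRn = \int[mu]_x f x.
Proof. by apply: eq_Rintegral => x _; rewrite dotRn0 cos0 mul1r. Qed.

Lemma sin_transform0 f : sin_transform f zeroRn = 0.
Proof.
rewrite /sin_transform /Rintegral (eq_integral (fun=> 0%E)) ?integral0// => x _.
by rewrite dotRn0 sin0 mul0r.
Qed.

Definition scaleRn (s : R) xi : Rn R n := [tuple s * tnth xi i | i < n].

Lemma dotRn_scale x s xi : dotRn x (scaleRn s xi) = s * dotRn x xi.
Proof. by rewrite /dotRn mulr_sumr; apply: eq_bigr => i _; rewrite tnth_mktuple mulrCA. Qed.

Lemma measurable_dotRn_r xi : measurable_fun setT (fun x => dotRn x xi).
Proof. exact: (measurableT_comp (measurable_dotRn (n := n)) (measurable_pair2 xi)). Qed.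

Lemma norm_dotRn_le x xi : `|dotRn x xi| <= normRn x * (n%:R * normRn xi).
Proof.
have := dotRn_dist x xi zeroRn; rewrite dotRn0 subr0 => /le_trans; apply.
by rewrite ler_wpM2l ?normRn_ge0// dist1_0.
Qed.

Lemma integrable_dotM f eta : isL11 f -> mu.-integrable setT (EFin \o (fun x => dotRn x eta * f x)).
Proof.
move=> f11; have fi1 := isL11_integrable1 f11; have fi := isL11_integrable f11.
have mf : measurable_fun setT f by case/integrableP: fi => /measurable_EFinP.
apply: (le_integrable measurableT _ _ (integrableZr measurableT (n%:R * normRn eta) fi1)).
  by apply: measurable_EFin; apply: measurable_funM => //; exact: measurable_dotRn_r.
move=> x _; rewrite -[leRHS]/(`|((1 + normRn x) * f x * (n%:R * normRn eta))%:E|)%E lee_fin.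
rewrite mulrAC normrM [leRHS]normrM ler_wpM2r// normrM.
rewrite [X in X * _]ger0_norm ?addr_ge0 ?normRn_ge0// [X in _ * X]ger0_norm ?mulr_ge0 ?normRn_ge0//.
apply: (le_trans (norm_dotRn_le _ _)); rewrite ler_wpM2r ?mulr_ge0 ?normRn_ge0// lerDr//.
Qed.

(** The conclusion is the derivative at 0 of the sine transform along the ray of eta, computed from
    the difference quotients at s = 1 / (j + 1), all of which vanish. *)
Lemma sin_transform_ray0 f eta : isL11 f ->
  (forall s : R, 0 < s -> sin_transform f (scaleRn s eta) = 0) ->
  \int[mu]_x (dotRn x eta * f x) = 0.
Proof.
move=> f11 S0; have fi := isL11_integrable f11.
have mf : measurable_fun setT f by case/integrableP: fi => /measurable_EFinP.
have md := measurable_dotRn_r eta.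
have msin (s : R) : measurable_fun setT (fun x => sin (s * dotRn x eta)).
  apply: (measurableT_comp (f := @sin R)); first by apply: continuous_measurable_fun; exact: continuous_sin.
  exact: measurable_funM.
(* The difference quotient under the integral; |sin y| <= |y| gives the majorant |x.eta| |f(x)|,
   independent of j. *)
pose G (j : nat) x := j.+1%:R * (sin (j.+1%:R^-1 * dotRn x eta) * f x).
have [] := @dominated_convergence _ _ _ mu _ measurableT
  (fun j x => (G j x)%:E) (fun x => (dotRn x eta * f x)%:E) (fun x => `|(dotRn x eta * f x)%:E|%E).
- by move=> j; apply: measurable_EFin; do 2 apply: measurable_funM => //.
- by apply: measurable_EFin; exact: measurable_funM.
- apply: aeW => x _; apply: cvg_EFin; first exact: nearW.
  rewrite (_ : _ \o _ = fun j => (j.+1%:R * sin (j.+1%:R^-1 * dotRn x eta)) * f x); last first.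
    by apply/funext => j; rewrite /G/= mulrA.
  apply: cvgM; last exact: cvg_cst.
  set d := dotRn x eta.
  apply/cvgrPdist_le => e e0.
  have : (fun j => d ^+ 2 * j.+1%:R^-1) x0 @[x0 --> \oo] --> (0 : R).
    by rewrite -[X in _ --> X](mulr0 (d ^+ 2)); apply: cvgM; [exact: cvg_cst|exact: cvg_harmonic].
  move=> /cvgrPdist_le/(_ _ e0); apply: filterS => j; rewrite sub0r normrN => /(le_trans _); apply.
  have j0 : (0 : R) < j.+1%:R by rewrite ltr0n.
  rewrite [leRHS]ger0_norm; last by rewrite mulr_ge0// sqr_ge0.
  have := norm_sin_sub_le (j.+1%:R^-1 * d); rewrite distrC => H.
  rewrite (_ : d - _ = j.+1%:R * (j.+1%:R^-1 * d - sin (j.+1%:R^-1 * d))); last first.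
    by rewrite mulrBr mulrA divff ?mul1r// gt_eqF.
  rewrite normrM gtr0_norm// (le_trans (ler_wpM2l (ltW j0) H))//.
  have gen (J : R) : 0 < J -> J * (J^-1 * d) ^+ 2 = d ^+ 2 * J^-1.
    by move=> J0; field; rewrite gt_eqF.
  by rewrite gen.
- exact: integrable_abse (integrable_dotM eta f11).
- apply: aeW => x j _; rewrite !abse_EFin lee_fin /G mulrA normrM [leRHS]normrM ler_wpM2r//.
  rewrite normrM ger0_norm// (le_trans (ler_wpM2l _ (norm_sin_le _)))//.
  by rewrite normrM ger0_norm// mulrA divff ?mul1r// pnatr_eq0.
move=> _ _ H.
have G0 j : (\int[mu]_x (G j x)%:E = 0)%E.
  have iS : mu.-integrable setT (EFin \o (fun x => sin (j.+1%:R^-1 * dotRn x eta) * f x)).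
    by apply: integrable_bddM => // x; exact: norm_sin_le1.
  rewrite /G; under eq_integral do rewrite EFinM; rewrite integralZl//.
  have := S0 _ (inv_succ_gt0 j); rewrite /sin_transform.
  under eq_Rintegral do rewrite dotRn_scale.
  rewrite /Rintegral => H0; rewrite -(fineK (integrable_fin_num measurableT iS)) /=.
  by rewrite H0 mule0.
move: H; rewrite [X in X @ _ --> _](_ : _ = cst 0%E); last by apply/funext.
move=> H; rewrite /Rintegral; have <- := cvg_lim (@ereal_hausdorff R) H.
by rewrite lim_cst.
Qed.

End transform_regularity.

(** * Oscillatory averages over cubes *)

Section trigonometric_mean.
Context {R : realType}.
Implicit Types (f : R -> R) (k a b c d : R).

(** An antiderivative stays within bounded distance of the line k s. This form of the mean value is
    stable under linear combinations and gives averages over long intervals with an explicit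
    error. *)
Definition has_mean f k := exists G (K : R),
  (forall s : R, is_derive s 1 G (f s)) /\ (forall s, `|G s - k * s| <= K).

Lemma has_mean_cst k : has_mean (fun=> k) k.
Proof.
exists (fun s => k * s), 0; split => s; last by rewrite subrr normr0.
by apply: is_derive_eq; rewrite /GRing.scale/= mulr1.
Qed.

Lemma has_mean_add f g k l : has_mean f k -> has_mean g l ->
  has_mean (fun s => f s + g s) (k + l).
Proof.
move=> [F [K [dF FK]]] [G [L [dG GL]]]; exists (fun s => F s + G s), (K + L); split => s.
  by apply: is_deriveD.
rewrite mulrDl opprD addrACA; apply: (le_trans (ler_normD _ _)).
exact: lerD.
Qed.

Lemma has_mean_scale f k c : has_mean f k -> has_mean (fun s => c * f s) (c * k).
Proof.
move=> [F [K [dF FK]]]; exists (fun s => c * F s), (`|c| * K); split => s.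
  exact: is_deriveZ.
by rewrite -mulrA -mulrBr normrM ler_wpM2l.
Qed.

Lemma has_mean_cos c g : g != 0 -> has_mean (fun s => c * cos (g * s)) 0.
Proof.
move=> g0; rewrite -(mulr0 c); apply: has_mean_scale.
exists (fun s => g^-1 * sin (g * s)), `|g^-1|; split => s.
  by apply: is_derive_eq; rewrite /GRing.scale/= mulr1 mulrCA mulVf// mulr1.
by rewrite mul0r subr0 normrM ler_piMr// norm_sin_le1.
Qed.

Lemma has_mean_sin c g : g != 0 -> has_mean (fun s => c * sin (g * s)) 0.
Proof.
move=> g0; rewrite -(mulr0 c); apply: has_mean_scale.
exists (fun s => - (g^-1 * cos (g * s))), `|g^-1|; split => s.
  by apply: is_derive_eq; rewrite /GRing.scale/= mulr1 mulNr mulrN opprK mulrCA mulVf// mulr1.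
by rewrite mul0r subr0 normrN normrM ler_piMr// norm_cos_le1.
Qed.

Definition trig al be a b c d s : R :=
  a * cos (al * s) + b * sin (al * s) + (c * cos (be * s) + d * sin (be * s)).

(** The mean value of the square of [trig] for distinct positive frequencies: every amplitude
    contributes half its square. *)
Definition energy a b c d : R := (a ^+ 2 + b ^+ 2 + (c ^+ 2 + d ^+ 2)) / 2.

(** The square expands into the constant [energy] and oscillations of frequencies 2 al, 2 be, al +
    be and al - be. None of these is 0, the last because the speeds differ, so every oscillation has
    mean 0. *)
Lemma has_mean_trig_sqr al be a b c d : 0 < al -> 0 < be -> al != be ->
  has_mean (fun s => trig al be a b c d s ^+ 2) (energy a b c d).
Proof.
move=> al0 be0 albe.
have n1 : 2 * al != 0 by rewrite mulf_neq0 ?gt_eqF.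
have n2 : 2 * be != 0 by rewrite mulf_neq0 ?gt_eqF.
have n3 : al - be != 0 by rewrite subr_eq0.
have n4 : al + be != 0 by rewrite gt_eqF// addr_gt0.
have H := has_mean_add (has_mean_add (has_mean_add
    (has_mean_add (has_mean_cst (energy a b c d)) (has_mean_cos ((a ^+ 2 - b ^+ 2) / 2) n1))
    (has_mean_add (has_mean_sin (a * b) n1) (has_mean_cos ((c ^+ 2 - d ^+ 2) / 2) n2)))
    (has_mean_add (has_mean_sin (c * d) n2) (has_mean_cos (a * c + b * d) n3)))
    (has_mean_add (has_mean_cos (a * c - b * d) n4)
       (has_mean_add (has_mean_sin (a * d + b * c) n4) (has_mean_sin (b * c - a * d) n3))).
rewrite !addr0 in H; move: H; congr (has_mean _ _); apply/funext => s.
have h1 := cos2Dsin2 (al * s); have h2 := cos2Dsin2 (be * s).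
have E1 : cos (2 * al * s) = cos (al * s) ^+ 2 - sin (al * s) ^+ 2.
  by rewrite (_ : 2 * al * s = al * s + al * s) ?cosD; ring.
have E2 : sin (2 * al * s) = 2 * (sin (al * s) * cos (al * s)).
  by rewrite (_ : 2 * al * s = al * s + al * s) ?sinD; ring.
have E3 : cos (2 * be * s) = cos (be * s) ^+ 2 - sin (be * s) ^+ 2.
  by rewrite (_ : 2 * be * s = be * s + be * s) ?cosD; ring.
have E4 : sin (2 * be * s) = 2 * (sin (be * s) * cos (be * s)).
  by rewrite (_ : 2 * be * s = be * s + be * s) ?sinD; ring.
rewrite E1 E2 E3 E4 !mulrBl !mulrDl cosB sinB cosD sinD /trig.
move: h1 h2; set p := cos (be * s); set q := sin (be * s); set u := cos (al * s); set v := sin (al * s).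
move=> h1 h2.
(* Multiplying the constants by cos^2 + sin^2 = 1 turns the claim into a polynomial identity in the
   four trigonometric values. *)
have -> : energy a b c d = (a ^+ 2 + b ^+ 2) / 2 * (u ^+ 2 + v ^+ 2) + (c ^+ 2 + d ^+ 2) / 2 * (p ^+ 2 + q ^+ 2).
  by rewrite h1 h2 /energy !mulr1 mulrDl.
by field.
Qed.

End trigonometric_mean.

Section weighted_line_integral.
Context {R : realType}.
Local Notation leb := (@lebesgue_measure R).
Implicit Types (p q t w : R).

Lemma integral_itv_FTC_in (F f : R -> R) p q : p < q ->
  (forall x : R, p <= x <= q -> {for x, continuous f}) ->
  (forall x : R, p <= x <= q -> is_derive x 1 F (f x)) ->
  (\int[leb]_(x in `[p, q]) (f x)%:E = (F q - F p)%:E)%E.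
Proof.
move=> pq cf dF.
have cF (x : R) : p <= x <= q -> {for x, continuous F}.
  move=> xpq; have dFx := dF x xpq.
  by apply/differentiable_continuous/derivable1_diffP; apply: ex_derive.
rewrite (continuous_FTC2 pq (F := F)) ?EFinB//.
- apply: continuous_in_subspaceT => x; rewrite inE/= in_itv/=; exact: cf.
- split.
  + move=> x; rewrite in_itv/= => /andP[px xq].
    have dFx : is_derive x 1 F (f x) by apply: dF; rewrite !ltW.
    by apply: ex_derive.
  + by apply: cvg_at_right_filter; apply: cF; rewrite lexx ltW.
  + by apply: cvg_at_left_filter; apply: cF; rewrite lexx ltW.
- move=> x; rewrite in_itv/= => /andP[px xq]; rewrite derive1E.
  have dFx : is_derive x 1 F (f x) by apply: dF; rewrite !ltW.
  by apply: derive_val.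
Qed.

(* Multiplying the integrand by [x / radius x <= 1], the derivative of the
   radius, makes it an exact derivative. *)
Lemma integral_radial_ge (f G : R -> R) (k K w p q t : R) :
  (forall s : R, is_derive s 1 G (f s)) -> (forall s, `|G s - k * s| <= K) ->
  (forall s, 0 <= f s) -> continuous f -> 0 <= w -> 0 < p -> p < q -> 0 < t ->
  ((k * (Num.sqrt (q ^+ 2 + w) - Num.sqrt (p ^+ 2 + w)) - 2 * K / t)%:E <=
   \int[leb]_(x in `[p, q]) (f (t * Num.sqrt (x ^+ 2 + w)))%:E)%E.
Proof.
move=> dG GK f0 cf w0 p0 pq t0.
pose rho x := Num.sqrt (x ^+ 2 + w).
have den x : 0 < x -> 0 < x ^+ 2 + w by move=> x0; rewrite ltr_wpDr// exprn_gt0.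
have rho0 x : 0 < x -> 0 < rho x by move=> x0; rewrite sqrtr_gt0 den.
have drho (x : R) : 0 < x -> is_derive x 1 rho (x / rho x).
  move=> x0; have ds : is_derive (x ^+ 2 + w) 1 (@Num.sqrt R) (2 * rho x)^-1.
    exact: is_derive1_sqrt (den x x0).
  apply: is_derive_eq; rewrite /GRing.scale/= mulr1 addr0.
  by have r0 := rho0 x x0; field; rewrite gt_eqF.
have crho : continuous rho.
  move=> x; apply: continuous_comp; last exact: sqrt_continuous.
  by apply: cvgD; [exact: exprn_continuous|exact: cvg_cst].
have cfr : continuous (fun x => f (t * rho x)).
  move=> x; apply: continuous_comp; last exact: cf.
  by apply: cvgM; [exact: cvg_cst|exact: crho].
(* Its increment from p to q is k (rho q - rho p) up to an error 2 K / t, by the hypothesis on G at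
   both ends. *)
pose F x := t^-1 * G (t * rho x).
have dF (x : R) : p <= x <= q -> is_derive x 1 F (f (t * rho x) * (x / rho x)).
  move=> /andP[px _]; have x0 := lt_le_trans p0 px.
  have dr := drho x x0.
  have dGx : is_derive (t * rho x) 1 G (f (t * rho x)) by exact: dG.
  have dtr : is_derive x 1 (fun x => t * rho x) (t * (x / rho x)) by exact: is_deriveZ.
  have dGr : is_derive x 1 (G \o (fun x => t * rho x)) (f (t * rho x) * (t * (x / rho x))).
    exact: is_derive1_comp.
  have dFx : is_derive x 1 F (t^-1 *: (f (t * rho x) * (t * (x / rho x)))) by exact: is_deriveZ.
  apply: is_derive_eq; rewrite /GRing.scale/=.
  by have r0 := rho0 x x0; field; rewrite !gt_eqF.
have xrho x : p <= x <= q -> 0 <= x / rho x <= 1.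
  move=> /andP[px _]; have x0 := lt_le_trans p0 px; have r0 := rho0 x x0.
  rewrite divr_ge0 ?(ltW x0) ?(ltW r0)//= ler_pdivrMr// mul1r.
  by rewrite -[leLHS]ger0_norm ?(ltW x0)// -sqrtr_sqr ler_sqrt ?lerDl// ltW// den.
have cw (x : R) : p <= x <= q -> {for x, continuous (fun x => f (t * rho x) * (x / rho x))}.
  move=> /andP[px _]; have x0 := lt_le_trans p0 px; have r0 := rho0 x x0.
  apply: cvgM; first exact: cfr.
  by apply: cvgM; [exact: cvg_id|apply: cvgV; [rewrite gt_eqF|exact: crho]].
apply: (@le_trans _ _ (\int[leb]_(x in `[p, q]) (f (t * rho x) * (x / rho x))%:E)%E).
  rewrite (integral_itv_FTC_in pq cw dF) lee_fin /F -mulrBr -/(rho q) -/(rho p).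
  rewrite -(ler_pM2l t0) mulrA mulfV ?gt_eqF// mul1r.
  rewrite mulrBr (mulrCA t (2 * K)) mulfV ?gt_eqF// mulr1.
  have := GK (t * rho q); have := GK (t * rho p); rewrite !ler_norml => /andP[a1 a2] /andP[b1 b2].
  have E (y : R) : k * (t * y) = t * (k * y) by rewrite mulrCA.
  rewrite !E in a1 a2 b1 b2; rewrite !mulrBr; lra.
apply: ge0_le_integral => //.
- move=> x; rewrite /= in_itv/= => /xrho /andP[h _]; rewrite lee_fin mulr_ge0//.
- apply: measurable_EFin; apply: (subspace_continuous_measurable_fun (measurable_itv _)).
  by apply: continuous_in_subspaceT => x; rewrite inE/= in_itv/=; exact: cw.
- by apply: measurable_EFin; apply: measurable_funTS; exact: continuous_measurable_fun.
- by move=> x; rewrite /= in_itv/= => /xrho /andP[_ h]; rewrite lee_fin ler_piMr.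
Qed.

End weighted_line_integral.

Section cube_lower_bound.
Context {R : realType} (n : nat).
Local Notation leb := (@lebesgue_measure R).
Local Notation mu n := (lebesgueRn R n).
Variables (al be a b c d : R) (eta : 'I_n.+1 -> R).
Hypotheses (al0 : 0 < al) (be0 : 0 < be) (albe : al != be).
Hypotheses (abcd : 0 < energy a b c d) (eta0 : 0 < eta ord0).

Let f s := trig al be a b c d s ^+ 2.

Let f0 s : 0 <= f s. Proof. exact: sqr_ge0. Qed.

Let cf : continuous f.
Proof.
apply: derivable_continuous => s; rewrite /f /trig.
by apply: ex_derive.
Qed.

Lemma normRn_cons m (x : R) (y : Rn R m) :
  normRn (Rn_cons (x, y)) = Num.sqrt (x ^+ 2 + dotRn y y).
Proof.
rewrite /normRn; congr Num.sqrt; rewrite /dotRn big_ord_recl/= -expr2; congr (_ + _).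
by apply: eq_bigr => i _; rewrite /Rn_cons !tnthS.
Qed.

Lemma normRn_le_sum m (x : Rn R m) : normRn x <= \sum_(i < m) `|tnth x i : R|.
Proof.
have s0 : 0 <= \sum_(i < m) `|tnth x i : R| by exact: sumr_ge0.
rewrite /normRn -[leRHS]ger0_norm// -sqrtr_sqr ler_sqrt ?sqr_ge0//.
rewrite expr2 mulr_suml; apply: ler_sum => i _.
rewrite -expr2 -(real_normK (num_real (tnth x i : R))) expr2 ler_wpM2l//.
by rewrite (bigD1 i)//= lerDl; exact: sumr_ge0.
Qed.

(** Times sg, a bound for |xi| on the scaled cubes, through the l^1 norm and eps <= eta_0 / 2. *)
Let L : R := \sum_(i < n.+1) `|eta i| + n.+1%:R * eta ord0.

Let L0 : 0 < L.
Proof. by rewrite /L ltr_wpDl ?sumr_ge0// mulr_gt0// ltr0n. Qed.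

Let mf : measurable_fun setT f. Proof. exact: continuous_measurable_fun. Qed.

Local Notation scaled sg := (fun i => sg * eta i).

(** On each line of the cube parallel to the first axis, the radius grows by at least a multiple of
    sg eps, and the square has its positive mean up to an error of order 1 / t. The estimate is
    invariant under dilation: the threshold involves only the product t sg. *)
Lemma cube_trig_lower : exists2 th, 0 < th & forall eps, 0 < eps <= eta ord0 / 2 ->
  exists T0 : R, forall sg t : R, 0 < sg -> 0 < t -> T0 <= t * sg ->
  (((2 * (sg * eps)) ^+ n.+1 * th)%:E <=
   \int[mu n.+1]_xi (\1_(cube (scaled sg) (sg * eps)) xi * f (t * normRn xi))%:E)%E.
Proof.
have [G [K [dG GK]]] := has_mean_trig_sqr a b c d al0 be0 albe.
have := abcd; set k := energy a b c d in GK * => k0.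
have th0 : 0 < k * eta ord0 / (4 * L) by rewrite divr_gt0// mulr_gt0.
exists (k * eta ord0 / (4 * L)) => // eps /andP[eps0 epsle].
(* From this threshold on, the error 2 K / t is at most half of the main term k sg eps eta_0 / L. *)
exists (4 * K * L / (k * eps * eta ord0)) => sg t sg0 t0 tsg.
set C := cube _ _; pose C' := cube (scaled sg \o lift ord0) (sg * eps).
have mC : measurable C by exact: measurable_cube.
have mC' : measurable C' by exact: measurable_cube.
set p := sg * (eta ord0 - eps); set q := sg * (eta ord0 + eps).
have p0 : 0 < p by rewrite mulr_gt0// subr_gt0; lra.
have pq : p < q by rewrite ltr_pM2l//; lra.
pose B := 2 * (sg * eps) * (k * eta ord0 / (4 * L)).
have se0 : 0 < sg * eps by rewrite mulr_gt0.
have B0 : 0 <= B by rewrite /B mulr_ge0 ?(ltW th0)// mulr_ge0// ltW.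
pose H xi : \bar R := (\1_C xi * f (t * normRn xi))%:E.
have mH : measurable_fun setT H.
  apply: measurable_EFin; apply: measurable_funM; first exact: measurable_indic.
  by apply: (measurableT_comp mf); apply: measurable_funM => //; exact: measurable_normRn.
have H0 xi : (0 <= H xi)%E by rewrite lee_fin mulr_ge0.
rewrite (ge0_integral_cons_sym mH H0).
have -> : (((2 * (sg * eps)) ^+ n.+1 * (k * eta ord0 / (4 * L)))%:E =
  \int[mu n]_x (B%:E * (\1_C' x)%:E))%E.
  rewrite ge0_integralZl//; [|by apply: measurable_EFin; exact: measurable_indic].
  rewrite integral_indic_cube; last exact: ltW.
  by rewrite -EFinM exprS; congr (_%:E); rewrite /B; ring.
have indE x y : \1_C (Rn_cons (x, y)) = \1_(`[p, q]%classic : set R) x * \1_C' y :> R.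
  rewrite !indicE -natrM mulnb; congr ((nat_of_bool _)%:R).
  have itvE : (p <= x <= q) = (`|x - sg * eta ord0| <= sg * eps).
    by rewrite ler_distl /p /q mulrBr mulrDr.
  apply/idP/andP; rewrite !inE/= in_itv/= itvE.
    by move/mem_cube_cons.
  by move=> h; exact/mem_cube_cons.
apply: ge0_le_integral => //.
- by move=> y _; rewrite mule_ge0// lee_fin.
- by apply: emeasurable_funM => //; apply: measurable_EFin; exact: measurable_indic.
- apply: (measurable_fun_fubini_tonelli_G (m1 := leb) (H \o @Rn_cons R n)).
    by apply: measurableT_comp => //; exact: measurable_Rn_cons.
  by move=> x; exact: H0.
move=> y _.
under [leRHS]eq_integral => x _ do rewrite /H normRn_cons indE.
have [yC|yC] := boolP (y \in C'); last first.
  have -> : \1_C' y = 0 :> R by rewrite indicE (negbTE yC).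
  by rewrite mule0; apply: integral_ge0 => x _; rewrite lee_fin mulr0 mul0r.
have -> : \1_C' y = 1 :> R by rewrite indicE yC.
rewrite mule1.
have -> : (\int[leb]_x (\1_(`[p, q]%classic : set R) x * 1 * f (t * Num.sqrt (x ^+ 2 + dotRn y y)))%:E =
  \int[leb]_(x in `[p, q]) (f (t * Num.sqrt (x ^+ 2 + dotRn y y)))%:E)%E.
  rewrite [RHS]integral_mkcond; apply: eq_integral => x _; rewrite patchE indicE mulr1.
  by case: ifPn => _; rewrite ?mul1r ?mul0r.
have w0 : 0 <= dotRn y y by apply: sumr_ge0 => i _; rewrite -expr2 sqr_ge0.
apply: le_trans (integral_radial_ge dG GK f0 cf w0 p0 pq t0).
rewrite lee_fin.
set rq := Num.sqrt (q ^+ 2 + _); set rp := Num.sqrt (p ^+ 2 + _).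
have yle : normRn y <= sg * (\sum_(i < n) `|eta (lift ord0 i)| + n%:R * eta ord0).
  apply: (le_trans (normRn_le_sum y)).
  have -> : n%:R * eta ord0 = \sum_(i < n) eta ord0.
    by rewrite sumr_const card_ord mulr_natl.
  rewrite -big_split mulr_sumr/=; apply: ler_sum => i _; rewrite mulrDr.
  have := set_mem yC i; rewrite /= => /(le_trans (ler_dist_dist _ _)).
  rewrite normrM gtr0_norm// => /(le_trans (ler_norm _)); rewrite lerBlDl => /le_trans; apply.
  by rewrite lerD2l ler_pM2l//; lra.
have rqL : rq <= sg * L.
  have q0 : 0 <= q by rewrite ltW// (lt_trans p0).
  apply: (@le_trans _ _ (q + normRn y)).
    have y0 := normRn_ge0 y.
    have -> : q + normRn y = Num.sqrt ((q + normRn y) ^+ 2) by rewrite sqrtr_sqr ger0_norm// addr_ge0.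
    rewrite /rq ler_sqrt ?sqr_ge0// sqrrD /normRn sqr_sqrtr// -addrA lerD2l lerDr.
    by rewrite mulrn_wge0// mulr_ge0// sqrtr_ge0.
  have -> : L = eta ord0 + eta ord0 + (\sum_(i < n) `|eta (lift ord0 i)| + n%:R * eta ord0).
    by rewrite /L big_ord_recl (gtr0_norm eta0) -natr1; ring.
  rewrite mulrDr lerD// /q ler_pM2l// lerD2l; lra.
have rq2 : rq ^+ 2 = q ^+ 2 + dotRn y y by rewrite sqr_sqrtr// addr_ge0// sqr_ge0.
have rp2 : rp ^+ 2 = p ^+ 2 + dotRn y y by rewrite sqr_sqrtr// addr_ge0// sqr_ge0.
have rp0 : 0 < rp by rewrite sqrtr_gt0 ltr_wpDr// exprn_gt0.
have rpq : rp <= rq by rewrite ler_sqrt ?lerD2r ?addr_ge0 ?sqr_ge0// lerXn2r ?nnegrE ?ltW// (lt_trans p0).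
have rq0 : 0 < rq by exact: lt_le_trans rpq.
(* The squared radii differ by q^2 - p^2 = 4 sg^2 eps eta_0, and the sum of the radii is at most 2
   sg L. *)
have gap : sg * eps * eta ord0 / L <= rq - rp.
  have E : (rq - rp) * (rq + rp) = 4 * (sg * eps) * (sg * eta ord0).
    by rewrite -subr_sqr rq2 rp2 /p /q; ring.
  rewrite ler_pdivrMr//.
  have Hg : (rq - rp) * (rq + rp) <= (rq - rp) * (2 * (sg * L)).
    by rewrite ler_wpM2l ?subr_ge0//; lra.
  rewrite -(ler_pM2l sg0); nra.
have Kt : 2 * K / t <= k * (sg * eps * eta ord0 / L) / 2.
  have kp : 0 < k * eps * eta ord0 by rewrite mulr_gt0// mulr_gt0.
  move: tsg; rewrite ler_pdivrMr// => tsg.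
  rewrite ler_pdivrMr// (_ : _ / 2 * t = t * sg * (k * eps * eta ord0) / (2 * L)); last first.
    by field; rewrite gt_eqF.
  rewrite ler_pdivlMr ?mulr_gt0//; apply: le_trans tsg; lra.
have -> : B = k * (sg * eps * eta ord0 / L) / 2.
  by rewrite /B; field; rewrite gt_eqF.
have := ler_wpM2l (ltW k0) gap; lra.
Qed.

(** The tolerance [dl] and the density [th] are fixed before eps, because eps is shrunk afterwards
    until the coefficients are constant up to [dl] on the cube. *)
Lemma cube_perturbed_lower : exists2 dl, 0 < dl & exists2 th, 0 < th &
  forall eps, 0 < eps <= eta ord0 / 2 -> exists T0 : R, forall (sg t : R) (h : Rn R n.+1 -> R),
  0 < sg -> 0 < t -> T0 <= t * sg -> measurable_fun setT h ->
  (forall xi, cube (scaled sg) (sg * eps) xi -> `|sg * h xi - trig al be a b c d (t * normRn xi)| <= dl) ->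
  (((2 * (sg * eps)) ^+ n.+1 * th / sg ^+ 2)%:E <=
   \int[mu n.+1]_xi (\1_(cube (scaled sg) (sg * eps)) xi * h xi ^+ 2)%:E)%E.
Proof.
have [th th0 H] := cube_trig_lower.
(* With this tolerance u^2 <= 2 (sg h)^2 + th / 2, so the perturbation costs half of the lower bound
   [th]; the division by 2 leaves th / 4. *)
exists (Num.sqrt (th / 4)); first by rewrite sqrtr_gt0 divr_gt0.
exists (th / 4) => [|eps epsP]; first by rewrite divr_gt0.
have [T0 HT] := H eps epsP; exists T0 => sg t h sg0 t0 tsg mh hd.
have {HT} := HT sg t sg0 t0 tsg.
have se0 : 0 <= sg * eps by case/andP: epsP => eps0 _; rewrite mulr_ge0// ltW.
set C := cube _ _ in hd *; set V := (2 * (sg * eps)) ^+ n.+1.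
have mC : measurable C by exact: measurable_cube.
have mI : measurable_fun setT (fun xi => (\1_C xi * h xi ^+ 2)%:E).
  by apply: measurable_EFin; apply: measurable_funM; [exact: measurable_indic|exact: measurable_funX].
have mC1 : measurable_fun setT (fun xi => (\1_C xi : R)%:E) by apply: measurable_EFin; exact: measurable_indic.
have I0 xi : (0 <= (\1_C xi * h xi ^+ 2)%:E)%E by rewrite lee_fin mulr_ge0 ?sqr_ge0.
move=> /le_trans HV.
have {HV} : ((V * th)%:E <= (2 * sg ^+ 2)%:E * \int[mu n.+1]_xi (\1_C xi * h xi ^+ 2)%:E + (th / 2 * V)%:E)%E.
  apply: HV.
  have -> : ((th / 2 * V)%:E = (th / 2)%:E * \int[mu n.+1]_xi (\1_C xi)%:E)%E.
    by rewrite integral_indic_cube.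
  rewrite -!ge0_integralZl//; [|by rewrite lee_fin divr_ge0// ltW|by rewrite lee_fin mulr_ge0// sqr_ge0].
  rewrite -ge0_integralD//; last 4 first.
  - by move=> xi _; rewrite mule_ge0// lee_fin mulr_ge0// sqr_ge0.
  - exact: emeasurable_funM.
  - by move=> xi _; rewrite mule_ge0// lee_fin// divr_ge0// ltW.
  - exact: emeasurable_funM.
  apply: ge0_le_integral => //.
  - by move=> xi _; rewrite lee_fin mulr_ge0.
  - apply: measurable_EFin; apply: measurable_funM; first exact: measurable_indic.
    by apply: (measurableT_comp mf); apply: measurable_funM => //; exact: measurable_normRn.
  - by apply: emeasurable_funD; exact: emeasurable_funM.
  - move=> xi _; rewrite -!EFinM -EFinD lee_fin indicE.
    have [/set_mem/hd xiC|_] := boolP (xi \in C); last by rewrite !mul0r !mulr0 addr0.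
    rewrite !mul1r mulr1 /f; set u := trig _ _ _ _ _ _ _ in xiC *; set v := h xi in xiC *.
    have vu : (sg * v - u) ^+ 2 <= th / 4.
      have -> : th / 4 = Num.sqrt (th / 4) ^+ 2 by rewrite sqr_sqrtr// divr_ge0// ltW.
      by rewrite -[leLHS]real_normK ?num_real// lerXn2r ?nnegrE ?sqrtr_ge0.
    have := sqr_ge0 (2 * (sg * v) - u); rewrite !expr2 in vu *; lra.
move=> HV; rewrite -/V.
have s20 : 0 < 2 * sg ^+ 2 by rewrite mulr_gt0// exprn_gt0.
rewrite -(@lee_pmul2l _ (2 * sg ^+ 2)%:E)// -EFinM.
set I := (\int[_]_xi _)%E in HV *; have I00 : (0 <= I)%E by exact: integral_ge0.
case: I I00 HV => [i| |]//; last by rewrite mulry gtr0_sg// mul1e leey.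
rewrite -!EFinM -!EFinD !lee_fin => i0 HV.
rewrite (_ : 2 * sg ^+ 2 * _ = V * th / 2); last by field; rewrite gt_eqF.
lra.
Qed.

End cube_lower_bound.

(** * The solution in Fourier space *)

Section fourier_wave.
Context {R : realType} (n : nat).
Implicit Types (a b : 'I_n -> R) (xi : Rn R n) (N : 'I_n).

(** The N-th coordinate of P a, the projection of a onto the direction of xi. *)
Definition longitudinal a xi N : R :=
  \sum_(l < n) (tnth xi N / normRn xi) * (tnth xi l / normRn xi) * a l.

(** The N-th coordinate of the solution formula for real vectors a, b in place of the transformed
    data. As the multipliers are real, the real and imaginary parts of [uhat] both have this
    form. *)
Definition wave (al be t : R) a b xi N : R :=
  let r := normRn xi in
  cos (t * al * r) * longitudinal a xi N +
  sin (t * al * r) / (al * r) * longitudinal b xi N +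
  cos (t * be * r) * (a N - longitudinal a xi N) +
  sin (t * be * r) / (be * r) * (b N - longitudinal b xi N).

Lemma complex_ReZ (x : R) (z : R[i]) : complex.Re ((x%:C)%C * z) = x * complex.Re z.
Proof. by case: z => p q /=; rewrite mul0r subr0. Qed.

Lemma complex_ImZ (x : R) (z : R[i]) : complex.Im ((x%:C)%C * z) = x * complex.Im z.
Proof. by case: z => p q /=; rewrite mul0r addr0. Qed.

Lemma complex_ReD (z w : R[i]) : complex.Re (z + w) = complex.Re z + complex.Re w.
Proof. by case: z; case: w. Qed.

Lemma complex_ImD (z w : R[i]) : complex.Im (z + w) = complex.Im z + complex.Im w.
Proof. by case: z; case: w. Qed.

Lemma projmx_mulE xi (F : 'cV[R[i]]_n) N :
  complex.Re ((projmx xi *m F) N 0) = longitudinal (fun k => complex.Re (F k 0)) xi N /\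
  complex.Im ((projmx xi *m F) N 0) = longitudinal (fun k => complex.Im (F k 0)) xi N.
Proof.
rewrite mxE (big_morph _ complex_ReD (erefl _)) (big_morph _ complex_ImD (erefl _)).
by split; apply: eq_bigr => l _; rewrite mxE ?complex_ReZ ?complex_ImZ.
Qed.

Variables (lambda mu t : R) (f0 f1 : 'I_n -> Rn R n -> R) (xi : Rn R n) (N : 'I_n).
Let al := Num.sqrt (lambda + 2 * mu).
Let be := Num.sqrt mu.

Lemma Re_uhat : complex.Re (uhat lambda mu f0 f1 t xi N 0) =
  wave al be t (fun k => cos_transform (f0 k) xi) (fun k => cos_transform (f1 k) xi) xi N.
Proof.
have [P0 _] := projmx_mulE xi (fourierv f0 xi) N.
have [P1 _] := projmx_mulE xi (fourierv f1 xi) N.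
have E f : longitudinal (fun k => complex.Re (fourierv f xi k 0)) xi N =
    longitudinal (fun k => cos_transform (f k) xi) xi N.
  by apply: eq_bigr => l _; rewrite mxE.
rewrite /uhat !mulmxBl !mul1mx.
move: (projmx xi *m fourierv f0 xi) (projmx xi *m fourierv f1 xi) P0 P1 => A B P0 P1.
rewrite /wave -!E -P0 -P1.
by rewrite !mxE !complex_ReD !complex_ReZ !Re_sub.
Qed.

Lemma Im_uhat : complex.Im (uhat lambda mu f0 f1 t xi N 0) =
  wave al be t (fun k => - sin_transform (f0 k) xi) (fun k => - sin_transform (f1 k) xi) xi N.
Proof.
have [_ P0] := projmx_mulE xi (fourierv f0 xi) N.
have [_ P1] := projmx_mulE xi (fourierv f1 xi) N.
have E f : longitudinal (fun k => complex.Im (fourierv f xi k 0)) xi N =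
    longitudinal (fun k => - sin_transform (f k) xi) xi N.
  by apply: eq_bigr => l _; rewrite mxE.
rewrite /uhat !mulmxBl !mul1mx.
move: (projmx xi *m fourierv f0 xi) (projmx xi *m fourierv f1 xi) P0 P1 => A B P0 P1.
rewrite /wave -!E -P0 -P1.
by rewrite !mxE !complex_ImD !complex_ImZ !Im_sub.
Qed.

End fourier_wave.

(** * Upper bound *)

Section wave_upper_bound.
Context {R : realType} (n : nat).
Implicit Types (a b : 'I_n -> R) (xi : Rn R n) (N : 'I_n).

Lemma norm_direction_le xi l : `|tnth xi l / normRn xi| <= 1.
Proof.
have [->|r0] := eqVneq (normRn xi) 0; first by rewrite invr0 mulr0 normr0.
have r1 : 0 < normRn xi by rewrite lt0r r0 normRn_ge0.
by rewrite normrM normfV (gtr0_norm r1) ler_pdivrMr// mul1r norm_tnth_le.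
Qed.

Lemma norm_longitudinal_le a xi N : `|longitudinal a xi N| <= \sum_(l < n) `|a l|.
Proof.
apply: (le_trans (ler_norm_sum _ _ _)); apply: ler_sum => l _.
by rewrite normrM ler_piMl// normrM mulr_ile1 ?norm_direction_le.
Qed.

(** The quotient q is at most t and at most 1 / (al r) in absolute value. Hence q s <= t / (t + 2)
    <= K and q r <= K, with s = 1 / (t + 2), and the two squares are added. *)
Lemma sin_quotient_sqr_le (al t r K : R) : 0 < al -> 0 <= t -> 0 <= r -> 1 <= K -> al^-1 <= K ->
  (sin (t * al * r) / (al * r)) ^+ 2 <= 2 * K ^+ 2 / ((t + 2)^-1 ^+ 2 + r ^+ 2).
Proof.
move=> al0 t0 r0 K1 alK; set s := (t + 2)^-1.
have s0 : 0 < s by rewrite invr_gt0; lra.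
have d0 : 0 < s ^+ 2 + r ^+ 2 by rewrite ltr_wpDr ?sqr_ge0// exprn_gt0.
have K0 : 0 <= K by lra.
rewrite ler_pdivlMr//.
(* At r = 0 the quotient has the default value 0. *)
have [->|rn0] := eqVneq r 0; first by rewrite !mulr0 invr0 mulr0 expr0n mul0r mulr_ge0// sqr_ge0.
have rp : 0 < r by rewrite lt0r rn0.
rewrite -[X in X * _ <= _]real_normK ?num_real//.
set q := `| _ |; have q0 : 0 <= q by exact: normr_ge0.
have ar0 : 0 < al * r by exact: mulr_gt0.
have qt : q <= t.
  rewrite /q normrM normfV (gtr0_norm ar0) ler_pdivrMr// mulrA.
  by apply: (le_trans (norm_sin_le _)); rewrite ger0_norm// !mulr_ge0// ltW.
have qr : q * r <= K.
  apply: le_trans alK; rewrite /q normrM normfV (gtr0_norm ar0) invfM mulrA.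
  rewrite divfK// ler_piMl ?norm_sin_le1// invr_ge0 ltW//.
have qs : q * s <= K.
  apply: le_trans K1; rewrite /s ler_pdivrMr; lra.
have h1 : (q * s) ^+ 2 <= K ^+ 2 by rewrite lerXn2r ?nnegrE// mulr_ge0// ltW.
have h2 : (q * r) ^+ 2 <= K ^+ 2 by rewrite lerXn2r ?nnegrE// mulr_ge0// ltW.
rewrite !exprMn in h1 h2; rewrite mulrDr; lra.
Qed.

(** The projection is bounded by the l^1 norm and its complement by twice that, which gives |w| <= 3
    A + 3 q B; then (x + y)^2 <= 2 x^2 + 2 y^2 yields 18, and 36 after inserting the bound for
    q^2. *)
Lemma wave_sqr_le (al be t K : R) a b xi N : 0 < al -> 0 < be -> 0 <= t ->
  1 <= K -> al^-1 <= K -> be^-1 <= K ->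
  wave al be t a b xi N ^+ 2 <= 18 * (\sum_(l < n) `|a l|) ^+ 2 +
    36 * K ^+ 2 / ((t + 2)^-1 ^+ 2 + normRn xi ^+ 2) * (\sum_(l < n) `|b l|) ^+ 2.
Proof.
move=> al0 be0 t0 K1 alK beK; have r0 := normRn_ge0 xi.
have h1 := sin_quotient_sqr_le al0 t0 r0 K1 alK.
have h2 := sin_quotient_sqr_le be0 t0 r0 K1 beK.
have la := norm_longitudinal_le a xi N; have lb := norm_longitudinal_le b xi N.
have aN : `|a N| <= \sum_(l < n) `|a l| by rewrite (bigD1 N)//= lerDl sumr_ge0.
have bN : `|b N| <= \sum_(l < n) `|b l| by rewrite (bigD1 N)//= lerDl sumr_ge0.
have c1 := norm_cos_le1 (t * al * normRn xi); have c2 := norm_cos_le1 (t * be * normRn xi).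
have d0 : 0 < (t + 2)^-1 ^+ 2 + normRn xi ^+ 2.
  by rewrite ltr_wpDr ?sqr_ge0// exprn_gt0// invr_gt0; lra.
rewrite /wave; set r := normRn xi in h1 h2 c1 c2 d0 *.
have -> : 36 * K ^+ 2 / ((t + 2)^-1 ^+ 2 + r ^+ 2) =
  18 * (2 * K ^+ 2 / ((t + 2)^-1 ^+ 2 + r ^+ 2)) by rewrite !mulrA -natrM.
have : 0 <= 2 * K ^+ 2 / ((t + 2)^-1 ^+ 2 + r ^+ 2).
  by apply: divr_ge0; [rewrite mulr_ge0// sqr_ge0|exact: ltW].
move: h1 h2; set Q := 2 * K ^+ 2 / _.
have sq (x : R) : x ^+ 2 <= Q -> `|x| <= Num.sqrt Q by move=> xQ; rewrite -sqrtr_sqr ler_wsqrtr.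
move=> /sq h1 /sq h2 Q0; have q0 := sqrtr_ge0 Q; rewrite -[in leRHS](sqr_sqrtr Q0).
move: (Num.sqrt Q) q0 h1 h2 => q q0 h1 h2.
have prod (x y X Y : R) : `|x| <= X -> `|y| <= Y -> `|x * y| <= X * Y.
  by move=> *; rewrite normrM ler_pM.
have p1 := prod _ _ _ _ c1 la; have p2 := prod _ _ _ _ h1 lb.
have p3 := prod _ _ _ _ c2 (le_trans (ler_normB _ _) (lerD aN la)).
have p4 := prod _ _ _ _ h2 (le_trans (ler_normB _ _) (lerD bN lb)).
have A0 := le_trans (normr_ge0 _) la; have B0 := le_trans (normr_ge0 _) lb.
set w := (w in w ^+ 2 <= _).
have W : `|w| <= 3 * \sum_(l < n) `|a l| + 3 * (q * \sum_(l < n) `|b l|).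
  apply: (le_trans (ler_normD _ _)); apply: (le_trans (lerD (ler_normD _ _) (lexx _))).
  apply: (le_trans (lerD (lerD (ler_normD _ _) (lexx _)) (lexx _))).
  by clear -p1 p2 p3 p4; lra.
move: W; move: (\sum_(l < n) `|a l|) (\sum_(l < n) `|b l|) A0 B0 => A B A0 B0 W.
rewrite -[leLHS]real_normK ?num_real//.
have : `|w| ^+ 2 <= (3 * A + 3 * (q * B)) ^+ 2.
  by rewrite lerXn2r ?nnegrE// (le_trans (normr_ge0 w)).
move=> /le_trans; apply; have := sqr_ge0 (A - q * B); rewrite !expr2; clear; lra.
Qed.

End wave_upper_bound.

(** * The logarithmic integral over a strip of the plane *)

Section strip_integral.
Context {R : realType}.
Local Notation leb := (@lebesgue_measure R).
Local Notation mu n := (lebesgueRn R n).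

Lemma integral_rsqrt (s : R) : 0 < s ->
  (\int[leb]_(x in `[(- 1)%R, 1%R]) ((Num.sqrt (s ^+ 2 + x ^+ 2))^-1)%:E =
   (2 * ln ((1 + Num.sqrt (s ^+ 2 + 1)) / s))%:E)%E.
Proof.
move=> s0; pose rho x := Num.sqrt (s ^+ 2 + x ^+ 2).
have den x : 0 < s ^+ 2 + x ^+ 2 by rewrite ltr_pwDl ?exprn_gt0// sqr_ge0.
have rho0 x : 0 < rho x by rewrite sqrtr_gt0 den.
have arg0 x : 0 < x + rho x.
  rewrite -ltrBlDl sub0r; apply: (le_lt_trans (ler_norm _)); rewrite normrN -sqrtr_sqr.
  by rewrite ltr_sqrt// ltrDr exprn_gt0.
(* Up to a constant this antiderivative is arsinh(x / s). *)
have dF (x : R) : is_derive x 1 (fun x => ln (x + rho x)) (rho x)^-1.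
  have ds : is_derive (s ^+ 2 + x ^+ 2) 1 (@Num.sqrt R) (2 * rho x)^-1.
    exact: is_derive1_sqrt (den x).
  have dl : is_derive (x + rho x) 1 (@ln R) (x + rho x)^-1 by exact: is_derive1_ln.
  apply: is_derive_eq; rewrite /GRing.scale/= mulr1 add0r.
  have := arg0 x; have := rho0 x => r0 a0.
  by field; rewrite !gt_eqF.
have cf : continuous (fun x => (rho x)^-1).
  move=> x; apply: cvgV; first by rewrite gt_eqF.
  apply: continuous_comp; last exact: sqrt_continuous.
  by apply: cvgD; [exact: cvg_cst|exact: exprn_continuous].
have m11 : -1 < (1 : R) by lra.
rewrite (integral_itv_FTC_in m11 (fun x _ => cf x) (fun x _ => dF x)); congr (_%:E).
(* Rationalisation, from (rho - 1) (rho + 1) = s^2 at x = 1, avoids the cancellation and makes the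
   two ends combine into one logarithm. *)
have -> : -1 + rho (-1) = s ^+ 2 / (1 + rho 1).
  have r1 : 1 + rho 1 != 0 by rewrite gt_eqF.
  apply: (mulIf r1); rewrite divfK// /rho sqrrN expr1n.
  have r2 : Num.sqrt (s ^+ 2 + 1) ^+ 2 = s ^+ 2 + 1 by rewrite sqr_sqrtr// addr_ge0// sqr_ge0.
  transitivity (Num.sqrt (s ^+ 2 + 1) ^+ 2 - 1); last by rewrite r2 addrK.
  ring.
have r1 : 0 < 1 + rho 1 by exact: arg0.
move: r1; rewrite /rho expr1n => r1.
rewrite !ln_div ?posrE ?exprn_gt0// lnXn// mulr2n; ring.
Qed.

Lemma integral_Rn0 (g : Rn R 0 -> \bar R) : (\int[mu 0]_z g z = g [tuple])%E.
Proof.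
rewrite (eq_integral (cst (g [tuple]))); first by rewrite integral_cst//= diracT mule1.
by move=> z _; rewrite (tuple0 z).
Qed.

Lemma measurable_regularized n (s : R) (f : Rn R n -> R) : 0 < s -> measurable_fun setT f ->
  measurable_fun setT (fun xi => f xi / (s ^+ 2 + normRn xi ^+ 2)).
Proof.
move=> s0 mf; apply: measurable_funM => //.
have mc : measurable_fun setT (fun y : R => (s ^+ 2 + y ^+ 2)^-1).
  apply: continuous_measurable_fun => y; apply: cvgV.
    by rewrite gt_eqF// ltr_pwDl ?exprn_gt0// sqr_ge0.
  by apply: cvgD; [exact: cvg_cst|exact: exprn_continuous].
by apply: (measurableT_comp mc); exact: measurable_normRn.
Qed.

Lemma measurable_strip n : measurable [set xi : Rn R n.+1 | `|tnth xi ord0 : R| <= 1].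
Proof.
rewrite (_ : [set _ | _] = (fun xi : Rn R n.+1 => tnth xi ord0) @^-1` `[-1, 1]%classic).
  by rewrite -[X in measurable X]setTI; exact: measurable_tnth.
by apply/seteqP; split => xi /=; rewrite in_itv/= ler_norml.
Qed.

(** A strip rather than a disc makes the inner integral run over the whole line, where it is a
    Poisson integral of height sqrt(s^2 + x^2) and equals pi divided by that height. The outer
    integral is [integral_rsqrt]. *)
Lemma integral_strip_le (t : R) : 0 <= t ->
  (\int[mu 2]_xi (\1_[set xi : Rn R 2 | (`|tnth xi ord0 : R| <= 1)%R] xi /
     ((t + 2)^-1 ^+ 2 + normRn xi ^+ 2))%:E <= (6 * pi * ln (t + 2))%:E)%E.
Proof.
move=> t0; set s := (t + 2)^-1; set D : set (Rn R 2) := [set xi | _].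
have s0 : 0 < s by rewrite invr_gt0; lra.
have mD : measurable D by exact: measurable_strip.
have den r : 0 < s ^+ 2 + r ^+ 2 by rewrite ltr_pwDl ?exprn_gt0// sqr_ge0.
rewrite ge0_integral_cons; last 2 first.
- by apply: measurable_EFin; apply: measurable_regularized => //; exact: measurable_indic.
- by move=> xi; rewrite lee_fin divr_ge0// ltW.
have inner (x : R) : (\int[mu 1]_z (\1_D (Rn_cons (x, z)) / (s ^+ 2 + normRn (Rn_cons (x, z)) ^+ 2))%:E =
    pi%:E * (\1_(`[(- 1)%R, 1%R]%classic : set R) x * (Num.sqrt (s ^+ 2 + x ^+ 2))^-1)%:E)%E.
  have e0 : 0 < Num.sqrt (s ^+ 2 + x ^+ 2) by rewrite sqrtr_gt0.
  have indE z : \1_D (Rn_cons (x, z)) = \1_(`[(- 1)%R, 1%R]%classic : set R) x :> R.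
    rewrite !indicE; congr ((nat_of_bool _)%:R); apply/idP/idP; rewrite !inE /D/= in_itv/= -ler_norml//.
  under eq_integral => z _ do rewrite indE.
  rewrite ge0_integral_cons; last 2 first.
  - have mF := @measurable_regularized 2 s (fun=> \1_(`[(- 1)%R, 1%R]%classic : set R) x) s0 (measurable_cst _).
    apply: measurable_EFin; apply: (measurableT_comp mF).
    by apply: (measurableT_comp (@measurable_Rn_cons R 1)); exact: measurable_pair1.
  - by move=> z; rewrite lee_fin divr_ge0// ltW.
  transitivity (\int[leb]_y ((\1_(`[(- 1)%R, 1%R]%classic : set R) x * (Num.sqrt (s ^+ 2 + x ^+ 2))^-1)%:E *
      (poisson (Num.sqrt (s ^+ 2 + x ^+ 2)) y)%:E))%E.
    apply: eq_integral => y _.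
    rewrite integral_Rn0 -EFinM; congr (_%:E).
    rewrite -mulrA; congr (_ * _); rewrite normRn_cons.
    have -> : dotRn (Rn_cons (y, [tuple])) (Rn_cons (y, [tuple])) = y ^+ 2 :> R.
      by rewrite /dotRn big_ord_recl big_ord0/= addr0 -expr2.
    rewrite /poisson !sqr_sqrtr ?(ltW (den _))// ?addr_ge0 ?sqr_ge0// addrA.
    by rewrite mulrA mulVf ?gt_eqF// mul1r.
  rewrite ge0_integralZl//; last 2 first.
  - by apply: measurable_EFin; apply: continuous_measurable_fun; exact: continuous_poisson.
  - by move=> y _; rewrite lee_fin poisson_ge0.
  by rewrite integral_poisson// muleC.
under eq_integral => x _ do rewrite inner.
have mr : measurable_fun setT (fun x : R => (Num.sqrt (s ^+ 2 + x ^+ 2))^-1).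
  apply: continuous_measurable_fun => x; apply: cvgV; first by rewrite gt_eqF// sqrtr_gt0.
  apply: continuous_comp; last exact: sqrt_continuous.
  by apply: cvgD; [exact: cvg_cst|exact: exprn_continuous].
rewrite ge0_integralZl//; last 2 first.
- by apply: measurable_EFin; apply: measurable_funM => //; exact: measurable_indic.
- by rewrite lee_fin pi_ge0.
have -> : (\int[leb]_x (\1_(`[(- 1)%R, 1%R]%classic : set R) x * (Num.sqrt (s ^+ 2 + x ^+ 2))^-1)%:E =
    \int[leb]_(x in `[(- 1)%R, 1%R]) ((Num.sqrt (s ^+ 2 + x ^+ 2))^-1)%:E)%E.
  rewrite [RHS]integral_mkcond; apply: eq_integral => x _; rewrite patchE indicE.
  by case: ifPn => _; rewrite ?mul1r ?mul0r.
rewrite integral_rsqrt// -EFinM lee_fin.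
have -> : 6 * pi * ln (t + 2) = pi * (2 * (3%:R * ln (t + 2))) by ring.
(* There remains (1 + sqrt(s^2 + 1)) / s <= (t + 2)^3, which holds because the left side is at most
   3 (t + 2) and (t + 2)^2 >= 4. *)
rewrite ler_wpM2l ?pi_ge0// ler_wpM2l// mulr_natl -lnXn; last lra.
have t2 : 0 < t + 2 by lra.
have s1 : s <= 1 by rewrite /s invf_le1//; lra.
have r2 : Num.sqrt (s ^+ 2 + 1) <= 2.
  have -> : 2 = Num.sqrt (2 ^+ 2) :> R by rewrite sqrtr_sqr ger0_norm.
  by rewrite ler_wsqrtr// (_ : 2 ^+ 2 = 1 + 3) ?lerD//; [rewrite expr_le1// ltW|lra|lra].
have r0 := sqrtr_ge0 (s ^+ 2 + 1).
rewrite ler_ln ?posrE ?exprn_gt0//; last by rewrite divr_gt0//; lra.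
rewrite /s invrK !exprS expr0 mulr1.
nra.
Qed.

End strip_integral.

Section integral_comparison.
Context d {T : measurableType d} {R : realType} (mu : {measure set T -> \bar R}).

Lemma ge0_integral_le_comb (F A B D : T -> R) (a b c : R) :
  measurable_fun setT F -> measurable_fun setT A ->
  measurable_fun setT B -> measurable_fun setT D ->
  (forall x, 0 <= F x) -> (forall x, 0 <= A x) -> (forall x, 0 <= B x) ->
  (forall x, 0 <= D x) -> 0 <= a -> 0 <= b -> 0 <= c ->
  (forall x, F x <= a * A x + b * B x + c * D x) ->
  (\int[mu]_x (F x)%:E <= a%:E * \int[mu]_x (A x)%:E +
     b%:E * \int[mu]_x (B x)%:E + c%:E * \int[mu]_x (D x)%:E)%E.
Proof.
move=> mF mA mB mD F0 A0 B0 D0 a0 b0 c0 FABD.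
have mE (G : T -> R) : measurable_fun setT G -> measurable_fun setT (fun x => (G x)%:E).
  exact: measurable_EFin.
have mZ (G : T -> R) (k : R) : measurable_fun setT G -> measurable_fun setT (fun x => (k * G x)%:E).
  by move=> mG; apply: measurable_EFin; exact: measurable_funM.
have Z (G : T -> R) (k : R) : measurable_fun setT G -> (forall x, 0 <= G x) -> 0 <= k ->
    (k%:E * \int[mu]_x (G x)%:E = \int[mu]_x (k * G x)%:E)%E.
  move=> mG G0 k0; under [RHS]eq_integral do rewrite EFinM.
  by rewrite ge0_integralZl//; [exact: mE|move=> x _; rewrite lee_fin].
rewrite (Z A)// (Z B)// (Z D)//.
have k0 (G : T -> R) (k : R) : (forall x, 0 <= G x) -> 0 <= k ->
    forall x, setT x -> (0 <= (k * G x)%:E)%E.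
  by move=> G0 k0 x _; rewrite lee_fin mulr_ge0.
rewrite -ge0_integralD//; [|exact: k0|exact: mZ|exact: k0|exact: mZ].
rewrite -ge0_integralD//; last 4 first.
- by move=> x _; rewrite adde_ge0// k0.
- by apply: emeasurable_funD; exact: mZ.
- exact: k0.
- exact: mZ.
apply: ge0_le_integral => //.
- by move=> x _; rewrite lee_fin.
- exact: mE.
- by apply: emeasurable_funD; [apply: emeasurable_funD; exact: mZ|exact: mZ].
by move=> x _; rewrite -!EFinD lee_fin.
Qed.

Lemma integral_sum_EFin (I : finType) (F : I -> T -> R) :
  (forall i, measurable_fun setT (F i)) -> (forall i x, 0 <= F i x) ->
  (\int[mu]_x (\sum_i F i x)%:E = \sum_i \int[mu]_x (F i x)%:E)%E.
Proof.
move=> mF F0; under eq_integral => x _ do rewrite -sumEFin.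
rewrite ge0_integral_sum//.
- by move=> i; apply: measurable_EFin.
- by move=> i x _; rewrite lee_fin.
Qed.

End integral_comparison.

Lemma sum_sqr_le {R : realDomainType} (I : finType) (x : I -> R) :
  (forall i, 0 <= x i) -> \sum_i x i ^+ 2 <= (\sum_i x i) ^+ 2.
Proof.
move=> x0; rewrite [leRHS]expr2 mulr_suml; apply: ler_sum => i _.
by rewrite expr2 ler_wpM2l// (bigD1 i)//= lerDl sumr_ge0.
Qed.

Section spectrum_bounds.
Context {R : realType} (n : nat).
Local Notation mu := (lebesgueRn R n).
Implicit Types f : Rn R n -> R.

Lemma norm_Rintegral_le_normL11 f : isL11 f -> `|\int[mu]_x f x| <= normL11 f.
Proof.
move=> f11; rewrite normL11E//; have fi := isL11_integrable f11.
apply: (le_trans (le_normr_Rintegral measurableT fi)).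
apply: le_Rintegral => //.
- exact: integrable_norm.
- apply: eq_integrable (integrable_norm (isL11_integrable1 f11)) => // x _ /=.
  by rewrite normrM ger0_norm// addr_ge0// normRn_ge0.
- by move=> x _; rewrite ler_peMl// lerDl normRn_ge0.
Qed.

(** Lipschitz bounds from the origin, where the cosine transform is the integral of f and the sine
    transform is 0. With E the increment bound, the cosine part gives 2 m^2 + 2 E^2 and the sine
    part E^2. *)
Lemma spectrum_le_near0 f xi : isL11 f ->
  spectrum f xi <= 2 * (\int[mu]_x f x) ^+ 2 +
    3 * (normL11 f * (n%:R * normRn xi)) ^+ 2.
Proof.
move=> f11.
have := cos_transform_lipschitz xi (zeroRn n) f11; rewrite cos_transform0 => hc.
have := sin_transform_lipschitz xi (zeroRn n) f11; rewrite sin_transform0 subr0 => hs.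
have L0 := normL11_ge0 f.
have Ld := ler_wpM2l L0 (dist1_0 xi).
move: (le_trans hc Ld) (le_trans hs Ld); rewrite /spectrum.
move: (cos_transform f xi) (sin_transform f xi) (\int[mu]_x f x) (normL11 f * _) => c s m E cE sE.
have E0 := le_trans (normr_ge0 _) sE.
have h1 : (c - m) ^+ 2 <= E ^+ 2 by rewrite -[leLHS]real_normK ?num_real// lerXn2r ?nnegrE.
have h2 : s ^+ 2 <= E ^+ 2 by rewrite -[leLHS]real_normK ?num_real// lerXn2r ?nnegrE.
have := sqr_ge0 (c - 2 * m); rewrite !expr2 in h1 h2 *; lra.
Qed.

(** The Lipschitz bound makes the spectrum vanish identically, and Plancherel does the rest. *)
Lemma normL2_eq0_of_normL11 f : isL2 f -> isL11 f -> normL11 f = 0 -> normL2 f = 0.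
Proof.
move=> f2 f11 L0; have fi := isL11_integrable f11.
have m0 : \int[mu]_x f x = 0.
  by apply/eqP; rewrite -normr_le0 -L0; exact: norm_Rintegral_le_normL11.
have S0 xi : spectrum f xi = 0.
  apply/eqP; rewrite eq_le spectrum_ge0 andbT.
  by have := spectrum_le_near0 xi f11; rewrite m0 L0 mul0r expr0n/= !mulr0 addr0.
have := plancherel fi (isL2_lty f2).
under eq_integral do rewrite S0.
rewrite integral0 -normL2_sqr// -EFinM => /eqP; rewrite eqe eq_sym mulf_eq0 => /orP[|].
  by rewrite expf_eq0 gt_eqF ?andbF// mulr_gt0// pi_gt0.
by rewrite sqrf_eq0 => /eqP.
Qed.

(** The data-dependent ratio by which the L^2 norm of f_1 is absorbed. A component with zero L^{1,1}
    norm gives the default quotient 0 and has zero L^2 norm. *)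
Lemma normL2_le_normL11 m (f : 'I_m -> Rn R n -> R) :
  (forall k, isL2 (f k) /\ isL11 (f k)) ->
  exists2 Q : R, 0 <= Q & forall k, normL2 (f k) <= Q * normL11 (f k).
Proof.
move=> hf; have q0 k : 0 <= normL2 (f k) / normL11 (f k).
  by rewrite divr_ge0 ?normL2_ge0 ?normL11_ge0.
exists (\sum_k normL2 (f k) / normL11 (f k)) => [|k]; first exact: sumr_ge0.
have [L0|Ln0] := eqVneq (normL11 (f k)) 0.
  by rewrite L0 mulr0 normL2_eq0_of_normL11//; have [] := hf k.
rewrite -ler_pdivrMr ?lt0r ?Ln0 ?normL11_ge0//.
by rewrite (bigD1 k)//= lerDl sumr_ge0.
Qed.

End spectrum_bounds.

Section planar_upper_bound.
Context {R : realType}.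
Local Notation mu := (lebesgueRn R 2).
Implicit Types f : Rn R 2 -> R.

Lemma integral_spectrum f : isL2 f -> isL11 f ->
  (\int[mu]_xi (spectrum f xi)%:E = ((2 * pi) ^+ 2 * normL2 f ^+ 2)%:E)%E.
Proof.
by move=> f2 f11; rewrite (plancherel (isL11_integrable f11) (isL2_lty f2)) -normL2_sqr// -EFinM.
Qed.

(** For |xi| >= 1 the denominator is at least 1 and Plancherel applies. For |xi| < 1 the value at
    the origin gives the strip integral, with 12 = 2 * 6, and the Lipschitz error 12 L^2 |xi|^2
    cancels against the denominator on a square of area 4, with 48 = 12 * 4. *)
Lemma integral_regularized_spectrum_le f (t : R) : isL2 f -> isL11 f -> 0 <= t ->
  (\int[mu]_xi (spectrum f xi / ((t + 2)^-1 ^+ 2 + normRn xi ^+ 2))%:E <=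
   ((2 * pi) ^+ 2 * normL2 f ^+ 2 + 12 * pi * ((\int[mu]_x f x) ^+ 2 * ln (t + 2)) +
    48 * normL11 f ^+ 2)%:E)%E.
Proof.
move=> f2 f11 t0; have fi := isL11_integrable f11.
set s := (t + 2)^-1; set m : R := (\int[mu]_x f x)%R; set L := normL11 f.
have s0 : 0 < s by rewrite invr_gt0; lra.
have den r : 0 < s ^+ 2 + r ^+ 2 by rewrite ltr_pwDl ?exprn_gt0// sqr_ge0.
have mS : measurable_fun setT (spectrum f) by exact: measurable_spectrum.
pose D : set (Rn R 2) := [set xi | (`|tnth xi ord0 : R| <= 1)%R].
have mD : measurable D by exact: measurable_strip.
pose Q := cube (fun=> 0 : R) 1 : set (Rn R 2).
have mQ : measurable Q by exact: measurable_cube.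
apply: (@le_trans _ _ (1%:E * \int[mu]_xi (spectrum f xi)%:E +
   (2 * m ^+ 2)%:E * \int[mu]_xi (\1_D xi / (s ^+ 2 + normRn xi ^+ 2))%:E +
   (12 * L ^+ 2)%:E * \int[mu]_xi (\1_Q xi)%:E)%E).
  apply: ge0_integral_le_comb => //.
  - exact: measurable_regularized.
  - by apply: measurable_regularized => //; exact: measurable_indic.
  - by move=> xi; rewrite divr_ge0 ?spectrum_ge0// ltW.
  - by move=> xi; exact: spectrum_ge0.
  - by move=> xi; rewrite divr_ge0// ltW.
  - by rewrite mulr_ge0// sqr_ge0.
  - by rewrite mulr_ge0// sqr_ge0.
  move=> xi; have Sx := spectrum_ge0 f xi; have d0 := den (normRn xi).
  have r0 := normRn_ge0 xi.
  rewrite mul1r; have [r1|r1] := leP 1 (normRn xi).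
    apply: (@le_trans _ _ (spectrum f xi)).
      rewrite ler_pdivrMr// ler_peMr//.
      have : 1 <= normRn xi ^+ 2 by rewrite expr_ge1.
      by move: (sqr_ge0 s); lra.
    rewrite -addrA lerDl addr_ge0// mulr_ge0//; do ?by rewrite mulr_ge0// sqr_ge0.
    by rewrite divr_ge0// ltW.
  have xiD : xi \in D by rewrite inE; apply: (le_trans (norm_tnth_le _ _)); exact: ltW.
  have xiQ : xi \in Q by rewrite inE => i; rewrite subr0; apply: (le_trans (norm_tnth_le _ _)); exact: ltW.
  rewrite !indicE xiD xiQ mulr1 div1r.
  have H := spectrum_le_near0 xi f11; rewrite -/m -/L in H.
  rewrite -addrA -[leLHS]add0r lerD//.
  rewrite ler_pdivrMr// mulrDl divfK ?gt_eqF//.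
  apply: (le_trans H); rewrite lerD2l.
  rewrite (_ : 3 * _ = 12 * L ^+ 2 * normRn xi ^+ 2); last by rewrite !exprMn; ring.
  apply: ler_wpM2l; first by rewrite mulr_ge0// sqr_ge0.
  by rewrite lerDr sqr_ge0.
rewrite integral_spectrum// mul1e integral_indic_cube// -EFinM.
apply: (@le_trans _ _ (((2 * pi) ^+ 2 * normL2 f ^+ 2)%:E + (2 * m ^+ 2)%:E * (6 * pi * ln (t + 2))%:E +
   (12 * L ^+ 2 * (2 * 1) ^+ 2)%:E)%E).
  apply: leeD => //; apply: leeD => //; apply: lee_pmul => //.
  - by rewrite lee_fin mulr_ge0// sqr_ge0.
  - by apply: integral_ge0 => xi _; rewrite lee_fin divr_ge0// ltW.
  - exact: integral_strip_le.
by rewrite -EFinM -!EFinD lee_fin le_eqVlt; apply/orP; left; apply/eqP; ring.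
Qed.

Lemma integral_sqr_modulus_uhat_le (lambda mu0 K t : R) (f0 f1 : 'I_2 -> Rn R 2 -> R) N :
  0 < lambda + 2 * mu0 -> 0 < mu0 -> 0 <= t -> 1 <= K ->
  (Num.sqrt (lambda + 2 * mu0))^-1 <= K -> (Num.sqrt mu0)^-1 <= K ->
  (forall k, isL2 (f0 k) /\ isL11 (f0 k)) -> (forall k, isL2 (f1 k) /\ isL11 (f1 k)) ->
  measurable_fun setT (sqr_modulus (fun xi => uhat lambda mu0 f0 f1 t xi N 0)) ->
  (\int[mu]_xi (sqr_modulus (fun xi => uhat lambda mu0 f0 f1 t xi N 0) xi)%:E <=
   (36 * \sum_k (2 * pi) ^+ 2 * normL2 (f0 k) ^+ 2 + 72 * K ^+ 2 * \sum_k
     ((2 * pi) ^+ 2 * normL2 (f1 k) ^+ 2 + 12 * pi * ((\int[mu]_x f1 k x) ^+ 2 * ln (t + 2)) +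
    48 * normL11 (f1 k) ^+ 2))%:E)%E.
Proof.
move=> l0 m0 t0 K1 alK beK hf0 hf1 mM.
have al0 : 0 < Num.sqrt (lambda + 2 * mu0) by rewrite sqrtr_gt0.
have be0 : 0 < Num.sqrt mu0 by rewrite sqrtr_gt0.
have s0 : 0 < (t + 2)^-1 by rewrite invr_gt0; lra.
have den r : 0 < (t + 2)^-1 ^+ 2 + r ^+ 2 by rewrite ltr_pwDl ?exprn_gt0// sqr_ge0.
have mS f : isL11 f -> measurable_fun setT (spectrum f).
  by move=> /isL11_integrable fi; exact: measurable_spectrum.
pose A xi := \sum_k spectrum (f0 k) xi.
pose B xi := \sum_k spectrum (f1 k) xi / ((t + 2)^-1 ^+ 2 + normRn xi ^+ 2).
have mB k : measurable_fun setT (fun xi => spectrum (f1 k) xi / ((t + 2)^-1 ^+ 2 + normRn xi ^+ 2)).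
  by apply: measurable_regularized => //; apply: mS; have [] := hf1 k.
have mA k : measurable_fun setT (spectrum (f0 k)) by apply: mS; have [] := hf0 k.
have B0 k xi : 0 <= spectrum (f1 k) xi / ((t + 2)^-1 ^+ 2 + normRn xi ^+ 2).
  by rewrite divr_ge0 ?spectrum_ge0// ltW.
(* The constants of [wave_sqr_le] double because the square of a sum of two components is at most
   twice the sum of the squares. The term with coefficient 0 only fills the three-term
   comparison. *)
apply: (@le_trans _ _ (36%:E * \int[mu]_xi (A xi)%:E + (72 * K ^+ 2)%:E * \int[mu]_xi (B xi)%:E +
   0%:E * \int[mu]_xi (A xi)%:E)%E).
  apply: ge0_integral_le_comb => //.
  - exact: measurable_sum.
  - exact: measurable_sum.
  - exact: measurable_sum.
  - by move=> xi; exact: sqr_modulus_ge0.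
  - by move=> xi; apply: sumr_ge0 => k _; exact: spectrum_ge0.
  - by move=> xi; exact: sumr_ge0.
  - by move=> xi; apply: sumr_ge0 => k _; exact: spectrum_ge0.
  - by rewrite mulr_ge0// sqr_ge0.
  move=> xi; rewrite mul0r addr0 /sqr_modulus Re_uhat Im_uhat.
  have H a b := wave_sqr_le a b xi N al0 be0 t0 K1 alK beK.
  apply: (le_trans (lerD (H _ _) (H _ _))).
  have csq x y : (x + y) ^+ 2 <= 2 * (x ^+ 2 + y ^+ 2) :> R.
    by have := sqr_ge0 (x - y); rewrite !expr2; lra.
  rewrite /A /B -mulr_suml !big_ord_recl !big_ord0 !addr0/= !normrN.
  move: (den (normRn xi)); set dd := _ + normRn xi ^+ 2 => dd0.
  set k0 := lift _ _; rewrite /spectrum.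
  have n2 (x : R) : x ^+ 2 = `|x| ^+ 2 by rewrite real_normK ?num_real.
  rewrite ![in leRHS](n2 (cos_transform _ _)) ![in leRHS](n2 (sin_transform _ _)).
  set c1 := `|cos_transform (f0 ord0) xi|; set c2 := `|cos_transform (f0 k0) xi|.
  set s1 := `|sin_transform (f0 ord0) xi|; set s2 := `|sin_transform (f0 k0) xi|.
  set p1 := `|cos_transform (f1 ord0) xi|; set p2 := `|cos_transform (f1 k0) xi|.
  set q1 := `|sin_transform (f1 ord0) xi|; set q2 := `|sin_transform (f1 k0) xi|.
  have i0 : 0 <= K ^+ 2 / dd by rewrite divr_ge0 ?sqr_ge0// ltW.
  have E1 := lerD (csq c1 c2) (csq s1 s2).
  have E2 := ler_wpM2l i0 (lerD (csq p1 p2) (csq q1 q2)).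
  rewrite -![_ * K ^+ 2 / dd]mulrA.
  rewrite (_ : 72 * K ^+ 2 * _ = 72 * (K ^+ 2 / dd * (p1 ^+ 2 + q1 ^+ 2 + (p2 ^+ 2 + q2 ^+ 2)))); last by rewrite !mulrA; ring.
  move: (K ^+ 2 / dd) i0 E2 => i i0; rewrite !mulrDr.
  by move=> E2; clear -E1 E2; lra.
rewrite mul0e adde0 !integral_sum_EFin//; last by move=> k xi; exact: spectrum_ge0.
rewrite (eq_bigr (fun k => ((2 * pi) ^+ 2 * normL2 (f0 k) ^+ 2)%:E)); last first.
  by move=> k _; have [] := hf0 k; exact: integral_spectrum.
rewrite sumEFin [leRHS]EFinD; apply: leeD; first by rewrite -EFinM.
rewrite [leRHS]EFinM; apply: lee_pmul => //.
- by rewrite lee_fin mulr_ge0// sqr_ge0.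
- by apply: sume_ge0 => k _; apply: integral_ge0 => xi _; rewrite lee_fin.
rewrite -sumEFin; apply: lee_sum => k _.
by apply: integral_regularized_spectrum_le => //; have [] := hf1 k.
Qed.

End planar_upper_bound.

Lemma measurable_sqr_modulus {R : realType} n (v : Rn R n -> R) g :
  is_fourierL2 v g -> measurable_fun setT (sqr_modulus g).
Proof.
by move=> [_ /isL2_measurable mR /isL2_measurable mI _]; apply: measurable_funD; exact: measurable_funX.
Qed.

(** With k >= 1 one has k <= k^2, so U^2 <= k Y^2 already gives U <= k Y, without the square root of
    k. *)
Lemma le_of_weighted_sqr_le {R : realFieldType} (c A B D U x y z : R) :
  0 < c -> 0 <= A -> 0 <= B -> 0 <= D -> 0 <= U -> 0 <= x -> 0 <= y -> 0 <= z ->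
  c * U ^+ 2 <= 2 * (A * x ^+ 2 + B * z ^+ 2 + D * y ^+ 2) ->
  U <= (1 + 2 * (A + B + D) / c) * (x + y + z).
Proof.
move=> c0 A0 B0 D0 U0 x0 y0 z0 HU; set k := 1 + _; set Y := x + y + z.
have Y0 : 0 <= Y by rewrite !addr_ge0.
have k1 : 1 <= k by rewrite lerDl divr_ge0 ?mulr_ge0 ?addr_ge0// ltW.
have sq w : 0 <= w -> w <= Y -> w ^+ 2 <= Y ^+ 2 by move=> w0 wY; rewrite lerXn2r ?nnegrE.
have hx : x ^+ 2 <= Y ^+ 2 by apply: sq => //; rewrite /Y; lra.
have hy : y ^+ 2 <= Y ^+ 2 by apply: sq => //; rewrite /Y; lra.
have hz : z ^+ 2 <= Y ^+ 2 by apply: sq => //; rewrite /Y; lra.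
have hA := ler_wpM2l A0 hx; have hB := ler_wpM2l B0 hz; have hD := ler_wpM2l D0 hy.
rewrite -ler_sqr ?nnegrE//; last by rewrite mulr_ge0//; lra.
have HU2 : U ^+ 2 <= k * Y ^+ 2.
  rewrite -(ler_pM2l c0) /k mulrDl mul1r mulrDr.
  rewrite [X in _ + X](_ : _ = 2 * (A + B + D) * Y ^+ 2); last by field; rewrite gt_eqF.
  have : 0 <= c * Y ^+ 2 by rewrite mulr_ge0 ?sqr_ge0// ltW.
  lra.
apply: (le_trans HU2); rewrite exprMn; apply: ler_wpM2r; first exact: sqr_ge0.
by rewrite expr2 ler_peMl//; lra.
Qed.

Lemma planar_upper_bound (R : realType) (lambda mu : R)
  (hlm : 0 < lambda + 2 * mu) (hmu : 0 < mu) (N : 'I_2)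
  (f0 f1 : 'I_2 -> Rn R 2 -> R)
  (hf0 : forall k, isL2 (f0 k) /\ isL11 (f0 k))
  (hf1 : forall k, isL2 (f1 k) /\ isL11 (f1 k))
  (u : R -> 'I_2 -> Rn R 2 -> R) (hu : elastic_solution lambda mu f0 f1 u) :
  exists2 C : R, 0 < C & forall t, 0 <= t ->
    normL2 (u t N) <=
      C * (vnorm2 f0 + absM f1 * Num.sqrt (ln (t + 2)) + vnorm11 f1).
Proof.
pose al := Num.sqrt (lambda + 2 * mu); pose be := Num.sqrt mu.
have al0 : 0 < al^-1 by rewrite invr_gt0 sqrtr_gt0.
have be0 : 0 < be^-1 by rewrite invr_gt0 sqrtr_gt0.
(* One number above 1 and above the inverses of both speeds, as [sin_quotient_sqr_le] requires. *)
pose K := 1 + al^-1 + be^-1.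
have [Q Q0 HQ] := normL2_le_normL11 hf1.
have pi0 := @pi_ge0 R.
pose c0 : R := (2 * pi) ^+ 2.
have c00 : 0 < c0 by rewrite exprn_gt0// mulr_gt0// pi_gt0.
(* The coefficients of the squares of the f_0 term, of the L^{1,1} term and of the logarithmic term;
   Q^2 in B turns the L^2 norms of f_1 into L^{1,1} norms. *)
pose A := 36 * c0; pose B := 72 * K ^+ 2 * (c0 * Q ^+ 2 + 48); pose D := 72 * K ^+ 2 * (12 * pi).
have A0 : 0 <= A by rewrite mulr_ge0// ltW.
have K20 : 0 <= 72 * K ^+ 2 by rewrite mulr_ge0// sqr_ge0.
have B0 : 0 <= B by rewrite mulr_ge0// addr_ge0// mulr_ge0 ?sqr_ge0// ltW.
have D0 : 0 <= D by rewrite mulr_ge0// mulr_ge0.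
have S0 : 0 <= A + B + D by rewrite !addr_ge0.
exists (1 + 2 * (A + B + D) / c0) => [|t t0].
  by rewrite ltr_pwDl// divr_ge0// ?mulr_ge0// ltW.
have ut := hu t t0 N.
have H1 := fourierL2_ge ut.
have lnt : 0 <= ln (t + 2) by rewrite ln_ge0//; lra.
have K1 : 1 <= K by rewrite /K; lra.
have K2 : al^-1 <= K by rewrite /K; lra.
have K3 : be^-1 <= K by rewrite /K; lra.
have H2 := integral_sqr_modulus_uhat_le hlm hmu t0 K1 K2 K3 hf0 hf1 (measurable_sqr_modulus ut).
have u2 : isL2 (u t N) by case: ut.
set U := normL2 (u t N); have U0 : 0 <= U := normL2_ge0 _.
have : (c0%:E * (U ^+ 2)%:E <= 2%:E * (A * vnorm2 f0 ^+ 2 + B * vnorm11 f1 ^+ 2 + D * (absM f1 ^+ 2 * ln (t + 2)))%:E)%E.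
  rewrite normL2_sqr//; apply: (le_trans H1); apply: lee_pmul => //.
    by apply: integral_ge0 => xi _; rewrite lee_fin sqr_modulus_ge0.
  apply: (le_trans H2); rewrite lee_fin -/c0.
  have E1 : \sum_k normL2 (f0 k) ^+ 2 <= vnorm2 f0 ^+ 2 by apply: sum_sqr_le => k; exact: normL2_ge0.
  have E2 : \sum_k normL11 (f1 k) ^+ 2 <= vnorm11 f1 ^+ 2 by apply: sum_sqr_le => k; exact: normL11_ge0.
  have E3 : \sum_k (\int[lebesgueRn R 2]_x f1 k x) ^+ 2 <= absM f1 ^+ 2.
    apply: le_trans (sum_sqr_le (x := fun k => `|moment f1 k|) _) => //.
    by apply: ler_sum => k _; rewrite real_normK ?num_real.
  have E4 : \sum_k normL2 (f1 k) ^+ 2 <= Q ^+ 2 * vnorm11 f1 ^+ 2.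
    apply: le_trans (ler_wpM2l (sqr_ge0 Q) E2); rewrite mulr_sumr; apply: ler_sum => k _.
    by rewrite -exprMn lerXn2r ?nnegrE ?normL2_ge0// mulr_ge0// normL11_ge0.
  rewrite -addrA; apply: lerD; first by rewrite -mulr_sumr mulrA ler_wpM2l.
  rewrite !big_split/= -!mulr_sumr -mulr_suml.
  rewrite (_ : B * _ + _ = 72 * K ^+ 2 * (c0 * (Q ^+ 2 * vnorm11 f1 ^+ 2) +
     12 * pi * (absM f1 ^+ 2 * ln (t + 2)) + 48 * vnorm11 f1 ^+ 2)); last by rewrite /B /D; ring.
  apply: ler_wpM2l => //; apply: lerD; last exact: ler_wpM2l.
  apply: lerD; first by apply: ler_wpM2l => //; exact: ltW.
  by apply: ler_wpM2l; [rewrite mulr_ge0|exact: ler_wpM2r].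
rewrite -!EFinM lee_fin.
set x := vnorm2 f0; set z := vnorm11 f1; set y := absM f1 * _.
have <- : y ^+ 2 = absM f1 ^+ 2 * ln (t + 2) by rewrite exprMn sqr_sqrtr.
have x0 : 0 <= x by apply: sumr_ge0 => k _; exact: normL2_ge0.
have z0 : 0 <= z by apply: sumr_ge0 => k _; exact: normL11_ge0.
have y0 : 0 <= y by rewrite mulr_ge0 ?sqrtr_ge0// sumr_ge0.
by move=> HU; exact: le_of_weighted_sqr_le HU.
Qed.

(** * Lower bounds *)

Lemma cvg_sumr {R : realType} (I : finType) {T : Type} (F : set_system T) {FF : Filter F}
    (f : I -> T -> R) (l : I -> R) : (forall i, f i x @[x --> F] --> l i) ->
  \sum_i f i x @[x --> F] --> \sum_i l i.
Proof. by move=> fl; apply: cvg_big => //; exact: add_continuous. Qed.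

Lemma normRn_neq0 {R : realType} n (eta : Rn R n.+1) : 0 < tnth eta ord0 :> R -> normRn eta != 0.
Proof. by move=> h; rewrite gt_eqF// (lt_le_trans h)// (le_trans (ler_norm _))// norm_tnth_le. Qed.

(** * Freezing the coefficients near a frequency *)

Section cube_filter.
Context {R : realType} (n : nat).
Implicit Types (xi eta : Rn R n).

(** The neighbourhood filter of eta, with closed cubes as a basis because these carry the integral
    estimates. *)
Definition cube_filter eta : set_system (Rn R n) :=
  filter_from [set e : R | 0 < e] (cube (tnth eta)).

Global Instance cube_filter_proper eta : ProperFilter (cube_filter eta).
Proof.
apply: filter_from_proper => [|e e0]; last by exists eta => i; rewrite subrr normr0 ltW.
apply: filter_from_filter; first by exists 1 => /=.
move=> e1 e2 /= e10 e20; exists (Num.min e1 e2); first by rewrite /= lt_min e10.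
by move=> xi H; split => i; apply: (le_trans (H i)); rewrite ge_min lexx ?orbT.
Qed.

Lemma cvg_tnth_cube eta i : (tnth xi i : R) @[xi --> cube_filter eta] --> (tnth eta i : R).
Proof.
apply/cvgrPdist_le => e e0; exists e => //= xi H.
by rewrite distrC; exact: H.
Qed.

Lemma cvg_lipschitz_cube (F : Rn R n -> R) eta L :
  (forall xi, `|F xi - F eta| <= L * dist1 xi eta) -> F @ cube_filter eta --> F eta.
Proof.
move=> FL; have H : L * dist1 xi eta @[xi --> cube_filter eta] --> L * \sum_(i < n) `|tnth eta i - tnth eta i|.
  apply: cvgM; first exact: cvg_cst.
  apply: cvg_sumr => i; apply: cvg_norm; apply: cvgB; [exact: cvg_tnth_cube|exact: cvg_cst].
rewrite big1 in H; last by move=> i _; rewrite subrr normr0.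
rewrite mulr0 in H.
apply/cvgrPdist_le => e e0; move/cvgrPdist_le: H => /(_ e e0).
apply: filterS => xi; rewrite sub0r normrN => /(le_trans (ler_norm _)).
by rewrite distrC; exact: le_trans.
Qed.

End cube_filter.

Section wave_trig.
Context {R : realType} (n : nat) (al be : R) (N : 'I_n).
Hypotheses (al0 : 0 < al) (be0 : 0 < be).
Implicit Types (a b : 'I_n -> R) (xi eta : Rn R n).

(** Separates the fast variable s = t |xi| from the slow dependence of the amplitudes on xi, so that
    the amplitudes can be frozen while s oscillates. *)
Definition wave_trig a b xi (s : R) : R :=
  trig al be (longitudinal a xi N) (longitudinal b xi N / (al * normRn xi))
    (a N - longitudinal a xi N) ((b N - longitudinal b xi N) / (be * normRn xi)) s.

Lemma wave_trigE t a b xi : wave al be t a b xi N = wave_trig a b xi (t * normRn xi).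
Proof.
rewrite /wave /wave_trig /trig !(mulrCA _ t) !mulrA.
by ring.
Qed.

Lemma normRn_scale (s : R) xi : 0 <= s -> normRn (scaleRn s xi) = s * normRn xi.
Proof.
move=> s0; rewrite /normRn /dotRn.
under eq_bigr => i _ do rewrite tnth_mktuple mulrACA.
by rewrite -mulr_sumr sqrtrM ?mulr_ge0// -expr2 sqrtr_sqr ger0_norm.
Qed.

Lemma longitudinal_scale (s : R) a xi : 0 < s -> longitudinal a (scaleRn s xi) N = longitudinal a xi N.
Proof.
move=> s0; apply: eq_bigr => l _; rewrite !tnth_mktuple normRn_scale ?ltW//.
by rewrite -!(mulf_div s) divff ?gt_eqF// !mul1r.
Qed.

Lemma longitudinalZ (s : R) a xi : longitudinal (fun k => s * a k) xi N = s * longitudinal a xi N.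
Proof. by rewrite /longitudinal mulr_sumr; apply: eq_bigr => l _; rewrite mulrCA. Qed.

(** Projections are homogeneous of degree 0, and the factor 1 / |xi| on the b terms absorbs sg.
    Towards the origin the contribution of a is thus damped by sg and that of b survives. *)
Lemma wave_scale (sg t : R) a b xi : 0 < sg ->
  sg * wave al be t a b (scaleRn sg xi) N =
  wave_trig (fun k => sg * a k) b xi (t * normRn (scaleRn sg xi)).
Proof.
move=> sg0; rewrite wave_trigE /wave_trig /trig !longitudinal_scale// longitudinalZ.
rewrite normRn_scale ?ltW//.
have inv (x r : R) : sg * (x * (sg * r)^-1) = x / r.
  by rewrite mulrA -(mulf_div sg) divff ?gt_eqF// mul1r.
set u := longitudinal a _ _; set v := longitudinal b _ _.
have E1 : v / (al * normRn xi) = sg * (v / (al * (sg * normRn xi))).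
  by rewrite (mulrCA al) inv.
have E2 : (b N - v) / (be * normRn xi) = sg * ((b N - v) / (be * (sg * normRn xi))).
  by rewrite (mulrCA be) inv.
rewrite E1 E2; ring.
Qed.

Lemma trig_dist (a b c d a' b' c' d' s : R) :
  `|trig al be a b c d s - trig al be a' b' c' d' s| <=
  `|a - a'| + `|b - b'| + `|c - c'| + `|d - d'|.
Proof.
rewrite (_ : _ - _ = (a - a') * cos (al * s) + (b - b') * sin (al * s) +
   (c - c') * cos (be * s) + (d - d') * sin (be * s)); last by rewrite /trig; ring.
have H (x y : R) : `|y| <= 1 -> `|x * y| <= `|x| by move=> y1; rewrite normrM ler_piMr.
have Hc (x y : R) : `|x * cos y| <= `|x| by apply: H; exact: norm_cos_le1.
have Hs (x y : R) : `|x * sin y| <= `|x| by apply: H; exact: norm_sin_le1.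
by do 3 (apply: (le_trans (ler_normD _ _)); apply: lerD => //).
Qed.

Context {Z : Type} (F : set_system Z) {FF : Filter F}.
Variables (a b : Z -> 'I_n -> R) (xi : Z -> Rn R n) (a0 b0 : 'I_n -> R) (eta : Rn R n).
Hypotheses (ca : forall k, a z k @[z --> F] --> a0 k) (cb : forall k, b z k @[z --> F] --> b0 k).
Hypotheses (cxi : forall k, (tnth (xi z) k : R) @[z --> F] --> (tnth eta k : R)) (eta0 : normRn eta != 0).

Lemma cvg_normRn : normRn (xi z) @[z --> F] --> normRn eta.
Proof.
have cd : dotRn (xi z) (xi z) @[z --> F] --> dotRn eta eta.
  by apply: cvg_sumr => i; apply: cvgM; exact: cxi.
exact: (continuous_cvg _ (@sqrt_continuous R _) cd).
Qed.

Lemma cvg_longitudinal (c : Z -> 'I_n -> R) (c0 : 'I_n -> R) : (forall k, c z k @[z --> F] --> c0 k) ->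
  longitudinal (c z) (xi z) N @[z --> F] --> longitudinal c0 eta N.
Proof.
move=> cc; apply: cvg_sumr => l.
have cu k : tnth (xi z) k / normRn (xi z) @[z --> F] --> (tnth eta k / normRn eta : R).
  by apply: cvgM; [exact: cxi|apply: cvgV => //; exact: cvg_normRn].
by apply: cvgM => //; apply: cvgM.
Qed.

(** The convergence is uniform in s because cosines and sines are bounded by 1: only the four
    amplitudes have to converge, each with an error e / 4. *)
Lemma cvg_wave_trig (e : R) : 0 < e -> \forall z \near F,
  forall s, `|wave_trig (a z) (b z) (xi z) s - wave_trig a0 b0 eta s| <= e.
Proof.
move=> e0; have e4 : 0 < e / 4 by rewrite divr_gt0.
have la := cvg_longitudinal ca; have lb := cvg_longitudinal cb.
have den (g : R) : 0 < g -> (g * normRn (xi z))^-1 @[z --> F] --> (g * normRn eta)^-1.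
  move=> g0; apply: cvgV; first by rewrite mulf_neq0// gt_eqF.
  by apply: cvgM; [exact: cvg_cst|exact: cvg_normRn].
have c2 : longitudinal (b z) (xi z) N / (al * normRn (xi z)) @[z --> F] -->
    longitudinal b0 eta N / (al * normRn eta) by apply: cvgM => //; exact: den.
have c3 : a z N - longitudinal (a z) (xi z) N @[z --> F] --> a0 N - longitudinal a0 eta N.
  exact: cvgB.
have c4 : (b z N - longitudinal (b z) (xi z) N) / (be * normRn (xi z)) @[z --> F] -->
    (b0 N - longitudinal b0 eta N) / (be * normRn eta).
  by apply: cvgM; [exact: cvgB|exact: den].
move/cvgrPdist_le: la => /(_ _ e4) h1; move/cvgrPdist_le: c2 => /(_ _ e4) h2.
move/cvgrPdist_le: c3 => /(_ _ e4) h3; move/cvgrPdist_le: c4 => /(_ _ e4) h4.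
near=> z => s; rewrite distrC; apply: (le_trans (trig_dist _ _ _ _ _ _ _ _ _)).
rewrite (_ : e = e / 4 + e / 4 + e / 4 + e / 4); last by field.
by do 3 ?apply: lerD; near: z.
Unshelve. all: by end_near. Qed.

End wave_trig.

Section wave_lower_bound.
Context {R : realType} (n : nat) (al be : R) (N : 'I_n.+1).
Hypotheses (al0 : 0 < al) (be0 : 0 < be) (albe : al != be).
Local Notation mu := (lebesgueRn R n.+1).
Variables (a b : Rn R n.+1 -> 'I_n.+1 -> R) (eta : Rn R n.+1).
Hypothesis eta0 : 0 < tnth eta ord0 :> R.
Hypothesis mwave : forall t, 0 <= t ->
  measurable_fun setT (fun xi => wave al be t (a xi) (b xi) xi N).

Definition wave_energy (a0 b0 : 'I_n.+1 -> R) (eta : Rn R n.+1) : R :=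
  energy (longitudinal a0 eta N) (longitudinal b0 eta N / (al * normRn eta))
    (a0 N - longitudinal a0 eta N) ((b0 N - longitudinal b0 eta N) / (be * normRn eta)).

(** The undilated case sg = 1 of the cube estimate, with eps small enough for the amplitudes to stay
    within [dl] of their values at eta. *)
Lemma wave_lower_bound : (forall k, a xi k @[xi --> cube_filter eta] --> a eta k) ->
  (forall k, b xi k @[xi --> cube_filter eta] --> b eta k) ->
  0 < wave_energy (a eta) (b eta) eta ->
  exists2 c : R, 0 < c & exists T : R, forall t, T <= t -> 0 <= t ->
    (c%:E <= \int[mu]_xi (wave al be t (a xi) (b xi) xi N ^+ 2)%:E)%E.
Proof.
move=> ca cb E0.
have [dl dl0 [th th0 H]] := cube_perturbed_lower (eta := tnth eta) al0 be0 albe E0 eta0.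
have [e /= e_gt0 He] := cvg_wave_trig N al0 be0 ca cb (@cvg_tnth_cube R n.+1 eta) (normRn_neq0 eta0) dl0.
pose eps := Num.min e (tnth eta ord0 / 2).
have eps0 : 0 < eps by rewrite lt_min e_gt0 divr_gt0.
have [|T0 HT] := H eps; first by rewrite eps0 ge_min lexx orbT.
exists ((2 * (1 * eps)) ^+ n.+1 * th / 1 ^+ 2).
  by rewrite divr_gt0// mulr_gt0// exprn_gt0// mulr_gt0// mulr_gt0.
exists (Num.max T0 1) => t; rewrite ge_max => /andP[Tt t1] t0.
have {}t1 : 0 < t by lra.
apply: le_trans (HT 1 t (fun xi => wave al be t (a xi) (b xi) xi N) ltr01 t1 _ (mwave t0) _) _.
- by rewrite mulr1.
- move=> xi xiC; rewrite mul1r wave_trigE; apply: He => i.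
  have := xiC i; rewrite !mul1r => /le_trans; apply.
  by rewrite ge_min lexx.
apply: ge0_le_integral => //.
- by move=> xi _; rewrite lee_fin mulr_ge0// sqr_ge0.
- apply: measurable_EFin; apply: measurable_funM; last by apply: measurable_funX; exact: mwave.
  by apply: measurable_indic; exact: measurable_cube.
- by apply: measurable_EFin; apply: measurable_funX; exact: mwave.
- move=> xi _; rewrite lee_fin indicE ler_piMl ?sqr_ge0//.
  by case: (_ \in _).
Qed.

End wave_lower_bound.

Lemma dyadic_count {R : realType} (s : R) : 0 < s -> exists2 T : R, 2 <= T & forall t, T <= t ->
  exists2 J : nat, 2 ^+ J <= t * s & ln (t + 2) / 2 <= J%:R.
Proof.
(* J is the integer part of the binary logarithm of the integer part of t s. Then J + 1 >= log t +
   log s and log(t + 2) <= 1 + log t, so the claim holds once log(t + 2) >= 4 - 2 log s. *)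
move=> s0; exists (Num.max (Num.max 2 s^-1) (expR (4 - 2 * ln s))) => [|t].
  by rewrite !le_max lexx.
rewrite !ge_max => /andP[/andP[t2 ts] te].
have t0 : 0 < t by lra.
have X1 : 1 <= t * s by rewrite -(mulVf (lt0r_neq0 s0)) ler_pM2r.
have X0 : 0 < t * s by lra.
have /andP[m1 m2] := truncn_itv (ltW X0).
set m := Num.truncn (t * s) in m1 m2.
have m0 : (0 < m)%N by rewrite /m truncn_gt0.
have /andP[k1 k2] := trunc_log_bounds (ltnSn 1) m0.
set J := trunc_log 2 m in k1 k2.
exists J; first by rewrite -natrX; apply: le_trans m1; rewrite ler_nat.
have XJ : t * s <= 2 ^+ J.+1.
  by rewrite -natrX; apply: (le_trans (ltW m2)); rewrite ler_nat.
have l2 : ln 2 <= 1 :> R by rewrite (_ : 2 = 1 + 1) ?le_ln1Dx//; lra.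
have lX : ln t + ln s <= J.+1%:R.
  rewrite -lnM ?posrE//; apply: (@le_trans _ _ (ln (2 ^+ J.+1))).
    by rewrite ler_ln ?posrE// exprn_gt0.
  by rewrite lnXn// -[leLHS]mulr_natr ler_piMl// ler0n.
have lt2 : ln (t + 2) <= 1 + ln t.
  apply: (@le_trans _ _ (ln (2 * t))); first by rewrite ler_ln ?posrE; lra.
  by rewrite lnM ?posrE//; lra.
have lte : 4 - 2 * ln s <= ln (t + 2).
  by rewrite -[leLHS]expRK ler_ln ?posrE ?expR_gt0//; lra.
rewrite -natr1 in lX; lra.
Qed.

Section planar_wave_lower_bound.
Context {R : realType} (al be : R) (N : 'I_2).
Hypotheses (al0 : 0 < al) (be0 : 0 < be) (albe : al != be).
Local Notation mu := (lebesgueRn R 2).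
Variables (a b : Rn R 2 -> 'I_2 -> R) (eta : Rn R 2) (a0 m : 'I_2 -> R) (L : R).
Hypothesis eta0 : 0 < tnth eta ord0 :> R.
Hypothesis mwave : forall t, 0 <= t ->
  measurable_fun setT (fun xi => wave al be t (a xi) (b xi) xi N).
Hypotheses (aL : forall xi k, `|a xi k - a0 k| <= L * normRn xi)
  (bL : forall xi k, `|b xi k - m k| <= L * normRn xi).

(** A joint limit, as sg tends to 0 from the right and xi to eta: the a amplitudes carry a factor sg
    and vanish, while b at sg xi tends to its value m at the origin. *)
Let frozen (dl : R) : 0 < dl -> exists2 e : R, 0 < e & forall sg xi, 0 < sg < e ->
  cube (tnth eta) e xi -> forall s, `|wave_trig al be N (fun k => sg * a (scaleRn sg xi) k)
    (b (scaleRn sg xi)) xi s - wave_trig al be N (fun=> 0) m eta s| <= dl.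
Proof.
move=> dl0; pose G := filter_prod (0^'+ : set_system R) (cube_filter eta).
have c1 : z.1 @[z --> G] --> (0 : R).
  by apply: cvg_trans; [exact: cvg_fst|exact: cvg_at_right_filter].
have cxi k : (tnth z.2 k : R) @[z --> G] --> (tnth eta k : R).
  apply: (cvg_comp (snd : R * Rn R 2 -> Rn R 2) (fun xi : Rn R 2 => tnth xi k : R) (F := G) (G := cube_filter eta)).
    exact: cvg_snd.
  exact: cvg_tnth_cube.
have pos : \forall z \near G, 0 < z.1.
  by exists ([set x | 0 < x], setT) => /=; [split; [exact: nbhs_right_gt|exact: filterT]|move=> [x y] []].
have squeeze (f g : R * Rn R 2 -> R) l : (\forall z \near G, `|f z - l| <= g z) ->
    g @ G --> (0 : R) -> f @ G --> l.
  move=> fg g0; apply/cvgrPdist_le => e e0; move/cvgrPdist_le: g0 => /(_ e e0).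
  apply: filterS2 fg => z fz; rewrite sub0r normrN distrC => /(le_trans (ler_norm _)).
  exact: le_trans.
pose rho (z : R * Rn R 2) := z.1 * normRn z.2.
have crho : rho @ G --> (0 : R).
  by rewrite -(mul0r (normRn eta)); apply: cvgM => //; exact: cvg_normRn.
have rhoE : \forall z \near G, normRn (scaleRn z.1 z.2) = rho z.
  by apply: filterS pos => z z0; rewrite normRn_scale// ltW.
have cb k : b (scaleRn z.1 z.2) k @[z --> G] --> m k.
  apply: (squeeze _ (fun z => L * rho z)).
    by apply: filterS rhoE => z <-; exact: bL.
  by rewrite -(mulr0 L); apply: cvgM => //; exact: cvg_cst.
have ca k : z.1 * a (scaleRn z.1 z.2) k @[z --> G] --> (0 : R).
  apply: (squeeze _ (fun z => z.1 * (`|a0 k| + L * rho z))).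
    apply: filterS2 pos rhoE => z z0 <-; rewrite subr0 normrM gtr0_norm// ler_pM2l//.
    by rewrite -lerBlDl; apply: (le_trans (lerB_dist _ _)); exact: aL.
  rewrite -(mul0r (`|a0 k| + L * 0)); apply: cvgM => //.
  by apply: cvgD; [exact: cvg_cst|apply: cvgM => //; exact: cvg_cst].
have [[P Q] /= [[e1 /= e10 P1] [e2 /= e20 Q2]] PQ] := cvg_wave_trig N al0 be0 ca cb cxi (normRn_neq0 eta0) dl0.
exists (Num.min e1 e2); first by rewrite lt_min e10.
move=> sg xi /andP[sg0]; rewrite lt_min => /andP[sg1 _] xiC; apply: (PQ (sg, xi)); split => /=.
  by apply: P1 => //=; rewrite sub0r normrN gtr0_norm.
by apply: Q2 => i; apply: (le_trans (xiC i)); rewrite ge_min lexx orbT.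
Qed.

(** Dyadic copies of one cube are disjoint, and in the plane the area sg^2 of a copy cancels the 1 /
    sg^2 of the squared singularity, so all copies contribute the same [c0]. The condition T0 <= t
    sg admits about log t of them. *)
Lemma planar_wave_lower_bound : 0 < wave_energy al be N (fun=> 0) m eta ->
  exists2 c : R, 0 < c & exists T : R, forall t, T <= t -> 0 <= t ->
    ((c * ln (t + 2))%:E <= \int[mu]_xi (wave al be t (a xi) (b xi) xi N ^+ 2)%:E)%E.
Proof.
move=> E0; have [dl dl0 [th th0 H]] := cube_perturbed_lower (eta := tnth eta) al0 be0 albe E0 eta0.
have [e e0 He] := frozen dl0.
(* With eps <= h / 4, a cube of at most half the scale has first coordinates at most (5/8) sg h,
   below the minimum (3/4) sg h of the larger cube. *)
pose h := tnth eta ord0 : R; pose eps := Num.min e (h / 4).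
have h0 : 0 < h by [].
have eps0 : 0 < eps by rewrite lt_min e0 divr_gt0.
have epse : eps <= e by rewrite ge_min lexx.
have epsh : eps <= h / 4 by rewrite ge_min lexx orbT.
have [|T0 HT] := H eps; first by rewrite eps0 -/h; lra.
pose T1 := Num.max T0 1; have T10 : 0 < T1 by rewrite lt_max ltr01 orbT.
pose s0 := e / 2; have s00 : 0 < s0 by rewrite divr_gt0.
pose sg (j : nat) := s0 / 2 ^+ j.
have p2 j : 0 < 2 ^+ j :> R by exact: exprn_gt0.
have sg0 j : 0 < sg j by rewrite divr_gt0.
have sge j : 0 < sg j < e.
  rewrite sg0/= ltr_pdivrMr//; apply: (@lt_le_trans _ _ e); first by rewrite /s0; lra.
  by rewrite ler_peMr ?(ltW e0)// exprn_ege1//; lra.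
have [T T2 HJ] := dyadic_count (divr_gt0 s00 T10).
pose c0 := 4 * eps ^+ 2 * th; have c00 : 0 < c0 by rewrite mulr_gt0// mulr_gt0// exprn_gt0.
exists (c0 / 2); first by rewrite divr_gt0.
exists T => t Tt t0; have [J J1 J2] := HJ t Tt.
have {}t0 : 0 < t by lra.
pose w xi := wave al be t (a xi) (b xi) xi N.
have mw : measurable_fun setT w by apply: mwave; exact: ltW.
pose C j := cube (fun i => sg j * tnth eta i) (sg j * eps) : set (Rn R 2).
have mC j : measurable (C j) by exact: measurable_cube.
have mCw j : measurable_fun setT (fun xi => \1_(C j) xi * w xi ^+ 2).
  by apply: measurable_funM; [exact: measurable_indic|exact: measurable_funX].
have low (j : 'I_J) : (c0%:E <= \int[mu]_xi (\1_(C j) xi * w xi ^+ 2)%:E)%E.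
  have -> : c0 = (2 * (sg j * eps)) ^+ 2 * th / sg j ^+ 2.
    by rewrite /c0; have := sg0 j; move: (sg j) => x x0; field; rewrite gt_eqF.
  apply: (HT (sg j) t w) => //.
    apply: (@le_trans _ _ T1); first by rewrite le_max lexx.
    have : 2 ^+ j <= t * (s0 / T1).
      by apply: le_trans J1; apply: ler_weXn2l; [lra|exact: ltnW].
    by rewrite /sg !mulrA !ler_pdivlMr// (mulrC T1).
  (* The point is pulled back to the fixed cube around eta, where [frozen] applies uniformly in
     j. *)
  move=> xi xiC; pose xi' := scaleRn (sg j)^-1 xi.
  have xiE : xi = scaleRn (sg j) xi'.
    by apply: eq_from_tnth => i; rewrite !tnth_mktuple mulrA mulfV ?gt_eqF// mul1r.
  have xiC' : cube (tnth eta) e xi'.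
    move=> i; apply: le_trans epse; rewrite -(ler_pM2l (sg0 j)); apply: le_trans (xiC i).
    rewrite -{1}(gtr0_norm (sg0 j)) -normrM mulrBr tnth_mktuple mulrA mulfV ?gt_eqF// mul1r//.
  by have := He (sg j) xi' (sge j) xiC' (t * normRn xi); rewrite /w xiE wave_scale.
have -> : c0 / 2 * ln (t + 2) = c0 * (ln (t + 2) / 2) by rewrite mulrAC mulrA.
apply: (@le_trans _ _ (\sum_(j < J) c0%:E)%E).
  by rewrite sumEFin lee_fin sumr_const card_ord -[leRHS]mulr_natr ler_pM2l.
apply: (le_trans (lee_sum _ (fun j _ => low j))).
rewrite -integral_sum_EFin//; last by move=> j xi; rewrite mulr_ge0// sqr_ge0.
apply: ge0_le_integral => //.
- by move=> xi _; rewrite lee_fin sumr_ge0// => j _; rewrite mulr_ge0// sqr_ge0.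
- by apply: measurable_EFin; exact: measurable_sum.
- by apply: measurable_EFin; exact: measurable_funX.
move=> xi _; rewrite lee_fin -mulr_suml ler_piMl ?sqr_ge0//.
have [j0 xij0|no] := pickP (fun j : 'I_J => xi \in C j); last first.
  by rewrite big1// => j _; rewrite indicE no.
have disj (i j : nat) : (i < j)%N -> xi \in C i -> xi \in C j -> False.
  move=> ij; rewrite !inE => /(_ ord0) Ci /(_ ord0) Cj.
  have sij : sg j <= sg i / 2.
    rewrite /sg -mulrA -invfM ler_pM2l// lef_pV2 ?posrE ?mulr_gt0//.
    by rewrite -exprSr ler_weXn2l//; lra.
  move: Ci Cj; rewrite -/h !ler_distl => /andP[+ _] /andP[_ +].
  move=> i1 j2; have hh : sg i * h - sg i * eps <= sg j * h + sg j * eps by lra.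
  have : sg i * (h - eps) <= (sg i / 2) * (h + eps).
    rewrite mulrBr; apply: (le_trans hh); rewrite -mulrDr ler_wpM2r// addr_ge0// ltW//.
  have := sg0 i; nra.
rewrite (bigD1 j0)//= big1 ?addr0; first by rewrite indicE xij0.
move=> j jj0; rewrite indicE; case: (boolP (xi \in C j)) => // xij.
have : (j < j0)%N || (j0 < j)%N by rewrite -neq_ltn.
by case/orP => /disj; [move=> /(_ xij xij0)|move=> /(_ xij0 xij)].
Qed.

End planar_wave_lower_bound.

(** * First moments as linear and quadratic forms *)

Section linear_combinations.
Context d {T : measurableType d} {R : realType} (mu : {measure set T -> \bar R}).
Variables (I : finType) (c : I -> R) (g : I -> T -> R).
Hypothesis gi : forall i, mu.-integrable setT (EFin \o g i).

Let integrable_term i : mu.-integrable setT (fun x => (c i * g i x)%:E).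
Proof. exact: (integrableZl measurableT (c i) (gi i)). Qed.

Lemma integrable_lincomb :
  mu.-integrable setT (EFin \o (fun x => \sum_i c i * g i x)).
Proof.
have H := @integrable_sum _ _ _ mu _ measurableT _ (index_enum I) xpredT _
  (fun i _ => integrable_term i).
by apply: eq_integrable H => // x _; rewrite /= -sumEFin.
Qed.

Lemma Rintegral_lincomb :
  \int[mu]_x (\sum_i c i * g i x) = \sum_i c i * \int[mu]_x g i x.
Proof.
rewrite /Rintegral; under eq_integral do rewrite -sumEFin.
rewrite integral_sum//.
rewrite (eq_bigr (fun i => (c i * fine (\int[mu]_x (g i x)%:E))%:E)); first by rewrite sumEFin.
move=> i _; rewrite EFinM fineK; last exact: (integrable_fin_num measurableT (gi i)).
under eq_integral do rewrite EFinM.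
exact: integralZl (gi i) _.
Qed.

End linear_combinations.

Section forms.
Context {R : realType} (I : finType).

Lemma sum_delta (F : I -> R) k : \sum_i (i == k)%:R * F i = F k.
Proof.
by rewrite (bigD1 k)//= eqxx mul1r big1 ?addr0// => i /negbTE ->; rewrite mul0r.
Qed.

(** The vector with all entries 1 and its sum with a basis vector are both positive; their
    difference isolates a coefficient. *)
Lemma linear_form_eq0 (p : I -> R) :
  (forall eta : I -> R, (forall i, 0 < eta i) -> \sum_i eta i * p i = 0) ->
  forall k, p k = 0.
Proof.
move=> p0 k; rewrite -(sum_delta p k).
have h1 := p0 (fun=> 1) (fun=> ltr01).
have h2 : \sum_i (1 + (i == k)%:R) * p i = 0 by apply: p0 => i; rewrite ltr_pwDl.
move: h2; under eq_bigr do rewrite mulrDl.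
by rewrite big_split/= h1 add0r.
Qed.

(* The second difference of the quadratic form at the vector [1,...,1]. *)
Lemma quadratic_form_eq0 (p : I -> I -> R) :
  (forall eta : I -> R, (forall i, 0 < eta i) ->
     \sum_i \sum_j eta i * (eta j * p i j) = 0) ->
  forall k l, p k l + p l k = 0.
Proof.
move=> p0 k l.
pose y i : R := (i == k)%:R; pose z i : R := (i == l)%:R.
have y0 i : 0 <= y i by rewrite /y. have z0 i : 0 <= z i by rewrite /z.
have h0 := p0 (fun=> 1) (fun=> ltr01).
have hy := p0 (fun i => 1 + y i) (fun i => ltr_pwDl ltr01 (y0 i)).
have hz := p0 (fun i => 1 + z i) (fun i => ltr_pwDl ltr01 (z0 i)).
have hyz := p0 (fun i => 1 + (y i + z i)) (fun i => ltr_pwDl ltr01 (addr_ge0 (y0 i) (z0 i))).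
have <- : \sum_i \sum_j (y i * (z j * p i j)) = p k l.
  by under eq_bigr do rewrite -mulr_sumr sum_delta; rewrite sum_delta.
have <- : \sum_i \sum_j (z i * (y j * p i j)) = p l k.
  by under eq_bigr do rewrite -mulr_sumr sum_delta; rewrite sum_delta.
transitivity (\sum_i \sum_j ((1 + (y i + z i)) * ((1 + (y j + z j)) * p i j) -
  (1 + y i) * ((1 + y j) * p i j) - (1 + z i) * ((1 + z j) * p i j) + 1 * (1 * p i j))).
  rewrite -big_split; apply: eq_bigr => i _; rewrite -big_split; apply: eq_bigr => j _ /=; ring.
under eq_bigr do rewrite !big_split !sumrN.
by rewrite !big_split !sumrN hyz hy hz h0/= !subr0 addr0.
Qed.

End forms.

Section vanishing_moments.
Context {R : realType} (n : nat).
Local Notation mu := (lebesgueRn R n.+1).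
Implicit Types (f : 'I_n.+1 -> Rn R n.+1 -> R).

Lemma isL11_lincomb f (c : 'I_n.+1 -> R) : (forall k, isL11 (f k)) ->
  isL11 (fun x => \sum_k c k * f k x).
Proof.
move=> hf; split; apply/Lfun1_integrable.
  by apply: integrable_lincomb => k; exact: isL11_integrable.
have H := integrable_lincomb c (fun k => isL11_integrable1 (hf k)).
apply: eq_integrable H => // x _ /=.
by rewrite mulr_sumr; congr EFin; apply: eq_bigr => k _; rewrite mulrCA.
Qed.

Lemma sin_transform_lincomb f (c : 'I_n.+1 -> R) xi : (forall k, isL11 (f k)) ->
  sin_transform (fun x => \sum_k c k * f k x) xi = \sum_k c k * sin_transform (f k) xi.
Proof.
move=> hf; rewrite /sin_transform -Rintegral_lincomb; last first.
  by move=> k; exact: integrable_sin_dot (isL11_integrable (hf k)).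
apply: eq_Rintegral => x _; rewrite mulr_sumr.
by apply: eq_bigr => k _; rewrite mulrCA.
Qed.

Lemma Rintegral_dotM f (g : Rn R n.+1 -> R) eta : isL11 g ->
  \int[mu]_x (dotRn x eta * g x) = \sum_l tnth eta l * \int[mu]_x (tnth x l * g x).
Proof.
move=> hg.
have ig l : mu.-integrable setT (EFin \o (fun x => tnth x l * g x)).
  have := integrable_dotM [tuple (i == l)%:R | i < n.+1] hg.
  apply: eq_integrable => // x _ /=; congr (_ * _)%:E.
  by rewrite /dotRn -[RHS](sum_delta (fun i => tnth x i : R)); apply: eq_bigr => i _; rewrite tnth_mktuple mulrC.
rewrite -Rintegral_lincomb//; apply: eq_Rintegral => x _.
by rewrite /dotRn mulr_suml; apply: eq_bigr => l _; rewrite (mulrC (tnth x l : R)) mulrA.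
Qed.

(** The projection on coordinate N carries the factor xi_N / |xi|, which positivity of the
    coordinates allows to cancel. *)
Lemma longitudinal_eq0 (c : 'I_n.+1 -> R) (xi : Rn R n.+1) N : (forall i, 0 < tnth xi i :> R) ->
  longitudinal c xi N = 0 -> \sum_k tnth xi k * c k = 0.
Proof.
move=> xi0; have r0 : 0 < normRn xi by apply: lt_le_trans (norm_tnth_le xi ord0); rewrite gtr0_norm.
rewrite /longitudinal; under eq_bigr do rewrite -mulrA; rewrite -mulr_sumr => /eqP.
have c1 : tnth xi N / normRn xi != 0 by rewrite gt_eqF// divr_gt0.
rewrite mulf_eq0 (negbTE c1)/= => /eqP E; apply/eqP.
rewrite -(inj_eq (mulfI (lt0r_neq0 (divr_gt0 ltr01 r0)))) mulr0 -[eqbRHS]E mulr_sumr.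
by apply/eqP/eq_bigr => k _; rewrite div1r mulrCA mulrA.
Qed.

(** Along the ray of a positive vector eta, the derivative at 0 of the sine transform of f_N is a
    linear form in eta with coefficients the first moments of f_N. The vanishing projection says the
    same of the combination of the f_k with weights eta_k, which gives a quadratic form in eta; only
    its symmetrised coefficients are determined. *)
Lemma moment_forms_eq0 f (N : 'I_n.+1) : (forall k, isL11 (f k)) ->
  (forall xi, 0 < tnth xi ord0 :> R ->
     longitudinal (fun k => sin_transform (f k) xi) xi N = 0 /\ sin_transform (f N) xi = 0) ->
  (forall l, moment1 f N l = 0) /\ (forall k l, moment1 f k l + moment1 f l k = 0).
Proof.
move=> hf S0.
pose T (eta : 'I_n.+1 -> R) : Rn R n.+1 := [tuple eta i | i < n.+1].
have TE eta i : tnth (T eta) i = eta i by rewrite tnth_mktuple.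
have pos eta (s : R) i : (forall i, 0 < eta i) -> 0 < s -> 0 < tnth (scaleRn s (T eta)) i :> R.
  by move=> eta0 s0; rewrite !tnth_mktuple mulr_gt0.
split.
  apply: linear_form_eq0 => eta eta0.
  have H := sin_transform_ray0 (hf N) (fun s s0 => (S0 _ (pos eta s ord0 eta0 s0)).2).
  rewrite Rintegral_dotM// in H.
  under eq_bigr do rewrite /moment1 mulrN; rewrite sumrN -[RHS]oppr0 -[in RHS]H; congr (- _).
  by apply: eq_bigr => l _; rewrite TE.
apply: quadratic_form_eq0 => eta eta0.
pose F x := \sum_k eta k * f k x.
have hF : isL11 F by exact: isL11_lincomb.
have ray (s : R) : 0 < s -> sin_transform F (scaleRn s (T eta)) = 0.
  move=> s0; rewrite sin_transform_lincomb//; set xi := scaleRn _ _.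
  have xi0 i : 0 < tnth xi i :> R by exact: pos.
  have := longitudinal_eq0 xi0 (S0 xi (xi0 ord0)).1.
  under eq_bigr do rewrite tnth_mktuple TE -mulrA.
  by rewrite -mulr_sumr => /eqP; rewrite mulf_eq0 gt_eqF//= => /eqP.
have := sin_transform_ray0 hF ray.
have dF x : dotRn x (T eta) * F x = \sum_k eta k * (dotRn x (T eta) * f k x).
  by rewrite mulr_sumr; apply: eq_bigr => k _; rewrite mulrCA.
under eq_Rintegral do rewrite dF.
rewrite Rintegral_lincomb; last by move=> k; exact: integrable_dotM.
move=> H; rewrite -[RHS]oppr0 -[in RHS]H -sumrN; apply: eq_bigr => k _.
rewrite Rintegral_dotM// mulr_sumr -sumrN; apply: eq_bigr => l _.
by rewrite TE /moment1 !mulrN.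
Qed.

Lemma absPN_eq0 f (N : 'I_n.+1) : (forall k, isL11 (f k)) ->
  (forall xi, 0 < tnth xi ord0 :> R ->
     longitudinal (fun k => sin_transform (f k) xi) xi N = 0 /\ sin_transform (f N) xi = 0) ->
  absPN f N = 0.
Proof.
move=> hf S0; have [PN PP] := moment_forms_eq0 hf S0.
rewrite /absPN /absP !big1 ?addr0//.
- by move=> k _; rewrite big1// => l _; rewrite PP normr0.
- move=> k _; apply/eqP; rewrite normr_eq0; have := PP k k.
  by rewrite -mulr2n => /eqP; rewrite mulrn_eq0.
(* The moments of f_k in direction N are opposite to those of f_N in direction k, which are already
   0. *)
- by move=> k _; have := PP k N; rewrite PN addr0 => ->; rewrite normr0.
- by move=> l _; rewrite PN normr0.
Qed.

End vanishing_moments.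

(** In dimension 2, indices k and l both different from N coincide, so each first moment occurs in
    one of the first three sums of [absPN]. *)
Lemma absP_planar_eq0 {R : realType} (f : 'I_2 -> Rn R 2 -> R) N :
  absPN f N = 0 -> \sum_k absP f k = 0.
Proof.
have n0 (I : finType) (P : pred I) (g : I -> R) : 0 <= \sum_(i | P i) `|g i| by exact: sumr_ge0.
have d0 : 0 <= \sum_(k < 2) \sum_(l < 2 | [&& (k < l)%N, k != N & l != N]) `|moment1 f k l + moment1 f l k|.
  by apply: sumr_ge0 => k _; exact: sumr_ge0.
rewrite /absPN => /eqP; rewrite !paddr_eq0 ?addr_ge0//; try exact: n0.
move=> /andP[/andP[/andP[h1 h2] h3] _].
have z (g : 'I_2 -> R) : \sum_k `|g k| == 0 -> forall k, g k = 0.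
  by move=> /eqP/psumr_eq0P H k; apply/eqP; rewrite -normr_eq0 H.
have p1 := z _ h1; have p2 := z _ h2; have p3 := z _ h3.
rewrite big1// => k _; rewrite /absP big1// => l _; apply/eqP; rewrite normr_eq0; apply/eqP.
have [->|kN] := eqVneq k N; first exact: p1.
have [->|lN] := eqVneq l N; first exact: p2.
suff -> : k = l by exact: p3.
apply: val_inj; move: kN lN (ltn_ord k) (ltn_ord l) (ltn_ord N).
rewrite -!(inj_eq val_inj) /=.
by move: (nat_of_ord k) (nat_of_ord l) (nat_of_ord N) => [|[|a]] [|[|b]] [|[|c]].
Qed.

Lemma wave_speeds_neq {R : realType} (lambda mu : R) : 0 < lambda + 2 * mu -> 0 < mu ->
  lambda + mu <> 0 -> Num.sqrt (lambda + 2 * mu) != Num.sqrt mu.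
Proof.
move=> hl hm hne; apply/eqP => E; apply: hne.
have : Num.sqrt (lambda + 2 * mu) ^+ 2 = Num.sqrt mu ^+ 2 by rewrite E.
by rewrite !sqr_sqrtr ?ltW//; lra.
Qed.

(** * From positive energy to lower bounds for the solution *)

Section lower_bounds.
Context {R : realType} (n : nat).
Local Notation mu := (lebesgueRn R n.+1).
Implicit Types (a b : 'I_n.+1 -> R) (N : 'I_n.+1).

Lemma wave_energy_eq0 (al be : R) N a b (eta : Rn R n.+1) : 0 < al -> 0 < be ->
  normRn eta != 0 -> ~~ (0 < wave_energy al be N a b eta) ->
  [/\ longitudinal a eta N = 0, longitudinal b eta N = 0, a N = 0 & b N = 0].
Proof.
move=> al0 be0 r0; rewrite -leNgt /wave_energy /energy => H.
have d1 : al * normRn eta != 0 by rewrite mulf_neq0// gt_eqF.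
have d2 : be * normRn eta != 0 by rewrite mulf_neq0// gt_eqF.
move: H; rewrite pmulr_lle0 ?invr_gt0// => H.
have sq0 (x y z w : R) : x ^+ 2 + y ^+ 2 + (z ^+ 2 + w ^+ 2) <= 0 -> [/\ x = 0, y = 0, z = 0 & w = 0].
  move=> h; have := sqr_ge0 x; have := sqr_ge0 y; have := sqr_ge0 z; have := sqr_ge0 w => hw hz hy hx.
  by split; apply/eqP; rewrite -sqrf_eq0 eq_le ?sqr_ge0 andbT; lra.
have [h1 h2 h3 h4] := sq0 _ _ _ _ H.
have h2' : longitudinal b eta N = 0.
  by apply/eqP; move/eqP: h2; rewrite mulf_eq0 invr_eq0 (negbTE d1) orbF.
split => //; first by rewrite h1 subr0 in h3.
by apply/eqP; move/eqP: h4; rewrite h2' subr0 mulf_eq0 invr_eq0 (negbTE d2) orbF.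
Qed.

Lemma longitudinalN a (eta : Rn R n.+1) N :
  longitudinal (fun k => - a k) eta N = - longitudinal a eta N.
Proof. by rewrite /longitudinal -sumrN; apply: eq_bigr => l _; rewrite mulrN. Qed.

(** The frequency is sought in a half space because the cube estimates need the radius to increase
    along the first axis. Zero energy throughout the half space would annihilate both moment
    quantities. *)
Lemma exists_wave_energy (al be : R) (f0 f1 : 'I_n.+1 -> Rn R n.+1 -> R) N :
  0 < al -> 0 < be ->
  (forall k, isL11 (f0 k)) -> (forall k, isL11 (f1 k)) ->
  absPN f0 N <> 0 \/ absPN f1 N <> 0 ->
  exists2 eta : Rn R n.+1, 0 < tnth eta ord0 :> R &
    0 < wave_energy al be N (fun k => - sin_transform (f0 k) eta)
          (fun k => - sin_transform (f1 k) eta) eta.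
Proof.
move=> al0 be0 hf0 hf1 HP; apply: contrapT => no.
have Z (eta : Rn R n.+1) : 0 < tnth eta ord0 :> R ->
  [/\ longitudinal (fun k => sin_transform (f0 k) eta) eta N = 0,
      longitudinal (fun k => sin_transform (f1 k) eta) eta N = 0,
      sin_transform (f0 N) eta = 0 & sin_transform (f1 N) eta = 0].
  move=> eta0; have E0 : ~~ (0 < wave_energy al be N (fun k => - sin_transform (f0 k) eta)
      (fun k => - sin_transform (f1 k) eta) eta).
    by apply/negP => E; apply: no; exists eta.
  have [] := wave_energy_eq0 al0 be0 (normRn_neq0 eta0) E0; rewrite !longitudinalN.
  have opp (x : R) : - x = 0 -> x = 0 by move=> /eqP; rewrite oppr_eq0 => /eqP.
  by move=> /opp -> /opp -> /opp -> /opp ->.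
by case: HP; apply; apply: absPN_eq0 => // xi /Z[].
Qed.

(** Zero energy at every positive vector would make the linear form with coefficients m vanish on
    all of them. *)
Lemma exists_moment_energy (al be : R) N (m : 'I_n.+1 -> R) : 0 < al -> 0 < be ->
  (exists k, m k != 0) ->
  exists2 eta : Rn R n.+1, 0 < tnth eta ord0 :> R &
    0 < wave_energy al be N (fun=> 0) m eta.
Proof.
move=> al0 be0 [k mk]; apply: contrapT => no.
suff m0 : forall k, m k = 0 by rewrite m0 eqxx in mk.
apply: linear_form_eq0 => eta eta0.
pose xi : Rn R n.+1 := [tuple eta i | i < n.+1].
have xi0 i : 0 < tnth xi i :> R by rewrite tnth_mktuple.
have E0 : ~~ (0 < wave_energy al be N (fun=> 0) m xi) by apply/negP => E; apply: no; exists xi.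
have [_ H _ _] := wave_energy_eq0 al0 be0 (normRn_neq0 (xi0 ord0)) E0.
by have := longitudinal_eq0 xi0 H; under eq_bigr do rewrite tnth_mktuple.
Qed.

Lemma normL2_ge_of_sqr_modulus (v : Rn R n.+1 -> R) g (c : R) : is_fourierL2 v g -> 0 <= c ->
  (c%:E <= \int[mu]_xi (sqr_modulus g xi)%:E)%E ->
  Num.sqrt (c / (2 * (2 * pi) ^+ n.+1)) <= normL2 v.
Proof.
move=> vg c0 /le_trans/(_ (fourierL2_le vg)).
have v2 : isL2 v by case: vg.
have C0 : 0 < (2 * pi) ^+ n.+1 :> R by rewrite exprn_gt0// mulr_gt0// pi_gt0.
rewrite -normL2_sqr// -EFinM lee_fin => H.
have N0 := normL2_ge0 v.
rewrite -[leRHS]ger0_norm// -sqrtr_sqr; apply: ler_wsqrtr.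
by rewrite ler_pdivrMr ?mulr_gt0// mulrC.
Qed.

Variables (lambda mu0 : R) (f0 f1 : 'I_n.+1 -> Rn R n.+1 -> R) (N : 'I_n.+1).
Variable (u : R -> 'I_n.+1 -> Rn R n.+1 -> R).
Hypotheses (hlm : 0 < lambda + 2 * mu0) (hmu : 0 < mu0) (hne : lambda + mu0 <> 0).
Hypotheses (hf0 : forall k, isL11 (f0 k)) (hf1 : forall k, isL11 (f1 k)).
Hypothesis hu : elastic_solution lambda mu0 f0 f1 u.
Let al := Num.sqrt (lambda + 2 * mu0).
Let be := Num.sqrt mu0.

Let al0 : 0 < al. Proof. by rewrite sqrtr_gt0. Qed.
Let be0 : 0 < be. Proof. by rewrite sqrtr_gt0. Qed.

Let albe : al != be. Proof. exact: wave_speeds_neq. Qed.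

(** Only the imaginary part of [uhat] is kept, since the hypothesis on first moments concerns sine
    transforms. *)
Lemma elastic_lower_bound : absPN f0 N <> 0 \/ absPN f1 N <> 0 ->
  exists2 c : R, 0 < c & exists T : R, forall t, T <= t -> 0 <= t -> c <= normL2 (u t N).
Proof.
move=> HP; have [eta eta0 E0] := exists_wave_energy al0 be0 hf0 hf1 HP.
have mw t : 0 <= t -> measurable_fun setT (fun xi => wave al be t
    (fun k => - sin_transform (f0 k) xi) (fun k => - sin_transform (f1 k) xi) xi N).
  move=> t0; have [_ _ /isL2_measurable + _] := hu t0 N; congr measurable_fun.
  by apply/funext => xi; rewrite Im_uhat.
have cv f : (forall k, isL11 (f k)) -> forall k : 'I_n.+1,
    - sin_transform (f k) xi @[xi --> cube_filter eta] --> - sin_transform (f k) eta.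
  move=> hf k; apply: cvgN; apply: (cvg_lipschitz_cube (L := normL11 (f k))) => xi.
  exact: sin_transform_lipschitz.
have [c c0 [T HT]] := wave_lower_bound al0 be0 albe eta0 mw (cv f0 hf0) (cv f1 hf1) E0.
exists (Num.sqrt (c / (2 * (2 * pi) ^+ n.+1))).
  by rewrite sqrtr_gt0 divr_gt0// mulr_gt0// exprn_gt0// mulr_gt0// pi_gt0.
exists T => t Tt t0; have ut := hu t0 N.
apply: (normL2_ge_of_sqr_modulus ut (ltW c0)); apply: (le_trans (HT t Tt t0)).
apply: ge0_le_integral => //.
- by move=> xi _; rewrite lee_fin sqr_ge0.
- by apply: measurable_EFin; apply: measurable_funX; exact: mw.
- by apply: measurable_EFin; exact: measurable_sqr_modulus ut.
- by move=> xi _; rewrite lee_fin /sqr_modulus Im_uhat lerDr sqr_ge0.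
Qed.

End lower_bounds.

(** Only the real part of [uhat] is kept: the cosine transform of f_1 at the origin is the total
    moment, which produces the singularity 1 / |xi|. *)
Lemma planar_log_lower_bound (R : realType) (lambda mu0 : R) (f0 f1 : 'I_2 -> Rn R 2 -> R)
    (N : 'I_2) (u : R -> 'I_2 -> Rn R 2 -> R) :
  0 < lambda + 2 * mu0 -> 0 < mu0 -> lambda + mu0 <> 0 ->
  (forall k, isL11 (f0 k)) -> (forall k, isL11 (f1 k)) ->
  elastic_solution lambda mu0 f0 f1 u -> absM f1 <> 0 ->
  exists2 c : R, 0 < c & exists T : R, forall t, T <= t -> 0 <= t ->
    c * Num.sqrt (ln (t + 2)) <= normL2 (u t N).
Proof.
move=> hlm hmu hne hf0 hf1 hu M1.
have al0 : 0 < Num.sqrt (lambda + 2 * mu0) by rewrite sqrtr_gt0.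
have be0 : 0 < Num.sqrt mu0 by rewrite sqrtr_gt0.
have albe := wave_speeds_neq hlm hmu hne.
have mne : exists k, moment f1 k != 0.
  apply: contrapT => no; apply: M1; rewrite /absM big1// => k _.
  apply/eqP; rewrite normr_eq0; apply/negP => /negP mk; apply: no; by exists k.
have [eta eta0 E0] := exists_moment_energy N al0 be0 mne.
have mw t : 0 <= t -> measurable_fun setT (fun xi => wave (Num.sqrt (lambda + 2 * mu0)) (Num.sqrt mu0) t
    (fun k => cos_transform (f0 k) xi) (fun k => cos_transform (f1 k) xi) xi N).
  move=> t0; have [_ /isL2_measurable + _ _] := hu t t0 N; congr measurable_fun.
  by apply/funext => xi; rewrite Re_uhat.
(* The factor 2 is the dimension, lost in bounding the l^1 norm of xi by its Euclidean norm; one L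
   serves both data. *)
pose L := 2 * (vnorm11 f0 + vnorm11 f1).
have v0 (f : 'I_2 -> Rn R 2 -> R) k : 0 <= vnorm11 f /\ normL11 (f k) <= vnorm11 f.
  split; first by apply: sumr_ge0 => i _; exact: normL11_ge0.
  by rewrite /vnorm11 (bigD1 k)//= lerDl; apply: sumr_ge0 => i _; exact: normL11_ge0.
have lip (f : 'I_2 -> Rn R 2 -> R) (c : R) : (forall k, isL11 (f k)) -> (forall k, normL11 (f k) <= c) -> 2 * c <= L ->
    forall xi k, `|cos_transform (f k) xi - moment f k| <= L * normRn xi.
  move=> hf fc cL xi k; have := cos_transform_lipschitz xi (zeroRn 2) (hf k).
  rewrite cos_transform0 => /le_trans; apply.
  apply: (le_trans (ler_wpM2l (normL11_ge0 (f k)) (dist1_0 xi))).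
  rewrite mulrA ler_wpM2r ?normRn_ge0//; apply: le_trans cL.
  by have := fc k; lra.
have [V0 _] := v0 f0 N; have [V1 _] := v0 f1 N.
have l0 : 2 * vnorm11 f0 <= L by rewrite /L; lra.
have l1 : 2 * vnorm11 f1 <= L by rewrite /L; lra.
have [c c0 [T HT]] := planar_wave_lower_bound al0 be0 albe eta0 mw
  (lip f0 _ hf0 (fun k => (v0 f0 k).2) l0) (lip f1 _ hf1 (fun k => (v0 f1 k).2) l1) E0.
have D0 : 0 < 2 * (2 * pi) ^+ 2 :> R by rewrite mulr_gt0// exprn_gt0// mulr_gt0// pi_gt0.
exists (Num.sqrt (c / (2 * (2 * pi) ^+ 2))); first by rewrite sqrtr_gt0 divr_gt0.
exists T => t Tt t0; have ut := hu t t0 N.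
have lnt : 0 <= ln (t + 2) by rewrite ln_ge0//; lra.
rewrite -sqrtrM; last by apply: divr_ge0; exact: ltW.
rewrite mulrAC.
apply: (normL2_ge_of_sqr_modulus ut); first by rewrite mulr_ge0// ltW.
apply: (le_trans (HT t Tt t0)); apply: ge0_le_integral => //.
- by move=> xi _; rewrite lee_fin sqr_ge0.
- by apply: measurable_EFin; apply: measurable_funX; exact: mw.
- by apply: measurable_EFin; exact: measurable_sqr_modulus ut.
- by move=> xi _; rewrite lee_fin /sqr_modulus Re_uhat lerDl sqr_ge0.
Qed.

Theorem theorem1p4 (R : realType) (n : nat) (hn : (2 <= n)%N)
  (lambda mu : R) (hlm : 0 < lambda + 2 * mu) (hmu : 0 < mu) (N : 'I_n)
  (f0 f1 : 'I_n -> Rn R n -> R)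
  (hf0 : forall k, isH1 (f0 k) /\ isL11 (f0 k))
  (hf1 : forall k, isL2 (f1 k) /\ isL11 (f1 k))
  (u : R -> 'I_n -> Rn R n -> R) (hu : elastic_solution lambda mu f0 f1 u) :
  (n = 2%N ->
    exists2 C : R, 0 < C & forall t, 0 <= t ->
      normL2 (u t N) <=
        C * (vnorm2 f0 + absM f1 * Num.sqrt (ln (t + 2)) + vnorm11 f1)) /\
  (lambda + mu <> 0 ->
    (n = 2%N ->
      \sum_(k < n) absP f0 k + \sum_(k < n) absP f1 k <> 0 ->
      exists2 C : R, 0 < C & exists T : R, forall t, T <= t -> 0 <= t ->
        C * (absM f0 + absM f1 * Num.sqrt (ln (t + 2)) +
             (\sum_(k < n) absP f0 k + \sum_(k < n) absP f1 k))
          <= normL2 (u t N)) /\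
    ((3 <= n)%N ->
      absPN f0 N <> 0 \/ absPN f1 N <> 0 ->
      exists2 C : R, 0 < C & exists T : R, forall t, T <= t -> 0 <= t ->
        C * (absM f0 + absM f1 + absPN f0 N + absPN f1 N)
          <= normL2 (u t N))).
Proof.
(* As C may depend on the data, a positive lower bound dominates any fixed number W; dividing by |W|
   + 1 covers W = 0. *)
have cst_bound (W : R) (v : R -> R) : (exists2 c : R, 0 < c & exists T : R, forall t, T <= t -> 0 <= t -> c <= v t) ->
    exists2 C : R, 0 < C & exists T : R, forall t, T <= t -> 0 <= t -> C * W <= v t.
  move=> [c c0 [T HT]]; have W0 : 0 < `|W| + 1 by rewrite ltr_wpDl.
  exists (c / (`|W| + 1)); first by rewrite divr_gt0.
  exists T => t Tt t0; apply: le_trans (HT t Tt t0).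
  by rewrite mulrAC ler_pdivrMr// ler_pM2l//; have := ler_norm W; lra.
have hf0' k : isL2 (f0 k) /\ isL11 (f0 k) by have [[]] := hf0 k.
split=> [n2|hne]; first by subst n; exact: (planar_upper_bound hlm hmu N hf0' hf1 hu).
split=> [n2 HP|n3 HP]; last first.
  case: n hn N f0 f1 hf0 hf1 u hu hf0' n3 HP => // n _ N f0 f1 hf0 hf1 u hu hf0' _ HP.
  apply: cst_bound; apply: (elastic_lower_bound hlm hmu hne _ _ hu HP) => k.
    by have [] := hf0 k.
  by have [] := hf1 k.
subst n.
(* In the plane, a nonzero first moment of any component forces [absPN] to be nonzero for one of the
   data. *)
have HN : absPN f0 N <> 0 \/ absPN f1 N <> 0.
  apply: contrapT => /not_orP[/contrapT h0 /contrapT h1].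
  by apply: HP; rewrite (absP_planar_eq0 h0) (absP_planar_eq0 h1) addr0.
have low := elastic_lower_bound hlm hmu hne (fun k => (hf0 k).2) (fun k => (hf1 k).2) hu HN.
(* With zero total moment of f_1 the right side is free of t and the constant bound suffices;
   otherwise the growing bound dominates all terms. *)
have [M1|M1] := eqVneq (absM f1) 0.
  rewrite M1.
  have [C C0 [T HT]] := cst_bound (absM f0 + (\sum_(k < 2) absP f0 k + \sum_(k < 2) absP f1 k)) _ low.
  by exists C => //; exists T => t Tt t0; rewrite mul0r addr0; exact: HT.
have [c c0 [T HT]] := planar_log_lower_bound N hlm hmu hne
  (fun k => (hf0 k).2) (fun k => (hf1 k).2) hu (elimN eqP M1).
set W := \sum_(k < 2) _ + _; set m0 := absM f0; set m1 := absM f1.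
have m10 : 0 <= m1 by exact: sumr_ge0.
have D0 : 0 < `|m0| + `|W| + m1 + 1 by rewrite ltr_wpDl// !addr_ge0.
exists (c / (`|m0| + `|W| + m1 + 1)); first by rewrite divr_gt0.
(* From t >= e on, sqrt(log(t + 2)) is at least 1, so it also dominates the terms that do not
   grow. *)
exists (Num.max T (expR 1)) => t; rewrite ge_max => /andP[Tt te] t0.
apply: le_trans (HT t Tt t0); rewrite mulrAC ler_pdivrMr// -mulrA ler_pM2l//.
have lnt : 1 <= ln (t + 2) by rewrite -[leLHS]expRK ler_ln ?posrE ?expR_gt0//; lra.
have st : 1 <= Num.sqrt (ln (t + 2)).
  by rewrite -[leLHS]ger0_norm// -sqrtr_sqr ler_wsqrtr// expr1n.
move: (Num.sqrt _) st => s s1.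
have h0 := ler_norm m0; have hW := ler_norm W.
have H : `|m0| + `|W| <= s * (`|m0| + `|W|) by rewrite ler_peMl// addr_ge0.
rewrite !mulrDr in H *; lra.
Qed.
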